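(* Let $N,M$ be positive integers with $NM>1$. Then the Markov-Dyck shift $MD(\widehat G(N,M))$ has two measures of maximal entropy, and its topological entropy is given by $$h\bigl(MD(\widehat G(N,M))\bigr)=\tfrac12\bigl(\log(N+1)+\log(M+1)\bigr).$$
   Context: **Markov-Dyck shift.** Let $G$ be a finite strongly connected directed graph with vertex set $\mathcal V$ and edge set $\mathcal E$, source map $s$, target map $t$, not consisting of a single cycle. Let $\mathcal E^-=\{e^-:e\in\mathcal E\}$ and $\mathcal E^+=\{e^+:e\in\mathcal E\}$ be disjoint copies of $\mathcal E$. The graph inverse semigroup of $G$ is the semigroup with zero generated by $\mathcal E^-\cup\{\mathbf 1_V:V\in\mathcal V\}\cup\mathcal E^+$ with relations $\mathbf 1_V^2=\mathbf 1_V$; $\mathbf 1_U\mathbf 1_W=0$ for $U\ne W$; $e^-=\mathbf 1_{s(e)}e^-=e^-\mathbf 1_{t(e)}$; $e^+=\mathbf 1_{t(e)}e^+=e^+\mathbf 1_{s(e)}$; $f^-f^+=\mathbf 1_{s(f)}$; and $f^-g^+=0$ for $f\neq g$. The Markov-Dyck shift $MD(G)$ is the subshift over the alphabet $\mathcal E^-\cup\mathcal E^+$ whose admissible words are exactly the words whose product in the graph inverse semigroup is nonzero. **The graph $\widehat G(N,M)$.** Its vertices are $V(0)$ and $V(n)$, $1\le n\le N$. Its edges are $f(n)$ from $V(0)$ to $V(n)$ for $1\le n\le N$, and $e(n,m)$ from $V(n)$ to $V(0)$ for $1\le n\le N$, $1\le m\le M$. A measure of maximal entropy is a shift-invariant Borel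 probability measure whose entropy equals the topological entropy. *)

(* Defs.v *)
From HB Require Import structures.
From mathcomp Require Import all_boot all_order all_algebra.
From mathcomp Require Import all_classical all_reals all_analysis.

Set Implicit Arguments.
Unset Strict Implicit.
Unset Printing Implicit Defensive.

Import Order.TTheory GRing.Theory Num.Theory.
Import numFieldNormedType.Exports.

Local Open Scope classical_set_scope.
Local Open Scope ring_scope.

(** * Directed graphs *)

(* Parallel edges and loops are allowed.  The edge [edge0] is only a proof that
   there is an edge: measurable types in MathComp-Analysis are pointed, so the
   space of bi-infinite sequences of edges must have a distinguished point. *)
Record digraph := Digraph {
  vertex : finType;
  edge : finType;
  src : edge -> vertex;
  tgt : edge -> vertex;
  edge0 : edge
}.

(** * The graph inverse semigroup *)

Section GraphInverseSemigroup.
Variable G : digraph.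

Inductive gis_gen :=
| Neg of edge G
| One of vertex G
| Pos of edge G.

(* [Some w] is the word [w] in the generators and [None] is the zero.  The empty
   word is present for convenience only: every defining relation is between
   nonempty words and zero, so no nonempty word is identified with it. *)
Definition gis_word := option (seq gis_gen).

Definition gis_mul (u v : gis_word) : gis_word :=
  if u is Some a then if v is Some b then Some (a ++ b) else None else None.

Inductive gis_rel : gis_word -> gis_word -> Prop :=
| rel_idem V : gis_rel (Some [:: One V; One V]) (Some [:: One V])
| rel_orth U W : U <> W -> gis_rel (Some [:: One U; One W]) None
| rel_neg_src e : gis_rel (Some [:: Neg e]) (Some [:: One (src e); Neg e])
| rel_neg_tgt e : gis_rel (Some [:: Neg e]) (Some [:: Neg e; One (tgt e)])
| rel_pos_tgt e : gis_rel (Some [:: Pos e]) (Some [:: One (tgt e); Pos e])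
| rel_pos_src e : gis_rel (Some [:: Pos e]) (Some [:: Pos e; One (src e)])
| rel_cancel f : gis_rel (Some [:: Neg f; Pos f]) (Some [:: One (src f)])
| rel_clash f g : f <> g -> gis_rel (Some [:: Neg f; Pos g]) None.

(* The congruence generated by the relations; two words represent the same
   element of the graph inverse semigroup iff they are congruent. *)
Inductive gis_eq : gis_word -> gis_word -> Prop :=
| gis_eq_rel u v : gis_rel u v -> gis_eq u v
| gis_eq_refl u : gis_eq u u
| gis_eq_sym u v : gis_eq u v -> gis_eq v u
| gis_eq_trans u v w : gis_eq u v -> gis_eq v w -> gis_eq u w
| gis_eq_mul u u' v v' :
    gis_eq u u' -> gis_eq v v' -> gis_eq (gis_mul u v) (gis_mul u' v').

(** * The Markov-Dyck shift *)

(* [inl e] is the letter e^- and [inr e] is the letter e^+. *)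
Definition letter : Type := (edge G + edge G)%type.
HB.instance Definition _ := Finite.on letter.
HB.instance Definition _ := isPointed.Build letter (inl (edge0 G)).

Definition gen_of_letter (a : letter) : gis_gen :=
  match a with inl e => Neg e | inr e => Pos e end.

Definition nonzero_word (w : seq letter) : Prop :=
  ~ gis_eq (Some (map gen_of_letter w)) None.

End GraphInverseSemigroup.

Definition factor (A : Type) (x : int -> A) (i : int) (n : nat) : n.-tuple A :=
  [tuple x (i + k%:Z) | k < n].

Definition markov_dyck (G : digraph) : set (int -> letter G) :=
  [set x | forall (i : int) (n : nat), (0 < n)%N -> nonzero_word (factor x i n)].
Arguments markov_dyck : clear implicits.

(** * Topological entropy of a subshift *)

Section TopologicalEntropy.
Variables (R : realType) (A : finType) (X : set (int -> A)).

Definition language (n : nat) : {set n.-tuple A} :=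
  [set w | `[< exists2 x, X x & exists i : int, factor x i n = w >]].

Definition topological_entropy : R :=
  limn (fun n : nat => ln (#|language n|%:R : R) / n%:R).

End TopologicalEntropy.

(** * Kolmogorov-Sinai entropy *)

Section MeasureEntropy.
Context d (T : measurableType d) (R : realType).
Variables (S : T -> T) (mu : probability T R).

Definition invariant_measure : Prop :=
  forall B : set T, measurable B -> mu (S @^-1` B) = mu B.

Definition ergodic : Prop :=
  forall B : set T, measurable B -> S @^-1` B = B -> mu B = 0%E \/ mu B = 1%E.

(* A finite measurable partition is given by its labelling map; some of the
   labels may be unused. *)
Definition measurable_partition (k : nat) (xi : T -> 'I_k) : Prop :=
  forall c : 'I_k, measurable (xi @^-1` [set c]).

Section Partition.
Variables (k : nat) (xi : T -> 'I_k).

(* The cell with itinerary [w] of the join of xi, S^-1 xi, ..., S^-(n-1) xi. *)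
Definition join_cell (n : nat) (w : n.-tuple 'I_k) : set T :=
  [set x | forall i : 'I_n, xi (iter i S x) = tnth w i].

(* Here 0 ln 0 = 0. *)
Definition join_entropy (n : nat) : R :=
  - \sum_(w : n.-tuple 'I_k)
      fine (mu (join_cell w)) * ln (fine (mu (join_cell w))).

Definition partition_entropy : R :=
  limn (fun n : nat => join_entropy n / n%:R).

End Partition.

Definition measure_entropy : \bar R :=
  ereal_sup [set h | exists k (xi : T -> 'I_k),
    measurable_partition xi /\ h = (partition_entropy xi)%:E].

End MeasureEntropy.

(** * Borel measures on the Markov-Dyck shift *)

(* The full shift over the letters of G: the Borel sigma-algebra of the product
   of the discrete topologies. *)
Definition borel_full_shift (G : digraph) :=
  g_sigma_algebraType (@open {ptws int -> discrete_topology (letter G)}).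

Definition shift (G : digraph) (x : borel_full_shift G) : borel_full_shift G :=
  fun i => x (i + 1).

(* Borel probability measures on the closed subset MD(G) are identified with
   Borel probability measures on the full shift that give MD(G) mass one. *)
Definition max_entropy_measure (R : realType) (G : digraph)
    (mu : probability (borel_full_shift G) R) : Prop :=
  [/\ mu (markov_dyck G) = 1%E,
      invariant_measure (@shift G) mu
    & measure_entropy (@shift G) mu
      = (topological_entropy R (markov_dyck G))%:E].

Definition ergodic_max_entropy_measure (R : realType) (G : digraph)
    (mu : probability (borel_full_shift G) R) : Prop :=
  max_entropy_measure mu /\ ergodic (@shift G) mu.

(* Library measures are functions on all sets, of which only the values on
   measurable sets are meaningful. *)
Definition same_measure d (T : measurableType d) (R : realType)
    (mu nu : probability T R) : Prop :=
  forall B : set T, measurable B -> mu B = nu B.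

(** * The graph G^(N, M) *)

(* [None] is V(0) and [Some n] is V(n); [inl n] is f(n) and [inr (n, m)] is
   e(n, m).  Indices start from 0 instead of 1. *)
Definition Ghat_src (N M : nat) (a : 'I_N + 'I_N * 'I_M) : option 'I_N :=
  match a with inl _ => None | inr (n, _) => Some n end.

Definition Ghat_tgt (N M : nat) (a : 'I_N + 'I_N * 'I_M) : option 'I_N :=
  match a with inl n => Some n | inr _ => None end.

Definition Ghat (N M : nat) (hN : (0 < N)%N) : digraph :=
  @Digraph (option 'I_N) ('I_N + 'I_N * 'I_M)%type
    (@Ghat_src N M) (@Ghat_tgt N M) (inl (Ordinal hN)).

(* Main.v *)
From HB Require Import structures.
From mathcomp Require Import all_boot all_order all_algebra.
From mathcomp Require Import all_classical all_reals all_analysis.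
From mathcomp Require Import zify ring lra.
Require Import Defs.

Set Implicit Arguments.
Unset Strict Implicit.
Unset Printing Implicit Defensive.

Import Order.TTheory GRing.Theory Num.Theory.
Import numFieldNormedType.Exports.

Local Open Scope classical_set_scope.
Local Open Scope ring_scope.

(* Idea.  Read a point of the Markov-Dyck shift from a passage through V(0) in
   blocks of two letters.  A block has one of (N + 1)(M + 1) codes: its first
   letter is some f(n)^- or closes an open e(n, m), its second letter is some
   e(n, m)^- or closes an open f(n).  What a closing letter is follows from the
   stack of open edges, so the codes determine the point as soon as every closing
   letter matches an earlier opening letter.  For independent uniform codes the
   height of the stack drifts upwards by (NM - 1)/((N + 1)(M + 1)) per block,
   hence almost every code sequence decodes; averaging the law of the decoded
   point with its shift gives an ergodic measure of entropy
   h = ln((N + 1)(M + 1))/2.  The number of words of length n is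
   exp(n h + O(ln n)), by a harmonic function for the height of the stack, so h is
   the topological entropy.

   Conversely, let mu be ergodic of entropy h.  An unmatched closing letter always
   precedes an unmatched opening letter, so by ergodicity one of the two kinds
   does not occur; reversing time, let it be the closing letters.  Then the codes
   generate up to a vanishing rate, so they have maximal entropy, hence are
   independent and uniform, and mu is the measure above.  It gives closing letters
   probability (1/(N + 1) + 1/(M + 1))/2 < 1/2, so it differs from its reversal. *)

(** * Entropy and stationary processes *)

(** Two measures are counted among the ergodic ones, since mixtures of maximal measures are again
    maximal. Every edge joins V(0) to another vertex, so passages through V(0) have period two; the
    codes therefore form a process over the square of the shift, and a single phase alone would not
    be invariant. Given the codes of [l] blocks, a word is undetermined only where a block reads
    below the part of the stack built since the first block, and each such underflow multiplies the
    number of words by [N * M]. Summed over all code sequences, these multiplicities cost only a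
    factor linear in [l], which bounds the language from above; the bound from below is the entropy
    of the measure already constructed. If almost every closing letter is matched, an underflow at
    block [j] has a probability tending to 0, because its closing letter has no partner among the
    [2 * j] letters before it; Cesaro averaging then makes the conditional entropy of the word o(l).
    The two kinds of unmatched letters exclude each other because a last unmatched closing letter
    would be a position chosen equivariantly, and no position is preferred by an invariant
    measure. *)

Section FiniteEntropy.
Context (R : realType) (C : finType) (p : C -> R).
Hypotheses (p_ge0 : forall c, 0 <= p c) (p_sum1 : \sum_c p c = 1).

Definition law_of (A : eqType) (f : C -> A) (a : A) : R := \sum_(c | f c == a) p c.

(** Written as an expectation over [C], so that comparing entropies amounts to comparing logarithms
    point by point. *)
Definition entropy_of (A : eqType) (f : C -> A) : R :=
  - \sum_c p c * ln (law_of f (f c)).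

Lemma law_of_ge0 (A : eqType) (f : C -> A) a : 0 <= law_of f a.
Proof. exact: sumr_ge0. Qed.

Lemma law_of_ge (A : eqType) (f : C -> A) c : p c <= law_of f (f c).
Proof. by rewrite /law_of (bigD1 c) //= lerDl sumr_ge0. Qed.

Lemma law_of_gt0 (A : eqType) (f : C -> A) c : 0 < p c -> 0 < law_of f (f c).
Proof. by move=> /lt_le_trans; apply; exact: law_of_ge. Qed.

Lemma sum_law_of (A : finType) (f : C -> A) (g : A -> R) :
  \sum_a law_of f a * g a = \sum_c p c * g (f c).
Proof.
rewrite (partition_big f xpredT) //=; apply: eq_bigr => a _.
by rewrite /law_of mulr_suml; apply: eq_bigr => c /eqP ->.
Qed.

Lemma sum_law_of1 (A : finType) (f : C -> A) : \sum_a law_of f a = 1.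
Proof.
have := sum_law_of f (fun=> 1).
by rewrite (eq_bigr _ (fun _ _ => mulr1 _)) (eq_bigr _ (fun _ _ => mulr1 _)) p_sum1.
Qed.

Lemma entropy_of_fin (A : finType) (f : C -> A) :
  entropy_of f = - \sum_a law_of f a * ln (law_of f a).
Proof. by rewrite sum_law_of. Qed.

(* Gibbs' inequality for the law of [(f, g)] against the law of [g] followed by
   the subprobability kernel [Q]. *)
Lemma entropy_of_kernel (A B : finType) (f : C -> A) (g : C -> B) (Q : A -> B -> R) :
  (forall a b, 0 <= Q a b) -> (forall b, \sum_a Q a b <= 1) ->
  (forall c, 0 < p c -> 0 < Q (f c) (g c)) ->
  entropy_of f <= entropy_of g - \sum_c p c * ln (Q (f c) (g c)).
Proof.
move=> Q0 Q1 Qp; pose h c := (f c, g c).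
suff: \sum_c p c * (ln (law_of g (g c)) + ln (Q (f c) (g c)) - ln (law_of f (f c)))
    <= 0.
  rewrite (eq_bigr (fun c => p c * ln (law_of g (g c)) + p c * ln (Q (f c) (g c))
    - p c * ln (law_of f (f c)))); last by move=> c _; ring.
  rewrite sumrB big_split /entropy_of /=; lra.
(* [t] is the density of the model, the law of [g] followed by [Q], against the joint law:
   [ln t <= t - 1], and the mean of [t] is at most 1. *)
pose t c := law_of g (g c) * Q (f c) (g c) / law_of h (h c).
apply: (@le_trans _ _ (\sum_c p c * (t c - 1))).
  apply: ler_sum => c _; have := p_ge0 c; rewrite le_eqVlt => /predU1P[<-|pc].
    by rewrite !mul0r.
  apply: ler_wpM2l => //.
  have hc : 0 < law_of h (h c) by exact: law_of_gt0.
  have gc : 0 < law_of g (g c) by exact: law_of_gt0.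
  have fc : 0 < law_of f (f c) by exact: law_of_gt0.
  have qc := Qp _ pc.
  (* The joint law lies below the law of [f], so the bound for the pair passes to [f]. *)
  have hf : ln (law_of h (h c)) <= ln (law_of f (f c)).
    rewrite ler_ln ?posrE // /law_of [leRHS]big_mkcond [leLHS]big_mkcond /=.
    apply: ler_sum => c' _; rewrite /h xpair_eqE.
    by case: eqP => //= _; case: ifP.
  have t0 : 0 < t c by rewrite /t divr_gt0 // mulr_gt0.
  have : ln (t c) <= t c - 1.
    rewrite -{1}(subrK 1 (t c)) addrC; apply: le_ln1Dx; lra.
  rewrite /t lnM ?posrE ?mulr_gt0 ?invr_gt0 // lnM ?posrE // lnV ?posrE //.
  lra.
rewrite (eq_bigr (fun c => p c * t c - p c)); last by move=> c _; ring.
rewrite sumrB p_sum1 subr_le0.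
rewrite (eq_bigr (fun c => p c * (law_of g (h c).2 * Q (h c).1 (h c).2 /
  law_of h (h c)))) //.
rewrite -(sum_law_of h (fun ab => law_of g ab.2 * Q ab.1 ab.2 / law_of h ab)).
apply: (@le_trans _ _ (\sum_(ab : A * B) law_of g ab.2 * Q ab.1 ab.2)).
  apply: ler_sum => -[a b] _ /=.
  have := law_of_ge0 h (a, b); rewrite le_eqVlt => /predU1P[<-|hp].
    by rewrite mul0r mulr_ge0 ?law_of_ge0.
  by rewrite mulrC divfK // gt_eqF.
rewrite -(pair_bigA _ (fun a b => law_of g b * Q a b)) exchange_big /=.
rewrite -[leRHS](sum_law_of1 g); apply: ler_sum => b _.
by rewrite -mulr_sumr ler_piMr ?law_of_ge0.
Qed.

(** The deterministic kernel has logarithmic cost 0. *)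
Lemma entropy_of_comp (A B : finType) (f : C -> A) (h : A -> B) :
  entropy_of (h \o f) <= entropy_of f.
Proof.
have := @entropy_of_kernel B A (h \o f) f (fun b a => (b == h a)%:R).
rewrite big1 ?subr0; last by move=> c _; rewrite /= eqxx ln1 mulr0.
apply=> [b a|a|c _]; first exact: ler0n.
  by rewrite (bigD1 (h a)) //= eqxx big1 ?addr0 // => b /negbTE ->.
by rewrite /= eqxx ltr01.
Qed.

(** The kernel guesses the first component by its own law, ignoring the second, and copies the
    second. *)
Lemma entropy_of_pair (A B : finType) (f : C -> A) (g : C -> B) :
  entropy_of (fun c => (f c, g c)) <= entropy_of f + entropy_of g.
Proof.
have := @entropy_of_kernel _ _ (fun c => (f c, g c)) g
  (fun ab b => law_of f ab.1 * (ab.2 == b)%:R).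
rewrite [X in _ - X](eq_bigr (fun c => p c * ln (law_of f (f c)))); last first.
  by move=> c _; rewrite /= eqxx mulr1n mulr1.
rewrite [entropy_of f]/entropy_of [leRHS]addrC; apply=> [ab b|b|c pc].
- by rewrite mulr_ge0 ?law_of_ge0 ?ler0n.
- rewrite -(pair_bigA _ (fun a b' => law_of f a * (b' == b)%:R)) /=.
  rewrite -[leRHS](sum_law_of1 f); apply: ler_sum => a _.
  by rewrite (bigD1 b) //= eqxx mulr1n mulr1 big1 ?addr0 // => b' /negbTE ->; rewrite mulr0.
- by rewrite /= eqxx mulr1n mulr1 law_of_gt0.
Qed.

(** Uniform kernel on the list [F b]; repetitions in the list only lower its total mass below 1. *)
Lemma entropy_of_fibre (A B : finType) (f : C -> A) (g : C -> B) (F : B -> seq A) :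
  (forall c, 0 < p c -> f c \in F (g c)) ->
  entropy_of f <= entropy_of g + \sum_c p c * ln ((size (F (g c)))%:R).
Proof.
move=> Ff.
have := @entropy_of_kernel _ _ f g (fun a b => (a \in F b)%:R / (size (F b))%:R).
have -> : \sum_c p c * ln ((f c \in F (g c))%:R / (size (F (g c)))%:R : R) =
    - \sum_c p c * ln (size (F (g c)))%:R.
  rewrite -sumrN; apply: eq_bigr => c _.
  have := p_ge0 c; rewrite le_eqVlt => /predU1P[<-|pc]; first by rewrite !mul0r oppr0.
  rewrite Ff // mul1r lnV ?mulrN // posrE ltr0n.
  by have := Ff _ pc; case: (F (g c)).
rewrite opprK; apply=> [a b|b|c pc].
- by rewrite divr_ge0 ?ler0n.
- have -> : \sum_a (a \in F b)%:R / (size (F b))%:R = #|F b|%:R / (size (F b))%:R :> R.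
    rewrite -mulr_suml -sum1_card natr_sum big_mkcond /=; congr (_ / _).
    by rewrite [RHS]big_mkcond; apply: eq_bigr => a _; case: (a \in F b).
  case: (posnP (size (F b))) => [->|s0]; first by rewrite invr0 mulr0.
  by rewrite ler_pdivrMr ?ltr0n // mul1r ler_nat card_size.
- rewrite Ff // mul1r invr_gt0 ltr0n.
  by have := Ff _ pc; case: (F (g c)).
Qed.

Lemma entropy_of_count (A : finType) (f : C -> A) (s : seq A) :
  (forall c, 0 < p c -> f c \in s) -> entropy_of f <= ln (size s)%:R.
Proof.
move=> fs; have := @entropy_of_fibre _ _ f (fun=> tt) (fun=> s) fs.
rewrite -mulr_suml p_sum1 mul1r => /le_trans; apply.
rewrite gerDr /entropy_of.
rewrite (eq_bigr (fun=> 0)) ?sumr_const ?mul0rn ?oppr0 // => c _.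
by rewrite [law_of _ _](_ : _ = 1) ?ln1 ?mulr0 // -p_sum1; apply: eq_bigl.
Qed.

Lemma entropy_of_ge (A : eqType) (f : C -> A) (e : R) :
  (forall c, 0 < p c -> law_of f (f c) <= e) -> - ln e <= entropy_of f.
Proof.
move=> fe; rewrite lerN2 -[leRHS]mul1r -p_sum1 mulr_suml; apply: ler_sum => c _.
have := p_ge0 c; rewrite le_eqVlt => /predU1P[<-|pc]; first by rewrite !mul0r.
have lc := law_of_gt0 f pc.
by rewrite ler_wpM2l // ler_ln ?posrE ?fe // (lt_le_trans lc) ?fe.
Qed.

(** Source of uniqueness: a process all of whose words have the largest possible entropy has uniform
    words. *)
Lemma entropy_of_uniform (A : finType) (f : C -> A) (a : A) :
  ln #|A|%:R <= entropy_of f -> law_of f a = #|A|%:R^-1.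
Proof.
move=> fA; pose u : R := #|A|%:R^-1; pose q := law_of f.
have A0 : 0 < #|A|%:R :> R by rewrite ltr0n; apply/card_gt0P; exists a.
have u0 : 0 < u by rewrite invr_gt0.
have q0 b : 0 <= q b by exact: law_of_ge0.
have q1 : \sum_b q b = 1 by exact: sum_law_of1.
have u1 : \sum_(b : A) u = 1.
  by rewrite sumr_const -mulr_natl mulfV // gt_eqF.
(* [ln t <= 2 (sqrt t - 1)] turns Gibbs' inequality into a sum of squares. *)
have key b : q b * ln u - q b * ln (q b) <=
    - (Num.sqrt u - Num.sqrt (q b)) ^+ 2 + (u - q b).
  rewrite sqrrB !sqr_sqrtr ?(ltW u0) //.
  have := q0 b; rewrite le_eqVlt => /predU1P[<-|qb].
    by rewrite !mul0r sqrtr0 mulr0 mul0rn; lra.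
  pose s := Num.sqrt u / Num.sqrt (q b).
  have s0 : 0 < s by rewrite divr_gt0 ?sqrtr_gt0.
  have e : ln u - ln (q b) = 2 * ln s.
    rewrite -{1}(sqr_sqrtr (ltW u0)) -{1}(sqr_sqrtr (ltW qb)).
    rewrite !lnXn ?sqrtr_gt0 // /s lnM ?posrE ?invr_gt0 ?sqrtr_gt0 //.
    by rewrite lnV ?posrE ?sqrtr_gt0 //; ring.
  have : ln s <= s - 1 by rewrite -{1}(subrK 1 s) addrC; apply: le_ln1Dx; lra.
  rewrite -mulrBr e => ls.
  have -> : Num.sqrt u * Num.sqrt (q b) = q b * s.
    rewrite /s -{2}(sqr_sqrtr (ltW qb)); field.
    by rewrite gt_eqF ?sqrtr_gt0.
  apply: (@le_trans _ _ (q b * (2 * (s - 1)))); last lra.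
  by rewrite ler_wpM2l //; lra.
have sq0 : \sum_b (Num.sqrt u - Num.sqrt (q b)) ^+ 2 <= 0.
  have := ler_sum (index_enum A) (fun b (_ : true) => key b).
  rewrite sumrB big_split /= sumrB sumrN -mulr_suml u1 q1 mul1r.
  move: fA; rewrite entropy_of_fin -/q {1}/u lnV ?posrE //; lra.
have /eqP : Num.sqrt u - Num.sqrt (q a) = 0.
  apply/eqP; rewrite -sqrf_eq0 eq_le sqr_ge0 andbT; apply: le_trans sq0.
  by rewrite (bigD1 a) //= lerDl sumr_ge0 // => b _; rewrite sqr_ge0.
rewrite subr_eq0 => /eqP/(congr1 (fun x => x ^+ 2)).
by rewrite !sqr_sqrtr ?(ltW u0) // => ->.
Qed.

End FiniteEntropy.

(** Fekete's lemma. The bound on every term turns a lower bound for an entropy rate into one for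
    words of each length. *)
Lemma subadditive_cvg (R : realType) (u : nat -> R) :
  (forall n, 0 <= u n) -> (forall m n, u (m + n)%N <= u m + u n) ->
  exists2 L : R, (fun n => u n / n%:R) @ \oo --> L
    & forall n, (0 < n)%N -> L <= u n / n%:R.
Proof.
move=> u0 uD.
pose V := [set u n / n%:R | n in [set n | (0 < n)%N]].
have V0 : has_inf V.
  split; first by exists (u 1%N / 1%:R); exists 1%N.
  by exists 0 => _ [n _ <-]; rewrite divr_ge0.
have VL n : (0 < n)%N -> inf V <= u n / n%:R.
  by move=> n0; apply: ge_inf; [case: V0|exists n].
exists (inf V) => //.
have umul m q : u (q * m + 0)%N <= q%:R * u m + u 0%N.
  elim: q => [|q IH]; first by rewrite mul0n mul0r add0r.
  by rewrite mulSn -addnA; apply: (le_trans (uD _ _)); rewrite -natr1; lra.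
apply/cvgrPdist_le => e e0.
have [_ [m m0 <-] hm] := inf_adherent (divr_gt0 e0 (ltr0Sn R 1)) V0.
(* [K] absorbs the remainder modulo [m] and the term [u 0] of [umul], which subadditivity does not
   force to vanish. *)
pose K := u 0%N + \sum_(r < m) u r.
have K0 : 0 <= K by rewrite addr_ge0 ?sumr_ge0.
near=> n.
have n0 : (0 < n)%N by near: n; exact: nbhs_infty_gt.
have nR : 0 < n%:R :> R by rewrite ltr0n.
have mR : 0 < m%:R :> R by rewrite ltr0n.
have hn : K / (e / 2) <= n%:R by near: n; exact: nbhs_infty_ger.
have Ln := VL _ n0.
rewrite ler_distlC; apply/andP; split; first by lra.
have un : u n <= n%:R * (u m / m%:R) + K.
  rewrite {1}(divn_eq n m); apply: (le_trans (uD _ _)).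
  rewrite /K addrA; apply: lerD.
    rewrite -[X in u X]addn0; apply: (le_trans (umul _ _)); rewrite lerD2r.
    rewrite mulrCA [leLHS]mulrC; apply: ler_wpM2l => //.
    by rewrite ler_pdivlMr // -natrM ler_nat leq_divM.
  rewrite (bigD1 (Ordinal (ltn_pmod n m0))) //= lerDl.
  by rewrite sumr_ge0.
have : u n / n%:R <= u m / m%:R + K / n%:R.
  rewrite ler_pdivrMr // mulrDl divfK ?gt_eqF // [_ / _ * n%:R]mulrC //.
have : K / n%:R <= e / 2.
  by rewrite ler_pdivrMr // mulrC -ler_pdivrMr // divr_gt0.
lra.
Unshelve. all: by end_near.
Qed.

(** * Finite-valued random variables and their entropy *)

Section DiscreteMaps.
Context d (T : measurableType d).

Lemma measurable_bigcup_count (I : countType) (F : I -> set T) :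
  (forall i, measurable (F i)) -> measurable (\bigcup_i F i).
Proof. by apply: countable_bigcupT_measurable; exact: countableP. Qed.

Lemma measurable_bigcap_count (I : countType) (F : I -> set T) :
  (forall i, measurable (F i)) -> measurable (\bigcap_i F i).
Proof.
move=> mF; rewrite -[X in measurable X]setCK setC_bigcap; apply: measurableC.
by apply: measurable_bigcup_count => i; exact: measurableC.
Qed.

(** A finite-valued random variable; no sigma-algebra is put on [C]. *)
Definition discrete (C : finType) (Z : T -> C) :=
  forall c, measurable (Z @^-1` [set c]).

Lemma discrete_pred (C : finType) (Z : T -> C) (P : pred C) :
  discrete Z -> measurable [set x | P (Z x)].
Proof.
move=> mZ; rewrite (_ : mkset _ = \bigcup_(c in [set c | P c]) (Z @^-1` [set c])).
  by apply: fin_bigcup_measurable => // c _; exact: mZ.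
by apply/seteqP; split=> x /= => [Px|[c Pc ->]//]; exists (Z x).
Qed.

Lemma discrete_comp (C A : finType) (Z : T -> C) (f : C -> A) :
  discrete Z -> discrete (f \o Z).
Proof.
move=> mZ a; rewrite (_ : _ @^-1` _ = [set x | pred1 a (f (Z x))]).
  exact: (discrete_pred (fun c => f c == a) mZ).
by apply/seteqP; split=> x /=; [move=> ->|move/eqP].
Qed.

Lemma discrete_pair (A B : finType) (X : T -> A) (Y : T -> B) :
  discrete X -> discrete Y -> discrete (fun x => (X x, Y x)).
Proof.
move=> mX mY [a b]; rewrite (_ : _ @^-1` _ = X @^-1` [set a] `&` Y @^-1` [set b]).
  exact: measurableI.
by apply/seteqP; split=> x /= [-> ->].
Qed.

Lemma discrete_tuple (A : finType) n (X : 'I_n -> T -> A) :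
  (forall i, discrete (X i)) -> discrete (fun x => [tuple X i x | i < n]).
Proof.
move=> mX w; rewrite (_ : _ @^-1` _ = \bigcap_(i in [set: 'I_n]) (X i @^-1` [set tnth w i])).
  by apply: fin_bigcap_measurable => // i _; exact: mX.
apply/seteqP; split=> x /= => [<- i _|h]; first by rewrite tnth_mktuple.
by apply: eq_from_tnth => i; rewrite tnth_mktuple; exact: h.
Qed.

End DiscreteMaps.

Section DiscreteRandomVariables.
Context d (T : measurableType d) (R : realType) (mu : probability T R).

Definition pr (E : set T) : R := fine (mu E).

Lemma prE (E : set T) : measurable E -> mu E = (pr E)%:E.
Proof. by move=> mE; rewrite /pr fineK // fin_num_measure. Qed.

Lemma pr_ge0 E : 0 <= pr E.
Proof. exact: fine_ge0. Qed.

Lemma le_pr E F : measurable E -> measurable F -> E `<=` F -> pr E <= pr F.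
Proof.
by move=> mE mF EF; rewrite -lee_fin -!prE //; apply: le_measure; rewrite ?inE.
Qed.

Lemma prT : pr setT = 1.
Proof. by rewrite /pr probability_setT. Qed.

Lemma pr0 : pr set0 = 0.
Proof. by rewrite /pr measure0. Qed.

Lemma prU E F : measurable E -> measurable F -> E `&` F = set0 ->
  pr (E `|` F) = pr E + pr F.
Proof.
move=> mE mF EF; apply: EFin_inj; rewrite EFinD -!prE //; last exact: measurableU.
by rewrite measureU.
Qed.

Lemma prC E : measurable E -> pr (~` E) = 1 - pr E.
Proof.
move=> mE; have := prU mE (measurableC mE) (setICr E).
by rewrite setUCr prT; lra.
Qed.

Lemma pr_le1 E : measurable E -> pr E <= 1.
Proof. by move=> mE; rewrite -prT le_pr. Qed.

Lemma le_prU E F : measurable E -> measurable F -> pr (E `|` F) <= pr E + pr F.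
Proof.
move=> mE mF; rewrite -lee_fin EFinD -!prE //; last exact: measurableU.
exact: measureU2.
Qed.

Lemma pr_cvgU (F : (set T)^nat) : (forall n, measurable (F n)) ->
  {homo F : n m / (n <= m)%N >-> n `<=` m} ->
  (fun n => pr (F n)) @ \oo --> pr (\bigcup_n F n).
Proof.
move=> mF ndF; have mU := bigcup_measurable (fun k (_ : setT k) => mF k).
apply: (@fine_cvg _ _ _ _ (mu \o F)); rewrite -prE //.
by apply: nondecreasing_cvg_mu => // n m nm; apply/subsetPset; exact: ndF.
Qed.

Lemma pr_cvgI (F : (set T)^nat) : (forall n, measurable (F n)) ->
  {homo F : n m / (n <= m)%N >-> m `<=` n} ->
  (fun n => pr (F n)) @ \oo --> pr (\bigcap_n F n).
Proof.
move=> mF ndF; have mU := bigcap_measurable (ex_intro _ 0%N I) (fun k (_ : setT k) => mF k).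
apply: (@fine_cvg _ _ _ _ (mu \o F)); rewrite -prE //.
apply: nonincreasing_cvg_mu => //.
  by apply: (le_lt_trans (probability_le1 mu (mF 0%N))); rewrite ltry.
by move=> n m nm; apply/subsetPset; exact: ndF.
Qed.

Lemma pr_bigcup0 (I : countType) (F : I -> set T) : (forall i, measurable (F i)) ->
  (forall i, pr (F i) = 0) -> pr (\bigcup_i F i) = 0.
Proof.
move=> mF F0; pose G n := if unpickle n is Some i then F i else set0.
have -> : \bigcup_i F i = \bigcup_n G n.
  apply/seteqP; split=> [x [i _ Fx]|x [n _]].
    by exists (pickle i) => //; rewrite /G pickleK.
  by rewrite /G; case: unpickle => // i Fx; exists i.
have mG n : measurable (G n) by rewrite /G; case: unpickle.
suff : mu (\bigcup_n G n) = 0%E by rewrite /pr => ->.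
apply: measure_negligible; first exact: bigcup_measurable.
apply: negligible_bigcup => n; exists (G n); split => //.
rewrite /G; case: unpickle => [i|]; last exact: measure0.
by apply: (etrans (prE (mF i))); rewrite F0.
Qed.

Lemma pr_bigcap1 (I : countType) (F : I -> set T) : (forall i, measurable (F i)) ->
  (forall i, pr (F i) = 1) -> pr (\bigcap_i F i) = 1.
Proof.
move=> mF F1; rewrite -[X in pr X]setCK setC_bigcap prC; last first.
  by apply: measurable_bigcup_count => i; exact: measurableC.
by rewrite pr_bigcup0 ?subr0 // => i; [exact: measurableC|rewrite prC // F1 subrr].
Qed.

Lemma pr_setI1 E F : measurable E -> measurable F -> pr F = 1 -> pr (E `&` F) = pr E.
Proof.
move=> mE mF F1; have mEF := measurableI _ _ mE mF.
have EF : measurable (E `\` F) by exact: measurableD.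
have -> : pr E = pr (E `&` F) + pr (E `\` F).
  by rewrite -prU ?setUIDK // setDE setIACA setICr setI0.
rewrite (_ : pr (E `\` F) = 0) ?addr0 //; apply/eqP; rewrite eq_le pr_ge0 andbT.
rewrite -(subrr (1 : R)) -[X in _ <= _ - X]F1 -prC //.
by apply: le_pr => //; exact: measurableC.
Qed.

Lemma eq_pr_ae E F N : measurable E -> measurable F -> measurable N -> pr N = 1 ->
  (forall x, N x -> E x <-> F x) -> pr E = pr F.
Proof.
move=> mE mF mN N1 EF; rewrite -(pr_setI1 mE mN N1) -(pr_setI1 mF mN N1).
by congr pr; apply/seteqP; split=> x [? Nx]; split=> //; apply/(EF x Nx).
Qed.

Section Pmf.
Context (C : finType).
Implicit Type Z : T -> C.

Definition pmf Z c : R := pr (Z @^-1` [set c]).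

Lemma pmf_ge0 Z c : 0 <= pmf Z c. Proof. exact: pr_ge0. Qed.

Lemma pr_mem Z (s : seq C) : discrete Z -> uniq s ->
  pr [set x | Z x \in s] = \sum_(c <- s) pmf Z c.
Proof.
move=> mZ; elim: s => [_|c s IH /= /andP[cs /IH es]].
  by rewrite big_nil (_ : mkset _ = set0) ?pr0 //; apply/seteqP; split.
have -> : [set x | Z x \in c :: s] = Z @^-1` [set c] `|` [set x | Z x \in s].
  apply/seteqP; split=> x /=; rewrite inE.
    by case/predU1P => [->|]; [left|right].
  by case=> [->|->]; rewrite ?eqxx ?orbT.
rewrite big_cons -es prU //.
  exact: (discrete_pred (fun c => c \in s) mZ).
apply/seteqP; split => // x [/= ->].
by rewrite (negbTE cs).
Qed.

Lemma pr_pred Z (P : pred C) : discrete Z ->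
  pr [set x | P (Z x)] = \sum_(c | P c) pmf Z c.
Proof.
move=> mZ; have := pr_mem mZ (enum_uniq P).
rewrite big_enum /= => <-.
by congr pr; apply/seteqP; split => x /=; rewrite mem_enum.
Qed.

Lemma sum_pmf Z : discrete Z -> \sum_c pmf Z c = 1.
Proof.
by move=> mZ; rewrite -(pr_pred xpredT mZ) -prT; congr pr; apply/seteqP; split.
Qed.

Definition entropy Z : R := entropy_of (pmf Z) id.

End Pmf.

Section PmfComp.
Context (C : finType) (Z : T -> C) (mZ : discrete Z).

Lemma law_of_pmf (A : finType) (f : C -> A) a : law_of (pmf Z) f a = pmf (f \o Z) a.
Proof.
rewrite /law_of -(pr_pred (fun c => f c == a) mZ); congr pr.
by apply/seteqP; split=> x /=; [move/eqP|move=> ->].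
Qed.

Lemma entropy_of_pmf (A : finType) (f : C -> A) : entropy_of (pmf Z) f = entropy (f \o Z).
Proof.
rewrite /entropy !entropy_of_fin; congr (- _); apply: eq_bigr => a _.
have -> : law_of (pmf (f \o Z)) id a = pmf (f \o Z) a.
  rewrite /law_of (bigD1 a) //= big1 ?addr0 // => b /andP[/eqP ->].
  by rewrite eqxx.
by rewrite law_of_pmf.
Qed.

Lemma sum_pmf_comp (A : finType) (f : C -> A) (g : A -> R) :
  \sum_c pmf Z c * g (f c) = \sum_a pmf (f \o Z) a * g a.
Proof.
by rewrite -sum_law_of; apply: eq_bigr => a _; rewrite law_of_pmf.
Qed.

Lemma entropy_kernel (A B : finType) (f : C -> A) (g : C -> B) (Q : A -> B -> R) :
  (forall a b, 0 <= Q a b) -> (forall b, \sum_a Q a b <= 1) ->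
  (forall c, 0 < pmf Z c -> 0 < Q (f c) (g c)) ->
  entropy (f \o Z) <= entropy (g \o Z) - \sum_c pmf Z c * ln (Q (f c) (g c)).
Proof.
rewrite -(entropy_of_pmf f) -(entropy_of_pmf g).
exact: (entropy_of_kernel (@pmf_ge0 _ Z) (sum_pmf mZ)).
Qed.

Lemma entropy_comp (A : finType) (f : C -> A) : entropy (f \o Z) <= entropy Z.
Proof.
rewrite -!entropy_of_pmf.
have := entropy_of_comp (@pmf_ge0 _ Z) (sum_pmf mZ) id f; exact.
Qed.

Lemma entropy_fibre (A B : finType) (f : C -> A) (g : C -> B) (F : B -> seq A) :
  (forall c, 0 < pmf Z c -> f c \in F (g c)) ->
  entropy (f \o Z) <= entropy (g \o Z) + \sum_c pmf Z c * ln ((size (F (g c)))%:R).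
Proof.
rewrite -(entropy_of_pmf f) -(entropy_of_pmf g).
exact: (entropy_of_fibre (@pmf_ge0 _ Z) (sum_pmf mZ)).
Qed.

Lemma entropy_count (s : seq C) :
  (forall c, 0 < pmf Z c -> c \in s) -> entropy Z <= ln (size s)%:R.
Proof. by apply: (entropy_of_count (@pmf_ge0 _ Z) (sum_pmf mZ)). Qed.

Lemma entropy_ge (e : R) : (forall c, pmf Z c <= e) -> - ln e <= entropy Z.
Proof.
move=> Ze; apply: (entropy_of_ge (@pmf_ge0 _ Z) (sum_pmf mZ)) => c _.
by rewrite law_of_pmf.
Qed.

Lemma entropy_uniform (c : C) : ln #|C|%:R <= entropy Z -> pmf Z c = #|C|%:R^-1.
Proof.
move=> h; rewrite -(entropy_of_uniform (@pmf_ge0 _ Z) (sum_pmf mZ) c h).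
by rewrite law_of_pmf.
Qed.

End PmfComp.

Lemma entropy_pair (A B : finType) (X : T -> A) (Y : T -> B) :
  discrete X -> discrete Y -> entropy (fun x => (X x, Y x)) <= entropy X + entropy Y.
Proof.
move=> mX mY; have mZ := discrete_pair mX mY.
have := entropy_of_pair (@pmf_ge0 _ (fun x => (X x, Y x))) (sum_pmf mZ) fst snd.
by rewrite !entropy_of_pmf.
Qed.

End DiscreteRandomVariables.

Lemma sum_tuple_prod (R : comPzSemiRingType) (A : finType) n (F : 'I_n -> A -> R) :
  \sum_(w : n.-tuple A) \prod_(i < n) F i (tnth w i) = \prod_(i < n) \sum_a F i a.
Proof.
rewrite bigA_distr_bigA /= (reindex (fun w : n.-tuple A => [ffun i => tnth w i])) /=.
  by apply: eq_bigr => w _; apply: eq_bigr => i _; rewrite ffunE.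
exists (fun f : {ffun 'I_n -> A} => [tuple f i | i < n]) => [w|f] _.
  by apply: eq_from_tnth => i; rewrite tnth_mktuple ffunE.
by apply/ffunP => i; rewrite ffunE tnth_mktuple.
Qed.

Lemma cvg_div_natr (R : realType) (c : R) : (fun n => c / n%:R) @ \oo --> (0 : R).
Proof.
rewrite -[X in _ --> X](mulr0 c); apply: cvgM; first exact: cvg_cst.
by rewrite -cvg_shiftS /=; exact: cvg_harmonic.
Qed.

Lemma ln_prod (R : realType) (I : finType) (F : I -> R) :
  (forall i, 0 < F i) -> ln (\prod_i F i) = \sum_i ln (F i).
Proof.
move=> F0; rewrite -[RHS]expRK expR_sum; congr ln; apply: eq_bigr => i _.
by rewrite lnK // posrE.
Qed.

(** * Entropy rate of a stationary process *)

Section StationaryProcess.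
Context d (T : measurableType d) (R : realType) (mu : probability T R) (S : T -> T).
Hypotheses (mS : forall B, measurable B -> measurable (S @^-1` B))
  (invS : invariant_measure S mu).

Lemma measurable_iter n B : measurable B -> measurable (iter n S @^-1` B).
Proof.
elim: n B => // n IH B mB.
by have := mS (IH _ mB); congr measurable; apply/seteqP; split=> x /=; rewrite -iterSr.
Qed.

Lemma pr_iter n B : measurable B -> pr mu (iter n S @^-1` B) = pr mu B.
Proof.
elim: n B => // n IH B mB; rewrite -(IH _ mB) /pr -(invS (measurable_iter n mB)).
by congr (fine (mu _)); apply/seteqP; split=> x /=; rewrite -iterSr.
Qed.

Lemma discrete_iter (C : finType) (Z : T -> C) n : discrete Z -> discrete (Z \o iter n S).
Proof. by move=> mZ c; rewrite comp_preimage; apply: measurable_iter; exact: mZ. Qed.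

Lemma pmf_iter n (C : finType) (Z : T -> C) c :
  discrete Z -> pmf mu (Z \o iter n S) c = pmf mu Z c.
Proof. by move=> mZ; rewrite /pmf comp_preimage pr_iter. Qed.

Lemma entropy_iter n (C : finType) (Z : T -> C) :
  discrete Z -> entropy mu (Z \o iter n S) = entropy mu Z.
Proof.
move=> mZ; rewrite /entropy; have -> // : pmf mu (Z \o iter n S) = pmf mu Z.
by apply/funext => c; exact: pmf_iter.
Qed.

Definition word (A : Type) (xi : T -> A) n (x : T) : n.-tuple A :=
  [tuple xi (iter i S x) | i < n].

Lemma discrete_word n (A : finType) (xi : T -> A) : discrete xi -> discrete (word xi n).
Proof. by move=> mxi; apply: discrete_tuple => i; exact: discrete_iter. Qed.

Arguments discrete_word n {A xi} _ _.

Lemma entropy_word_add m n (A : finType) (xi : T -> A) : discrete xi ->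
  entropy mu (word xi (m + n)) <= entropy mu (word xi m) + entropy mu (word xi n).
Proof.
move=> mxi.
have mW k : discrete (word xi k) by exact: discrete_word.
have mW' : discrete (word xi n \o iter m S) by exact: discrete_iter.
rewrite -(entropy_iter m (mW n)); apply: le_trans (entropy_pair mu (mW m) mW').
have -> : word xi (m + n) =
    (fun uv => cat_tuple uv.1 uv.2) \o (fun x => (word xi m x, (word xi n \o iter m S) x)).
  apply/funext => x /=; apply: val_inj; apply: (@eq_from_nth _ (xi x)).
    by rewrite !size_tuple.
  rewrite size_tuple => i im.
  rewrite [\val (cat_tuple _ _)]/(tval _ ++ tval _) nth_cat size_tuple.
  have nthW k y j : (j < k)%N -> nth (xi x) (word xi k y) j = xi (iter j S y).
    by move=> jk; rewrite -[j]/(val (Ordinal jk)) -tnth_nth tnth_mktuple.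
  case: ltnP => mi; rewrite !nthW //; last by rewrite ltn_subLR.
  by rewrite -iterD subnK.
by apply: entropy_comp; exact: discrete_pair.
Qed.

Definition entropy_rate (A : finType) (xi : T -> A) : R :=
  limn (fun n => entropy mu (word xi n) / n%:R).

Lemma entropy_ge0 (A : finType) (Z : T -> A) : discrete Z -> 0 <= entropy mu Z.
Proof.
by move=> mZ; rewrite -[leLHS]oppr0 -(ln1 R); apply: entropy_ge => // c; exact: pr_le1.
Qed.

Lemma entropy_rate_cvg (A : finType) (xi : T -> A) : discrete xi ->
  (fun n => entropy mu (word xi n) / n%:R) @ \oo --> entropy_rate xi.
Proof.
move=> mxi; have [] := @subadditive_cvg _ (fun n => entropy mu (word xi n)).
- by move=> n; apply: entropy_ge0; exact: discrete_word.
- by move=> m n; exact: entropy_word_add.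
- by move=> L cL _; rewrite /entropy_rate (cvg_lim _ cL).
Qed.

Lemma entropy_rate_le (A : finType) (xi : T -> A) n : discrete xi -> (0 < n)%N ->
  entropy_rate xi <= entropy mu (word xi n) / n%:R.
Proof.
move=> mxi n0; have [] := @subadditive_cvg _ (fun n => entropy mu (word xi n)).
- by move=> k; apply: entropy_ge0; exact: discrete_word.
- by move=> k m; exact: entropy_word_add.
- by move=> L cL; rewrite /entropy_rate (cvg_lim _ cL) //; exact.
Qed.

Lemma partition_entropyE k (xi : T -> 'I_k) :
  measurable_partition xi -> partition_entropy S mu xi = entropy_rate xi.
Proof.
move=> mxi; rewrite /partition_entropy /entropy_rate.
suff -> : (fun n => join_entropy S mu xi n / n%:R) =
    (fun n => entropy mu (word xi n) / n%:R) by [].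
apply/funext => n; congr (_ / _).
have mW := discrete_word n mxi.
have jc w : pr mu (join_cell S xi w) = pmf mu (word xi n) w.
  congr pr; apply/seteqP; split=> x /=; first move=> h.
    by apply: eq_from_tnth => i; rewrite tnth_mktuple.
  by move=> <- i; rewrite tnth_mktuple.
rewrite -(entropy_of_pmf mu mW id) entropy_of_fin /join_entropy; congr (- _).
by apply: eq_bigr => w _; rewrite law_of_pmf //= -/(pr mu _) jc.
Qed.

Lemma le_entropy_rate (A B : finType) (xi : T -> A) (eta : T -> B) (e c : R) :
  discrete xi -> discrete eta ->
  (forall n, entropy mu (word xi n) <= entropy mu (word eta n) + n%:R * e + c) ->
  entropy_rate xi <= entropy_rate eta + e.
Proof.
move=> mxi meta h.
have ceta : (fun n => entropy mu (word eta n) / n%:R + e + c / n%:R) @ \oo -->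
    entropy_rate eta + e + 0.
  apply: cvgD; last exact: cvg_div_natr.
  by apply: cvgD; [exact: entropy_rate_cvg|exact: cvg_cst].
rewrite -[leRHS]addr0.
apply: ler_cvg_to (entropy_rate_cvg mxi) ceta _; near=> n.
have n0 : 0 < n%:R :> R by rewrite ltr0n; near: n; exact: nbhs_infty_gt.
rewrite ler_pdivrMr // (le_trans (h n)) // !mulrDl !divfK ?gt_eqF //; lra.
Unshelve. all: by end_near.
Qed.

(* One direction of the Kolmogorov-Sinai theorem: conditionally on a long
   [eta]-word, guess the [xi]-word letter by letter with the kernel giving mass
   [1 - e] to the prediction [g] and sharing [e] between all letters. *)
Lemma entropy_rate_approx (A B : finType) (xi : T -> A) (eta : T -> B) (L t : nat)
    (g : L.-tuple B -> A) (e : R) :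
  discrete xi -> discrete eta -> 0 < e < 1 ->
  entropy_rate xi <= entropy_rate eta - ln (1 - e)
    - pr mu [set x | xi (iter t S x) != g (word eta L x)] * ln (e / #|A|%:R).
Proof.
move=> mxi meta /andP[e0 e1]; set dlt := pr mu _.
pose xi' := xi \o iter t S; have mxi' : discrete xi' by exact: discrete_iter.
pose q (a a' : A) : R := if a == a' then 1 - e else e / #|A|%:R.
have A0 (a : A) : a \in A -> 0 < #|A|%:R :> R by move=> _; rewrite ltr0n; apply/card_gt0P; exists a.
have q0 a a' : 0 < q a a'.
  by rewrite /q; case: ifP => _; [rewrite subr_gt0|rewrite divr_gt0 // (A0 a)].
have q1 a' : \sum_a q a a' <= 1.
  apply: (@le_trans _ _ (\sum_a ((1 - e) * (a == a')%:R + e / #|A|%:R))).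
    apply: ler_sum => a _; rewrite /q; case: ifP => _; rewrite ?mulr1 ?mulr0 ?add0r //.
    by rewrite lerDl divr_ge0 // ltW.
  rewrite big_split /= -mulr_sumr (bigD1 a') //= eqxx big1 => [|b /negbTE -> //].
  rewrite addr0 mulr1n mulr1 sumr_const -[X in _ + X]mulr_natr divfK ?gt_eqF ?(A0 a') //; lra.
pose V x := (xi' x, g (word eta L x)).
have mgw : discrete (g \o word eta L).
  exact: (discrete_comp g (discrete_word L meta)).
have mV : discrete V by exact: discrete_pair.
pose cost := - \sum_aa pmf mu V aa * ln (q aa.1 aa.2).
have costE : cost <= - ln (1 - e) - dlt * ln (e / #|A|%:R).
  rewrite /cost (bigID (fun aa => aa.1 == aa.2)) /= opprD; apply: lerD.
    rewrite (eq_bigr (fun aa => pmf mu V aa * ln (1 - e))); last first.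
      by move=> aa; rewrite /q => ->.
    rewrite -mulr_suml -(pr_pred mu (fun aa => aa.1 == aa.2) mV) -mulrN ler_piMl //.
      rewrite oppr_ge0 ln_le0 //; lra.
    by apply: pr_le1; exact: (discrete_pred (fun aa => aa.1 == aa.2) mV).
  rewrite (eq_bigr (fun aa => pmf mu V aa * ln (e / #|A|%:R))); last first.
    by move=> aa; rewrite /q => /negbTE ->.
  by rewrite -mulr_suml -(pr_pred mu (fun aa => aa.1 != aa.2) mV).
apply: (@le_trans _ _ (entropy_rate eta + cost)); last by lra.
(* Predicting [n] letters takes an [eta]-word of length [n + L]; the [L] extra letters cost a
   constant, which the rate does not see. *)
apply: (@le_entropy_rate _ _ _ _ _ (entropy mu (word eta L))) => // n.
have mW := discrete_word n mxi'; have mE := discrete_word (n + L) meta.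
have mZ := discrete_pair mW mE.
have ijP (i : 'I_n) (j : 'I_L) : (i + j < n + L)%N by case: i j => i ? [j ?] /=; lia.
pose sub (b : (n + L).-tuple B) (i : 'I_n) : L.-tuple B :=
  [tuple tnth b (Ordinal (ijP i j)) | j < L].
have subE i x : sub (word eta (n + L) x) i = word eta L (iter i S x).
  by apply: eq_from_tnth => j; rewrite !tnth_mktuple -iterD [(j + i)%N]addnC.
pose Q (a : n.-tuple A) (b : (n + L).-tuple B) := \prod_(i < n) q (tnth a i) (g (sub b i)).
have Q0 a b : 0 < Q a b by exact: prodr_gt0.
have := @entropy_kernel _ _ _ mu _ _ mZ _ _ fst snd Q.
have -> : entropy mu (fst \o (fun x => (word xi' n x, word eta (n + L) x))) =
    entropy mu (word xi n).
  by rewrite -(entropy_iter t (discrete_word n mxi)); congr entropy; apply/funext => x;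
    apply: eq_from_tnth => i; rewrite !tnth_mktuple /xi' /= -!iterD addnC.
have -> : \sum_c pmf mu (fun x => (word xi' n x, word eta (n + L) x)) c * ln (Q c.1 c.2) =
    - (n%:R * cost).
  rewrite (eq_bigr (fun c => \sum_(i < n)
    pmf mu (fun x => (word xi' n x, word eta (n + L) x)) c *
    ln (q (tnth c.1 i) (g (sub c.2 i))))); last first.
    by move=> c _; rewrite -mulr_sumr ln_prod.
  rewrite exchange_big /= (eq_bigr (fun=> - cost)); last first.
    move=> i _.
    rewrite (sum_pmf_comp mu mZ (fun c => (tnth c.1 i, g (sub c.2 i)))
      (fun aa => ln (q aa.1 aa.2))) opprK.
    apply: eq_bigr => aa _; congr (_ * _).
    rewrite -(pmf_iter i aa mV); congr (pmf mu _ aa); apply/funext => x /=.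
    by rewrite subE tnth_mktuple.
  by rewrite sumr_const card_ord mulNrn mulr_natl.
rewrite opprK => h.
have {h} : entropy mu (word xi n) <= entropy mu (word eta (n + L)) + n%:R * cost.
  apply: h => [a b|b|c _]; [exact: ltW|rewrite /Q|exact: Q0].
  rewrite (sum_tuple_prod (fun i a => q a (g (sub b i)))).
  apply: prodr_ile1 => i _; rewrite q1 andbT.
  by apply: sumr_ge0 => a _; exact: ltW.
have := entropy_word_add n L meta; lra.
Qed.

End StationaryProcess.

(** * Two-sided processes: approximation by cylinders and the generator theorem *)

Section SequenceSpace.
Context d (T : measurableType d) (A : finType) (X : int -> T -> A).
Hypothesis mX : forall i, discrete (X i).
Hypothesis genX :
  @measurable d T `<=` <<s [set E | exists i a, E = X i @^-1` [set a]] >>.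

Definition window (i : int) n (x : T) : n.-tuple A := [tuple X (i + k%:Z) x | k < n].

Lemma discrete_window i n : discrete (window i n).
Proof. by apply: discrete_tuple => k; exact: mX. Qed.

Lemma coord_generate :
  @measurable d T = <<s [set E | exists i a, E = X i @^-1` [set a]] >>.
Proof.
apply/seteqP; split=> // E; apply: smallest_sub; first exact: sigma_algebra_measurable.
by move=> _ [i [a ->]]; exact: mX.
Qed.

Lemma measurable_coord_fun d' (T' : measurableType d') (f : T' -> T) :
  (forall i, discrete (X i \o f)) -> measurable_fun setT f.
Proof.
move=> mf; apply: (measurability _ coord_generate) => _ [_ [i [a ->]] <-].
by rewrite setTI; exact: (mf i a).
Qed.

Lemma measurable_coord_preimage d' (T' : measurableType d') (f : T' -> T) E :
  (forall i, discrete (X i \o f)) -> measurable E -> measurable (f @^-1` E).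
Proof.
by move=> mf mE; rewrite -[X in measurable X]setTI; apply: measurable_coord_fun.
Qed.

Lemma measurable_shift (S : T -> T) E : (forall i x, X i (S x) = X (i + 1) x) ->
  measurable E -> measurable (S @^-1` E).
Proof.
move=> XS; apply: measurable_coord_preimage => i; rewrite (_ : _ \o _ = X (i + 1)) //.
by apply/funext => x /=; rewrite XS.
Qed.

(** [E] depends on the coordinates in [[-t, t)] only; with centred windows, finitely many cylinders
    always share one [t]. *)
Definition cylinder (t : nat) (E : set T) :=
  forall x y, window (- t%:Z) (t + t) x = window (- t%:Z) (t + t) y -> E x -> E y.

Lemma eq_window t t' x y : (t <= t')%N ->
  window (- t'%:Z) (t' + t') x = window (- t'%:Z) (t' + t') y ->
  window (- t%:Z) (t + t) x = window (- t%:Z) (t + t) y.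
Proof.
move=> tt' xy; apply: eq_from_tnth => k; rewrite !tnth_mktuple.
have kP : ((t' - t) + k < t' + t')%N by case: k => k /=; lia.
have := congr1 (fun w => tnth w (Ordinal kP)) xy; rewrite !tnth_mktuple /=.
by have -> : - t'%:Z + (t' - t + k)%N%:Z = - t%:Z + k%:Z by lia.
Qed.

Lemma cylinder_le t t' E : (t <= t')%N -> cylinder t E -> cylinder t' E.
Proof. by move=> tt' cE x y /(eq_window tt'); exact: cE. Qed.

Lemma cylinderU t E F : cylinder t E -> cylinder t F -> cylinder t (E `|` F).
Proof. by move=> cE cF x y xy [/(cE _ _ xy)|/(cF _ _ xy)]; [left|right]. Qed.

Lemma cylinderC t E : cylinder t E -> cylinder t (~` E).
Proof. by move=> cE x y xy Ex /(cE _ _ (esym xy)). Qed.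

Definition base t (E : set T) (w : (t + t).-tuple A) : bool :=
  `[< exists2 y, E y & window (- t%:Z) (t + t) y = w >].

Lemma baseE t E x : cylinder t E -> base E (window (- t%:Z) (t + t) x) = `[< E x >].
Proof.
move=> cE; apply/asboolP/asboolP => [[y Ey yx]|Ex]; last by exists x.
exact: cE yx Ey.
Qed.

Lemma cylinderE t E : cylinder t E ->
  E = [set x | base E (window (- t%:Z) (t + t) x)].
Proof. by move=> cE; apply/seteqP; split=> x /=; rewrite baseE // => /asboolP. Qed.

Lemma measurable_cylinder t E : cylinder t E -> measurable E.
Proof. by move=> /cylinderE ->; apply: discrete_pred; exact: discrete_window. Qed.

Section Approximation.
Context (R : realType) (mu nu : probability T R).

(** These sets form a sigma-algebra containing the coordinate events. One cylinder serves both
    measures, so that agreement on cylinders implies agreement everywhere. *)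
Let approx (E : set T) := measurable E /\ forall e : R, 0 < e ->
  exists t C, [/\ cylinder t C, pr mu (E `+` C) < e & pr nu (E `+` C) < e].

Let measurableY (E F : set T) : measurable E -> measurable F -> measurable (E `+` F).
Proof. by move=> mE mF; apply: measurableU; exact: measurableD. Qed.

Let approxC E : approx E -> approx (~` E).
Proof.
move=> [mE aE]; split; first exact: measurableC.
move=> e /aE[t [C [cC h1 h2]]]; exists t, (~` C).
have -> : ~` E `+` ~` C = E `+` C.
  apply/seteqP; split=> x [[h3 h4]|[h3 h4]]; first by right; split=> //; exact: contrapT.
  - by left; split=> //; exact: contrapT.
  - by right; split=> //; exact.
  - by left; split=> //; exact.
by split=> //; exact: cylinderC.
Qed.

Let approxU E F : approx E -> approx F -> approx (E `|` F).
Proof.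
move=> [mE aE] [mF aF]; split; first exact: measurableU.
move=> e e0; have e2 : 0 < e / 2 by rewrite divr_gt0.
have [t [C [cC c1 c2]]] := aE _ e2; have [u [D [cD d1 d2]]] := aF _ e2.
have mC := measurable_cylinder cC; have mD := measurable_cylinder cD.
have sub : (E `|` F) `+` (C `|` D) `<=` (E `+` C) `|` (F `+` D).
  move=> x [[[h|h] /not_orP[h1 h2]]|[[h|h] /not_orP[h1 h2]]].
  - by left; left.
  - by right; left.
  - by left; right.
  - by right; right.
have bound (m : probability T R) : pr m (E `+` C) < e / 2 -> pr m (F `+` D) < e / 2 ->
    pr m ((E `|` F) `+` (C `|` D)) < e.
  move=> h1 h2; have : pr m ((E `|` F) `+` (C `|` D)) <= pr m (E `+` C) + pr m (F `+` D).
    apply: le_trans (le_prU _ _ _); [apply: le_pr => //|exact: measurableY..].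
      by apply: measurableY; exact: measurableU.
    by apply: measurableU; exact: measurableY.
  lra.
exists (maxn t u), (C `|` D); split; [|exact: bound..].
by apply: cylinderU; [apply: cylinder_le cC; exact: leq_maxl|
  apply: cylinder_le cD; exact: leq_maxr].
Qed.

Let approx0 : approx set0.
Proof.
by split=> // e e0; exists 0%N, set0; rewrite setYK !pr0; split=> // x y _.
Qed.

Let approx_bigcup (F : (set T)^nat) : (forall n, approx (F n)) -> approx (\bigcup_n F n).
Proof.
move=> aF; pose U n := \big[setU/set0]_(k < n) F k.
have aU n : approx (U n).
  rewrite /U; elim: n => [|n IH]; first by rewrite big_ord0.
  by rewrite big_ord_recr /=; exact: approxU.
have mU n : measurable (U n) by case: (aU n).
have mE : measurable (\bigcup_n F n) by apply: bigcup_measurable => n _; case: (aF n).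
have subU n : U n `<=` \bigcup_n F n.
  by rewrite /U -bigcup_mkord => x [k _ Fx]; exists k.
have UE : \bigcup_n U n = \bigcup_n F n.
  apply/seteqP; split=> [x [n _ /subU]|x [n _ Fx]] //.
  by exists n.+1 => //; rewrite /U -bigcup_mkord; exists n => //=.
split=> // e e0; have e2 : 0 < e / 2 by rewrite divr_gt0.
have near_U (m : probability T R) :
    \forall n \near \oo, pr m (\bigcup_n F n) - pr m (U n) < e / 2.
  have : (fun n => pr m (U n)) @ \oo --> pr m (\bigcup_n F n).
    rewrite -UE; apply: pr_cvgU => // n n' nn'; rewrite /U -!bigcup_mkord.
    by move=> x [k kn Fx]; exists k => //=; exact: leq_trans nn'.
  move/cvgrPdist_lt => /(_ _ e2); apply: filterS => n.
  exact: (le_lt_trans (ler_norm _)).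
have [n [hm hn]] : exists n, pr mu (\bigcup_n F n) - pr mu (U n) < e / 2 /\
    pr nu (\bigcup_n F n) - pr nu (U n) < e / 2.
  have : \forall n \near \oo, pr mu (\bigcup_n F n) - pr mu (U n) < e / 2 /\
    pr nu (\bigcup_n F n) - pr nu (U n) < e / 2 by near do split.
  by case=> n _ /(_ n (leqnn n)) ?; exists n.
have [_ /(_ _ e2)[t [C [cC c1 c2]]]] := aU n; exists t, C.
have mC := measurable_cylinder cC.
have bound (m : probability T R) : pr m (\bigcup_n F n) - pr m (U n) < e / 2 ->
    pr m (U n `+` C) < e / 2 -> pr m (\bigcup_n F n `+` C) < e.
  move=> h1 h2.
  have h3 : pr m (\bigcup_n F n `\` U n) = pr m (\bigcup_n F n) - pr m (U n).
    rewrite -{2}(setDUK (subU n)) prU ?setDIK //; first by lra.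
    exact: measurableD.
  have : pr m (\bigcup_n F n `+` C) <= pr m (\bigcup_n F n `\` U n) + pr m (U n `+` C).
    apply: le_trans (le_prU _ _ _); [apply: le_pr|exact: measurableD|exact: measurableY].
    - exact: measurableY.
    - by apply: measurableU; [exact: measurableD|exact: measurableY].
    move=> x [[Fx nC]|[Cx nF]]; last by right; right; split=> // /subU.
    by have [Ux|nU] := pselect (U n x); [right; left|left].
  lra.
by split=> //; exact: bound.
Unshelve. all: by end_near.
Qed.

Lemma measurable_approx E (e : R) : measurable E -> 0 < e ->
  exists t C, [/\ cylinder t C, pr mu (E `+` C) < e & pr nu (E `+` C) < e].
Proof.
move=> /genX mE; suff : approx E by move=> [_]; exact.
move: mE; apply: smallest_sub; last first.
  move=> _ [i [a ->]]; split=> [|{}e e0]; first exact: mX.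
  (* The successor is there because windows are open on the right. *)
  exists (absz i).+1, (X i @^-1` [set a]); rewrite setYK !pr0; split=> // x y xy /= <-.
  have kP : (absz (i + (absz i).+1%:Z)%R < (absz i).+1 + (absz i).+1)%N by lia.
  have := congr1 (fun w => tnth w (Ordinal kP)) xy; rewrite !tnth_mktuple /=.
  by have -> : - (absz i).+1%:Z + (absz (i + (absz i).+1%:Z))%:Z = i by lia.
split=> // F aF.
by rewrite setTD; exact: approxC.
Qed.

End Approximation.

Section Consequences.
Context (R : realType).
Implicit Types mu nu : probability T R.

Lemma pr_setY mu E F : measurable E -> measurable F ->
  `|pr mu E - pr mu F| <= pr mu (E `+` F).
Proof.
have key (G H : set T) : measurable G -> measurable H ->
    pr mu G <= pr mu H + pr mu (G `+` H).
  move=> mG mH; have mY : measurable (G `+` H) by apply: measurableU; exact: measurableD.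
  apply: le_trans (le_prU _ mH mY); apply: le_pr => //; first exact: measurableU.
  by move=> x Gx; have [Hx|nH] := pselect (H x); [left|right; left].
move=> mE mF; rewrite ler_distl; have := key _ _ mE mF; have := key _ _ mF mE.
by rewrite setYC; lra.
Qed.

Lemma pr_unique mu nu : (forall t C, cylinder t C -> pr mu C = pr nu C) ->
  forall E, measurable E -> pr mu E = pr nu E.
Proof.
move=> h E mE; apply/eqP; rewrite -subr_eq0 -normr_le0; apply/ler_addgt0Pr => e e0.
have e2 : 0 < e / 2 by rewrite divr_gt0.
have [t [C [cC c1 c2]]] := measurable_approx mu nu mE e2.
have mC := measurable_cylinder cC.
have := pr_setY mu mE mC; have := pr_setY nu mE mC; rewrite (h _ _ cC).
by rewrite !ler_norml => /andP[? ?] /andP[? ?]; apply/andP; split; lra.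
Qed.

(** Each cell of [xi] is approximated by a cylinder, and [g] picks any label whose cylinder contains
    the point. The guess can be wrong only where some cell differs from its cylinder. *)
Lemma discrete_approx mu (B : finType) (xi : T -> B) (dlt : R) : discrete xi -> 0 < dlt ->
  exists t (g : (t + t).-tuple A -> B),
    pr mu [set x | xi x != g (window (- t%:Z) (t + t) x)] < dlt.
Proof.
move=> mxi d0; have [b0 _|B0] := pickP B; last first.
  exists 0%N, (fun w => xi point); rewrite (_ : mkset _ = set0) ?pr0 //.
  by apply/seteqP; split=> // x; have := B0 (xi x).
have B0 : 0 < #|B|%:R :> R by rewrite ltr0n; apply/card_gt0P; exists b0.
have /choice[tC htC] (b : B) : exists tC : nat * set T, cylinder tC.1 tC.2 /\
    pr mu (xi @^-1` [set b] `+` tC.2) < dlt / #|B|%:R.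
  have [||t [C [cC c1 _]]] := @measurable_approx _ mu mu (xi @^-1` [set b]) (dlt / #|B|%:R).
  - exact: mxi.
  - by rewrite divr_gt0.
  - by exists (t, C).
pose t := \max_b (tC b).1.
have cC b : cylinder t (tC b).2.
  by apply: cylinder_le (proj1 (htC b)); exact: leq_bigmax.
exists t, (fun w => odflt b0 [pick b | base (tC b).2 w]).
pose Y b := xi @^-1` [set b] `+` (tC b).2.
have mYb b : measurable (Y b).
  by apply: measurableU; apply: measurableD => //; exact: measurable_cylinder.
have mU (s : seq B) : measurable (\big[setU/set0]_(b <- s) Y b).
  by apply: bigsetU_measurable => b _.
have leU (s : seq B) : pr mu (\big[setU/set0]_(b <- s) Y b) <= \sum_(b <- s) pr mu (Y b).
  elim: s => [|b s IH]; first by rewrite !big_nil pr0.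
  by rewrite !big_cons (le_trans (le_prU _ _ _)) // lerD2l.
apply: (@le_lt_trans _ _ (pr mu (\big[setU/set0]_(b <- enum B) Y b))).
  apply: le_pr => //.
    apply: (@discrete_pred _ _ _ (fun x => (xi x, window (- t%:Z) (t + t) x))
      (fun bw => bw.1 != odflt b0 [pick b | base (tC b).2 bw.2])).
    by apply: discrete_pair => //; exact: discrete_window.
  move=> x /= xg; have [|noY] := pselect (exists b, Y b x).
    by case=> b Yb; rewrite -bigcup_seq; exists b => //=; rewrite mem_enum.
  suff : xi x == odflt b0 [pick b | base (tC b).2 (window (- t%:Z) (t + t) x)].
    by move=> h; rewrite h in xg.
  case: pickP => [b|/(_ (xi x))]; rewrite baseE //.
    move=> /asboolP Cb /=; apply: contrapT => xib; apply: noY; exists b; right; split=> //.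
    by move/eqP.
  move/asboolP => nC; exfalso; apply: noY; exists (xi x); left; split=> //.
apply: (le_lt_trans (leU _)); rewrite big_enum /=.
apply: (@lt_le_trans _ _ (\sum_(b : B) dlt / #|B|%:R)).
  apply: ltr_sum; last by move=> b _; exact: (proj2 (htC b)).
  by apply/hasP; exists b0; rewrite ?mem_index_enum.
by rewrite sumr_const -[leLHS]mulr_natr divfK // gt_eqF.
Qed.

(** Kolmogorov-Sinai theorem for the coordinate partition: any partition is predicted from a long
    window with small error, and [entropy_rate_approx] bounds the price of the errors. *)
Theorem entropy_rate_generator mu (S : T -> T) (B : finType) (xi : T -> B) :
  (forall i x, X i (S x) = X (i + 1) x) -> invariant_measure S mu -> discrete xi ->
  entropy_rate mu S xi <= entropy_rate mu S (X 0).
Proof.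
move=> XS invS mxi.
have mS E := @measurable_shift S E XS.
have XiS n i x : X i (iter n S x) = X (i + n%:Z) x.
  by elim: n i => [|n IH] i /=; rewrite ?addr0 // XS IH; congr (X _ x); lia.
apply/ler_addgt0Pr => e e0.
(* Chosen so that [- ln (1 - e1) = e / 2]. *)
pose e1 := 1 - expR (- (e / 2)).
have x0 : 0 < expR (- (e / 2)) by exact: expR_gt0.
have x1 : expR (- (e / 2)) < 1 by rewrite expR_lt1; lra.
have e1P : 0 < e1 < 1 by rewrite /e1; apply/andP; split; lra.
(* [K] bounds the price of one wrong prediction; adding 1 makes it positive, and error probability
   [e / 2 / K] then costs at most [e / 2]. *)
pose K := `|ln (e1 / #|B|%:R)| + 1; have K0 : 0 < K by rewrite /K ltr_wpDl.
have dlt0 : 0 < e / 2 / K by rewrite !divr_gt0.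
have [t [g hg]] := discrete_approx mu mxi dlt0.
have := @entropy_rate_approx _ _ _ mu S mS invS _ _ xi (X 0) (t + t) t g e1 mxi (mX 0) e1P.
set dl := pr mu _.
(* The predictor sees the coordinates 0 to [2 * t - 1] and guesses the label at time [t]; invariance
   moves this to the centred window. *)
have dlE : dl = pr mu [set x | xi x != g (window (- t%:Z) (t + t) x)].
  rewrite -(pr_iter mS invS t); last first.
    apply: (@discrete_pred _ _ _ (fun x => (xi x, window (- t%:Z) (t + t) x))
      (fun bw => bw.1 != g bw.2)).
    by apply: discrete_pair => //; exact: discrete_window.
  congr pr; apply/funext => x /=; congr (is_true (_ != g _)).
  apply: eq_from_tnth => k; rewrite !tnth_mktuple !XiS; congr (X _ x); lia.
have l1 : ln (1 - e1) = - (e / 2) by rewrite /e1 opprB addrC subrK expRK.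
have l2 : - (dl * ln (e1 / #|B|%:R)) <= e / 2.
  apply: (@le_trans _ _ (dl * K)).
    rewrite -mulrN ler_wpM2l ?pr_ge0 // /K.
    by rewrite (le_trans (ler_norm _)) // normrN lerDl.
  by rewrite -ler_pdivlMr // dlE ltW.
by rewrite l1; lra.
Qed.

End Consequences.

End SequenceSpace.

(** * The Borel sigma-algebra of the full shift *)

Section BorelFullShift.
Variable G : digraph.

Definition coord (i : int) (x : borel_full_shift G) : letter G := x i.

Lemma open_coord i (a : letter G) :
  open ([set x | x i = a] : set {ptws int -> discrete_topology (letter G)}).
Proof.
rewrite openE => x /= xa.
apply: (@proj_continuous int (fun=> discrete_topology (letter G)) i x [set a]).
by rewrite /proj xa; exact: discrete_set1.
Qed.

Lemma discrete_coord i : discrete (coord i).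
Proof. by move=> a; apply: sub_sigma_algebra; exact: open_coord. Qed.

Let same_window (x y : int -> letter G) t :=
  window coord (- t%:Z) (t + t) x = window coord (- t%:Z) (t + t) y.

Let same_windowP x y t : same_window x y t ->
  forall i : int, - t%:Z <= i < t%:Z -> x i = y i.
Proof.
move=> xy i it; have kP : (absz (i + t%:Z)%R < t + t)%N by lia.
have := congr1 (fun w => tnth w (Ordinal kP)) xy; rewrite !tnth_mktuple /= /coord.
by have -> : - t%:Z + (absz (i + t%:Z))%:Z = i by lia.
Qed.

(** The sets containing a cylinder around [x] form a filter. It converges to [x] in every
    coordinate, hence in the product topology, so it contains every open neighbourhood of [x]. *)
Lemma open_window (U : set {ptws int -> discrete_topology (letter G)}) x :
  open U -> U x -> exists t, forall y, same_window x y t -> U y.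
Proof.
move=> oU Ux.
pose F : set_system (int -> letter G) :=
  fun E => exists t, forall y, same_window x y t -> E y.
have FF : Filter F.
  split; first by exists 0%N.
    move=> E E' [t Et] [t' Et']; exists (maxn t t') => y xy; split.
      by apply: Et; apply: eq_window xy; exact: leq_maxl.
    by apply: Et'; apply: eq_window xy; exact: leq_maxr.
  by move=> E E' EE' [t Et]; exists t => y /Et /EE'.
have Fx : {ptws, F --> x}.
  rewrite cvg_sup => i; rewrite cvg_image; last first.
    by rewrite eqEsubset; split=> v // _; exists (cst v).
  move=> W Wx; exists ((fun y => y i) @^-1` W).
    exists (absz i).+1 => y xy /=; rewrite -(same_windowP xy); last lia.
    exact: nbhs_singleton.
  by rewrite eqEsubset; split => [j [? + <-//]|j Wj]; exists (fun _ => j).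
by have := Fx U (open_nbhs_nbhs (conj oU Ux)).
Qed.

(** An open set is the union of the cylinders that it contains, and there are only countably many
    cylinders. *)
Lemma borel_generate : @measurable _ (borel_full_shift G) `<=`
  <<s [set E | exists i a, E = coord i @^-1` [set a]] >>.
Proof.
set gen := (X in <<s X >>).
apply: smallest_sub; first exact: smallest_sigma_algebra.
move=> U oU; pose T : measurableType _ := g_sigma_algebraType gen.
have mT i : @discrete _ T (letter G) (coord i).
  by move=> a; apply: sub_sigma_algebra; exists i, a.
(* The index type, a radius with a finite set of windows, is countable. *)
pose C (tW : {t : nat & {set (t + t).-tuple (letter G)}}) : set T :=
  [set x | window coord (- (tag tW)%:Z) (tag tW + tag tW) x \in tagged tW].
pose F tW := if `[< C tW `<=` U >] then C tW else set0.
have -> : U = \bigcup_tW F tW.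
  apply/seteqP; split=> [x Ux|x [tW _]]; last first.
    by rewrite /F; case: asboolP => // CU /CU.
  have [t tU] := open_window oU Ux.
  pose tW := Tagged (fun t : nat => {set (t + t).-tuple (letter G)})
    [set window coord (- t%:Z) (t + t) x]%SET.
  exists tW => //; rewrite /F asboolT; first by rewrite /C /= inE.
  by move=> y; rewrite /C /= inE => /eqP/esym/tU.
suff : measurable (\bigcup_tW F tW) by [].
apply: measurable_bigcup_count => tW; rewrite /F; case: ifP => // _.
by apply: (discrete_pred (fun w => w \in tagged tW)); exact: discrete_window.
Qed.

End BorelFullShift.

(** * The uniform Bernoulli process *)

Section UniformDigits.
Context (R : realType) (b : nat).
Hypothesis b_gt0 : (0 < b)%N.

Definition unit_uniform : set (measurableTypeR R) -> \bar R :=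
  mrestr (@lebesgue_measure R) (measurable_itv `[0, 1[).

HB.instance Definition _ := Measure.on unit_uniform.

Let unit_uniform_setT : unit_uniform setT = 1%E.
Proof.
rewrite /unit_uniform /mrestr setTI lebesgue_measure_itv /= lte_fin ltr01.
by rewrite oppr0 adde0.
Qed.

HB.instance Definition _ :=
  Measure_isProbability.Build _ _ R unit_uniform unit_uniform_setT.

(** The integer written by the first [n] digits of [u] in base [b]: on [[0, 1)] its level sets are
    intervals of length [b ^ - n], which makes the digits independent and uniform. *)
Definition prefix (n : nat) (u : R) : nat := Num.truncn (u * (b ^ n)%:R).

Definition digit (n : nat) (u : R) : nat := (prefix n.+1 u %% b)%N.

Let b0R n : 0 < (b ^ n)%:R :> R. Proof. by rewrite ltr0n expn_gt0 b_gt0. Qed.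

Lemma prefix_div n u : 0 <= u -> (prefix n.+1 u %/ b)%N = prefix n u.
Proof.
move=> u0; apply/esym/truncn_def.
have := @truncn_itv _ (u * (b ^ n.+1)%:R); rewrite mulr_ge0 // => /(_ isT).
rewrite -/(prefix n.+1 u) expnSr natrM mulrA; set v := u * _; set m := prefix _ _.
have bR : 0 < b%:R :> R by rewrite ltr0n.
case/andP=> h1 h2; apply/andP; split.
  rewrite -(ler_pM2r bR) -natrM; apply: le_trans h1.
  by rewrite ler_nat leq_divM.
rewrite -(ltr_pM2r bR) -natrM; apply: lt_le_trans h2 _.
by rewrite ler_nat ltn_ceil.
Qed.

(** The fold is the Horner value of the digits [w] in base [b]. *)
Lemma prefix_digits n u (w : nat -> nat) : 0 <= u < 1 -> (forall k, (w k < b)%N) ->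
  (forall k, (k < n)%N -> digit k u = w k) <->
  prefix n u = foldl (fun acc k => acc * b + w k)%N 0%N (iota 0 n).
Proof.
move=> u01 wb; elim: n => [|n IH].
  split=> // _; rewrite /prefix expn0 mulr1; apply: truncn_def.
  by case/andP: u01 => -> ->.
have u0 : 0 <= u by case/andP: u01.
rewrite -addn1 iotaD foldl_cat add0n /= addn1.
set acc := foldl _ _ _ in IH *; split=> [h|h].
  rewrite (divn_eq (prefix n.+1 u) b) prefix_div // -/(digit n u) h //.
  by congr (_ * _ + _)%N; apply/IH => k kn; apply: h; rewrite ltnS ltnW.
move=> k; rewrite ltnS leq_eqVlt => /predU1P[->|].
  by rewrite /digit h modnMDl modn_small.
apply: (proj2 IH).
by rewrite -prefix_div // h divnMDl // divn_small // addn0.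
Qed.

Lemma unit_uniform_prefix n m : (m < b ^ n)%N ->
  unit_uniform [set u | prefix n u = m] = ((b ^ n)%:R^-1)%:E.
Proof.
move=> mb; rewrite /unit_uniform /mrestr.
have bn := b0R n.
have -> : [set u | prefix n u = m] `&` `[0, 1[ =
    `[m%:R / (b ^ n)%:R, m.+1%:R / (b ^ n)%:R[%classic :> set R.
  apply/seteqP; split=> u /=; rewrite !in_itv /= ler_pdivrMr // ltr_pdivlMr //.
    case=> <- /andP[u0 u1]; have := @truncn_itv _ (u * (b ^ n)%:R).
    by rewrite mulr_ge0 // => /(_ isT).
  move=> h; split; first exact: truncn_def.
  case/andP: h => h1 h2; apply/andP; split.
    by rewrite -(pmulr_lge0 _ bn) (le_trans _ h1).
  by rewrite -(ltr_pM2r bn) mul1r (lt_le_trans h2) // ler_nat.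
rewrite lebesgue_measure_itv /= lte_fin ltr_pM2r ?invr_gt0 // ltr_nat ltnSn.
by rewrite -EFinB -mulrBl -natr1 addrAC subrr add0r mul1r.
Qed.

Lemma measurable_prefix n m : measurable [set u : measurableTypeR R | prefix n u = m].
Proof.
have bn := b0R n.
(* The digits are defined on the whole line, and truncation sends negative numbers to 0. *)
have -> : [set u : R | prefix n u = m] =
    (if m == 0%N then `]-oo, 0[%classic else set0) `|`
    `[m%:R / (b ^ n)%:R, m.+1%:R / (b ^ n)%:R[%classic.
  apply/seteqP; split=> u /=; rewrite in_itv /= ler_pdivrMr // ltr_pdivlMr //.
    have [u0|u0] := ltP u 0; last first.
      move=> <-; right; have := @truncn_itv _ (u * (b ^ n)%:R).
      by rewrite mulr_ge0 // => /(_ isT).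
    have -> : prefix n u = 0%N.
      apply/eqP; rewrite -leqn0 /prefix truncn_le_nat.
      by rewrite (lt_le_trans (_ : _ < 0)) // nmulr_rlt0.
    by move=> <-; left; rewrite /= in_itv /=.
  case=> [|h]; last exact: truncn_def.
  case: eqP => //= -> ; rewrite in_itv /= => u0.
  apply/eqP; rewrite -leqn0 /prefix truncn_le_nat.
  by rewrite (lt_le_trans (_ : _ < 0)) // nmulr_rlt0.
by apply: measurableU; [case: ifP|].
Qed.

Lemma discrete_digit n : discrete (fun u : measurableTypeR R => inord (digit n u) : 'I_b.-1.+1).
Proof.
move=> c; rewrite (_ : _ @^-1` _ =
   \bigcup_m (if (m %% b == c)%N then [set u : measurableTypeR R | prefix n.+1 u = m] else set0)).
  by apply: bigcup_measurable => m _; case: ifP => // _; exact: measurable_prefix.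
apply/seteqP; split=> u /=.
  move=> uc; exists (prefix n.+1 u) => //; rewrite -/(digit n u) -uc.
  by rewrite inordK ?eqxx // prednK // ltn_pmod.
case=> m _; case: ifP => // /eqP mc /= um; apply: val_inj.
by rewrite /= inordK /digit um mc // prednK // ltn_pmod.
Qed.

End UniformDigits.

Section Pushforward.
Context d (T : measurableType d) (R : realType).

Lemma exists_pushforward d' (T' : measurableType d') (mu : probability T R) (f : T -> T') :
  measurable_fun setT f ->
  exists nu : probability T' R, forall E, nu E = mu (f @^-1` E).
Proof.
move=> mf; pose F : {mfun T >-> T'} := HB.pack f (isMeasurableFun.Build _ _ _ _ f mf).
by exists (distribution mu F).
Qed.

Lemma exists_midpoint (mu nu : probability T R) :
  exists la : probability T R, forall E, measurable E -> pr la E = (pr mu E + pr nu E) / 2.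
Proof.
have h0 : 0 <= 2^-1 :> R by rewrite invr_ge0.
pose h := NngNum h0; pose m : {measure set T -> \bar R} := measure_add (mscale h mu) (mscale h nu).
have mE (E : set T) : m E = ((2^-1)%:E * mu E + (2^-1)%:E * nu E)%E.
  exact: (measure_addE (mscale h mu) (mscale h nu) E).
have m1 : m setT = 1%E.
  by rewrite mE !probability_setT !mule1 -EFinD; congr EFin; lra.
pose la : probability T R := HB.pack (m : set T -> \bar R)
  (Measure.class m) (Measure_isProbability.Build _ _ _ m m1).
exists la => E mE'; apply: EFin_inj; rewrite -prE // [LHS](mE E) !prE //.
by rewrite -EFinM -EFinD; congr EFin; lra.
Qed.

End Pushforward.

Section UniformLaw.
Context d (T : measurableType d) (R : realType) (mu : probability T R).

Lemma pr_partition (C : finType) (Z : T -> C) E : measurable E -> discrete Z ->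
  pr mu E = \sum_c pr mu (E `&` Z @^-1` [set c]).
Proof.
move=> mE mZ; pose V x := (`[< E x >], Z x).
have mV : discrete V.
  apply: discrete_pair => // -[|].
    rewrite (_ : _ @^-1` _ = E) //; apply/seteqP; split=> x /=; first by move/asboolP.
    by move=> Ex; apply/asboolP.
  rewrite (_ : _ @^-1` _ = ~` E); first exact: measurableC.
  by apply/seteqP; split=> x /=; [move/asboolPn|move=> Ex; apply/asboolPn].
have -> : pr mu E = pr mu [set x | (V x).1].
  by congr pr; apply/seteqP; split=> x /= /asboolP.
rewrite (pr_pred mu (fun v => v.1) mV) /=.
rewrite (eq_bigl (fun v => (v.1 == true) && xpredT v.2)); last by case=> [[]].
rewrite (eq_bigr (fun v => pmf mu V (v.1, v.2))); last by case.
rewrite -(pair_big (pred1 true) xpredT (fun a c => pmf mu V (a, c))) /= big_pred1_eq.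
apply: eq_bigr => c _; congr pr; apply/seteqP; split=> x /=.
  by case=> /asboolP.
by case=> Ex <-; rewrite /V asboolT.
Qed.

Context (B : finType) (Y : nat -> T -> B) (mY : forall k, discrete (Y k)).

Lemma measurable_coords (K : seq nat) (y : nat -> B) :
  measurable [set x | forall k, k \in K -> Y k x = y k].
Proof.
rewrite (_ : mkset _ = \bigcap_(k in [set` K]) (Y k @^-1` [set y k])) //.
by apply: bigcap_measurableType => k _; exact: mY.
Qed.

Hypothesis prefix_law : forall n y,
  pr mu [set x | forall k, (k < n)%N -> Y k x = y k] = #|B|%:R^-1 ^+ n.

(** Induction on the number [m] of indices below [n] missing from [K]: add one missing index and sum
    over its values. *)
Lemma coords_law (K : seq nat) (y : nat -> B) : uniq K ->
  pr mu [set x | forall k, k \in K -> Y k x = y k] = #|B|%:R^-1 ^+ size K.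
Proof.
pose n := (\max_(k <- K) k).+1.
have : all (fun k => k < n)%N K.
  by apply/allP => k kK; rewrite /n ltnS; exact: leq_bigmax_seq.
move: n => n Kn uK; have sK : (size K <= n)%N.
  rewrite -(size_iota 0 n); apply: uniq_leq_size => // k kK.
  by rewrite mem_iota /= add0n; exact: (allP Kn).
have [m nE] : exists m, (n = size K + m)%N by exists (n - size K)%N; rewrite subnKC.
elim: m K y uK Kn sK nE => [|m IH] K y uK Kn sK nE.
  rewrite addn0 in nE; rewrite -{1}nE -(prefix_law n y).
  congr pr; apply/funext => x /=; apply/propext.
  have [_ eK] : (size K = size (iota 0 n) /\ K =i iota 0 n)%type.
    rewrite size_iota; split=> //.
    have [] := uniq_min_size uK (s2 := iota 0 n) => //; last by rewrite size_iota nE.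
    by move=> k /(allP Kn); rewrite mem_iota.
  by split=> h k kK; apply: h; move: kK; rewrite eK mem_iota.
have [k0 [k0n k0K]] : exists k0, (k0 < n)%N /\ k0 \notin K.
  apply: contrapT => h; have sub : {subset iota 0 n <= K}.
    move=> k; rewrite mem_iota /= add0n => kn; apply/negPn/negP => kK.
    by apply: h; exists k.
  have := uniq_leq_size (iota_uniq 0 n) sub.
  by rewrite size_iota nE -[X in (_ <= X)%N]addn0 leq_add2l.
rewrite (pr_partition (measurable_coords K y) (mY k0)).
have B0 (c : B) : c \in B -> #|B|%:R != 0 :> R.
  by move=> _; rewrite pnatr_eq0 -lt0n; apply/card_gt0P; exists c.
pose y' c k := if k == k0 then c else y k.
rewrite (eq_bigr (fun=> #|B|%:R^-1 ^+ (size K).+1)); last first.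
  move=> c _; rewrite -(IH (k0 :: K) (y' c)) /=; last by lia.
  - congr pr; apply/seteqP; split=> x /=.
      case=> h1 h2 k; rewrite inE /y' => /predU1P[->|kK]; first by rewrite eqxx.
      by case: eqP => [kk0|_]; [rewrite kk0 in kK; rewrite kK in k0K|exact: h1].
    move=> h; split=> [k kK|]; last by rewrite h ?mem_head // /y' eqxx.
    rewrite h ?inE ?kK ?orbT // /y'; case: eqP => // kk0.
    by rewrite kk0 (negbTE k0K) in kK.
  - by rewrite k0K.
  - by rewrite k0n.
  - by rewrite nE; lia.
rewrite sumr_const exprS -[LHS]mulr_natr mulrAC mulVf ?mul1r //.
exact: (B0 (y 0%N)).
Qed.

End UniformLaw.

#[short(type="finPointedType")]
HB.structure Definition FinPointed := {T of Finite T & Pointed T}.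

Definition seq_space (B : pointedType) := g_sigma_algebraType
  [set E : set (int -> B) | exists i a, E = (fun x => x i) @^-1` [set a]].

Definition seq_shift (B : pointedType) (x : seq_space B) : seq_space B :=
  fun i => x (i + 1).

Section UniformBernoulli.
Context (R : realType) (B : finPointedType).

Definition seq_coord (i : int) (x : seq_space B) : B := x i.

Lemma discrete_seq_coord i : discrete (seq_coord i).
Proof. by move=> a; apply: sub_sigma_algebra; exists i, a. Qed.

Lemma seq_space_generate : @measurable _ (seq_space B) `<=`
  <<s [set E | exists i a, E = seq_coord i @^-1` [set a]] >>.
Proof. by []. Qed.

(** Spreads the digits of a single number over the two-sided index set. *)
Definition int_index (i : int) : nat :=
  match i with Posz n => n.*2 | Negz n => n.*2.+1 end.

Lemma int_index_inj : injective int_index.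
Proof. by move=> [m|m] [n|n] /= h; lia. Qed.

Let b_gt0 : (0 < #|B|)%N. Proof. by apply/card_gt0P; exists (point : B). Qed.

Let Y (k : nat) (u : measurableTypeR R) : B := nth point (enum B) (digit #|B| k u).

Let mY k : discrete (Y k).
Proof.
have := discrete_comp (fun i : 'I_#|B|.-1.+1 => nth point (enum B) i)
  (discrete_digit b_gt0 (R := R) k).
congr discrete; apply/funext => u /=; rewrite inordK // prednK //.
by rewrite ltn_pmod.
Qed.

Let Y_law n y :
  pr (@unit_uniform R) [set x | forall k, (k < n)%N -> Y k x = y k] = #|B|%:R^-1 ^+ n.
Proof.
pose w k := index (y k) (enum B).
have wb k : (w k < #|B|)%N by rewrite cardE index_mem mem_enum.
have u1 : pr (@unit_uniform R) (`[0, 1[%classic : set (measurableTypeR R)) = 1.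
  by rewrite /pr /= /unit_uniform /mrestr setIid lebesgue_measure_itv /= lte_fin ltr01 oppr0 adde0.
pose m := foldl (fun acc k => acc * #|B| + w k)%N 0%N (iota 0 n).
have mb : (m < #|B| ^ n)%N.
  rewrite {}/m; elim: n => // n IH; rewrite -[X in iota 0 X]addn1 iotaD foldl_cat /= add0n expnS.
  apply: (@leq_trans ((foldl (fun acc k => acc * #|B| + w k)%N 0%N (iota 0 n)).+1 * #|B|)).
    by rewrite mulSn addnC ltn_add2r.
  by rewrite mulnC leq_mul2l IH orbT.
rewrite (@eq_pr_ae _ _ _ (@unit_uniform R) _ [set u | prefix #|B| n u = m] `[0, 1[%classic) //.
- by rewrite /pr /= unit_uniform_prefix //= natrX exprVn.
- rewrite (_ : mkset _ = \bigcap_(k in `I_n) (Y k @^-1` [set y k])) //.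
  by apply: bigcap_measurableType => k _; exact: mY.
- exact: measurable_prefix.
move=> u; rewrite /= in_itv /= => u01; rewrite /m -(@prefix_digits _ _ b_gt0 n u w u01 wb).
split=> h k /h; rewrite /Y /w.
  by move=> <-; rewrite index_uniq ?enum_uniq // -cardE ltn_pmod.
by move=> ->; rewrite nth_index ?mem_enum.
Qed.

Theorem exists_uniform_bernoulli : exists nu : probability (seq_space B) R,
  forall (s : seq int) (y : int -> B), uniq s ->
    pr nu [set x | forall i, i \in s -> x i = y i] = #|B|%:R^-1 ^+ size s.
Proof.
pose f (u : measurableTypeR R) : seq_space B := fun i => Y (int_index i) u.
have mf : measurable_fun setT f.
  apply: (measurable_coord_fun discrete_seq_coord seq_space_generate) => i.
  exact: mY.
have [nu nuE] := exists_pushforward (@unit_uniform R) mf; exists nu => s y us.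
rewrite /pr nuE -(size_map int_index).
pose y' k := y (if odd k then Negz k./2 else Posz k./2).
have y'E i : y' (int_index i) = y i.
  by rewrite /y'; case: i => n /=; rewrite odd_double /= ?doubleK ?uphalf_double.
rewrite -(coords_law mY Y_law y') ?map_inj_uniq //; last exact: int_index_inj.
congr (fine (_ _)); apply/seteqP; split=> u /= h.
  by move=> _ /mapP[i si ->]; rewrite y'E; exact: h.
by move=> i si; rewrite -y'E; apply: h; exact: map_f.
Qed.

End UniformBernoulli.

(** * Invariance and ergodicity of the Bernoulli process *)

Section UniformProcess.
Context (R : realType) (B : finPointedType) (nu : probability (seq_space B) R).

Notation win := (window (@seq_coord B)).

Lemma seq_window_shift i n (x : seq_space B) : win i n (seq_shift x) = win (i + 1) n x.
Proof.
apply: eq_from_tnth => k; rewrite !tnth_mktuple /seq_coord /seq_shift.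
by congr (x _); lia.
Qed.

Lemma seq_window_iter m i n (x : seq_space B) :
  win i n (iter m (@seq_shift B) x) = win (i + m%:Z) n x.
Proof.
elim: m i => [|m IH] i; first by rewrite addr0.
by rewrite iterS seq_window_shift IH; congr (win _ n x); lia.
Qed.

Lemma discrete_seq_window i n : discrete (win i n).
Proof. exact: (discrete_window (@discrete_seq_coord B)). Qed.

Lemma measurable_seq_shift E : measurable E -> measurable (@seq_shift B @^-1` E).
Proof.
by apply: (measurable_shift (@discrete_seq_coord B) (@seq_space_generate B)).
Qed.

Lemma window_law :
  (forall (s : seq int) (y : int -> B), uniq s ->
    pr nu [set x | forall i, i \in s -> x i = y i] = #|B|%:R^-1 ^+ size s) ->
  forall i n w, pmf nu (win i n) w = #|B|%:R^-1 ^+ n.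
Proof.
move=> law i n w; pose s := [seq i + k%:Z | k <- iota 0 n].
pose y (j : int) : B := nth point w (absz (j - i)).
have us : uniq s by rewrite map_inj_uniq ?iota_uniq // => a b /addrI [].
have sn : size s = n by rewrite size_map size_iota.
rewrite -[in RHS]sn -(law s y us); congr pr; apply/seteqP; split=> x /= h.
  move=> j /mapP[k]; rewrite mem_iota add0n => /andP[_ kn] ->.
  rewrite /y addrAC subrr add0r -h -[absz _]/(val (Ordinal kn)) -tnth_nth.
  by rewrite tnth_mktuple.
apply: eq_from_tnth => k; rewrite tnth_mktuple (tnth_nth point).
rewrite /seq_coord h; first by rewrite /y addrAC subrr add0r.
by apply/mapP; exists (val k) => //; rewrite mem_iota /= add0n.
Qed.

Hypothesis uniform_windows : forall i n w, pmf nu (win i n) w = #|B|%:R^-1 ^+ n.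

Lemma uniform_invariant : invariant_measure (@seq_shift B) nu.
Proof.
have mS : measurable_fun setT (@seq_shift B).
  by move=> _ E mE; rewrite setTI; exact: measurable_seq_shift.
have [nu' nuE] := exists_pushforward nu mS.
move=> E mE; rewrite -nuE !prE //; congr EFin.
apply: (pr_unique (@discrete_seq_coord B) (@seq_space_generate B)) => // t C cC.
rewrite (cylinderE cC) /pr nuE -!/(pr _ _); move: (@base _ _ _ _ t C) => P.
rewrite (pr_pred nu P (@discrete_seq_window (- t%:Z) (t + t))).
rewrite (_ : _ @^-1` _ = [set x | P (win (- t%:Z + 1) (t + t) x)]); last first.
  by apply/funext => x /=; rewrite seq_window_shift.
rewrite (pr_pred nu P (@discrete_seq_window _ (t + t))).
by apply: eq_bigr => w _; rewrite !uniform_windows.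
Qed.

(** A shift by [t + t] moves the window of [D] next to that of [C]; together they form one window of
    twice the length. *)
Lemma uniform_independent t C D :
  cylinder (@seq_coord B) t C -> cylinder (@seq_coord B) t D ->
  pr nu (C `&` iter (t + t) (@seq_shift B) @^-1` D) = pr nu C * pr nu D.
Proof.
move=> cC cD.
pose V x := (win (- t%:Z) (t + t) x, win (- t%:Z + (t + t)%N%:Z) (t + t) x).
have mV : discrete V by apply: discrete_pair; exact: discrete_seq_window.
have Vlaw ww : pmf nu V ww = #|B|%:R^-1 ^+ (t + t) * #|B|%:R^-1 ^+ (t + t).
  rewrite -exprD -(uniform_windows (- t%:Z) (cat_tuple ww.1 ww.2)).
  congr pr; apply/seteqP; split=> x /=.
    move=> <-; apply: eq_from_tnth => k.
    rewrite [RHS](tnth_nth point) /= nth_cat size_tuple card_ord.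
    have nthW i n j : (j < n)%N -> nth point (win i n x) j = x (i + j%:Z).
      by move=> jn; rewrite -[j]/(val (Ordinal jn)) -tnth_nth tnth_mktuple.
    rewrite tnth_mktuple; case: ltnP => kt; rewrite nthW //; last first.
      by rewrite ltn_subLR.
    by rewrite /seq_coord; congr (x _); case: k kt => k /= ? ?; lia.
  move=> h; rewrite [ww]surjective_pairing; congr (_, _); apply: eq_from_tnth => k.
    have := congr1 (fun w => tnth w (lshift (t + t) k)) h.
    rewrite tnth_mktuple [RHS](tnth_nth point) /= nth_cat size_tuple ?card_ord ltn_ord.
    by rewrite -tnth_nth tnth_mktuple.
  have := congr1 (fun w => tnth w (rshift (t + t) k)) h.
  rewrite tnth_mktuple [RHS](tnth_nth point) /= nth_cat size_tuple ?card_ord ltnNge leq_addr /=.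
  rewrite addKn -tnth_nth tnth_mktuple => <-.
  by rewrite /seq_coord; congr (x _); lia.
rewrite (cylinderE cC) (cylinderE cD).
move: (@base _ _ _ _ t C) (@base _ _ _ _ t D) => P Q.
rewrite (_ : _ `&` _ = [set x | (fun v => P v.1 && Q v.2) (V x)]); last first.
  apply/seteqP; split=> x /=; rewrite seq_window_iter.
    by case=> -> ->.
  by case/andP.
rewrite (pr_pred nu (fun v => P v.1 && Q v.2) mV).
rewrite (pr_pred nu P (@discrete_seq_window _ _)) (pr_pred nu Q (@discrete_seq_window _ _)).
rewrite (eq_bigr (fun v => #|B|%:R^-1 ^+ (t + t) * #|B|%:R^-1 ^+ (t + t))) //.
rewrite -(pair_big P Q (fun _ _ => #|B|%:R^-1 ^+ (t + t) * #|B|%:R^-1 ^+ (t + t))) /=.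
rewrite mulr_suml; apply: eq_bigr => w _; rewrite mulr_sumr.
by apply: eq_bigr => w' _; rewrite !uniform_windows.
Qed.

(** An invariant set is close to a cylinder that is independent of its own shift by [t + t]; hence
    its probability [p] is as close as desired to [p * p]. *)
Lemma uniform_ergodic : ergodic (@seq_shift B) nu.
Proof.
move=> E mE SE.
have SnE n : iter n (@seq_shift B) @^-1` E = E.
  elim: n => // n IH; rewrite -[RHS]SE -[in RHS]IH; apply/funext => x /=.
  by rewrite -iterS iterSr.
set p := pr nu E; suff : p = 0 \/ p = 1 by rewrite prE // -/p => -[] ->; [left|right].
have p01 : 0 <= p <= 1 by rewrite pr_ge0 pr_le1.
suff pp : p = p * p.
  have /eqP : p * (p - 1) = 0 by rewrite mulrBr mulr1 -pp subrr.
  by rewrite mulf_eq0 subr_eq0 => /orP[]/eqP; [left|right].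
apply/eqP; rewrite -subr_eq0 -normr_le0; apply/ler_addgt0Pr => e e0; rewrite add0r.
have e4 : 0 < e / 4 by rewrite divr_gt0.
have [t [C [cC c1 _]]] := measurable_approx (@discrete_seq_coord B)
  (@seq_space_generate B) nu nu mE e4.
have mC := measurable_cylinder (@discrete_seq_coord B) cC.
set n := (t + t)%N; pose S n := iter n (@seq_shift B).
have mSn D : measurable D -> measurable (S n @^-1` D).
  exact: (measurable_iter measurable_seq_shift).
have indep := uniform_independent cC cC; rewrite -/n -/(S n) in indep.
have mEC : measurable (E `+` C) by apply: measurableU; exact: measurableD.
have h1 : `|p - pr nu C| <= e / 4.
  by apply: le_trans (ltW c1); exact: pr_setY.
have h2 : `|p - pr nu C * pr nu C| <= e / 2.
  rewrite -indep; apply: le_trans (pr_setY nu mE _) _.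
    by apply: measurableI => //; exact: mSn.
  apply: (@le_trans _ _ (pr nu (E `+` C) + pr nu (S n @^-1` (E `+` C)))).
    apply: le_trans (le_prU _ _ _); [apply: le_pr| |exact: mSn] => //.
    - by apply: measurableU; apply: measurableD => //; apply: measurableI => //; exact: mSn.
    - by apply: measurableU => //; exact: mSn.
    move=> x [[Ex /not_andP[nC|nC]]|[[Cx SCx] nE]].
    - by left; left.
    - by right; left; split=> //; rewrite -(SnE n) in Ex.
    - by left; right.
  rewrite (pr_iter measurable_seq_shift uniform_invariant) //; lra.
have h3 : `|pr nu C * pr nu C - p * p| <= e / 2.
  have -> : pr nu C * pr nu C - p * p = (pr nu C - p) * (pr nu C + p) by ring.
  have c01 : 0 <= pr nu C <= 1 by rewrite pr_ge0 pr_le1.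
  have -> : e / 2 = (e / 4) * 2 by field.
  rewrite normrM; apply: ler_pM => //; first by rewrite distrC.
  by rewrite ger0_norm; lra.
have -> : p - p * p = (p - pr nu C * pr nu C) + (pr nu C * pr nu C - p * p) by ring.
by apply: (le_trans (ler_normD _ _)); lra.
Qed.

End UniformProcess.

(** * The stack of open edges *)

Section PushdownAction.
Variable G : digraph.
Implicit Types (w u : seq (gis_gen G)) (a : letter G).

(* The graph inverse semigroup acts by partial maps on pairs of a current vertex
   and a stack of edges: [e^-] pushes [e] and [e^+] pops it. *)
Definition state : Type := (vertex G * seq (edge G))%type.

Definition step (g : gis_gen G) (st : state) : option state :=
  match g, st.2 with
  | Neg e, s => if st.1 == src e then Some (tgt e, e :: s) else None
  | One U, _ => if st.1 == U then Some st else None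
  | Pos e, e' :: s => if (e' == e) && (st.1 == tgt e) then Some (src e, s) else None
  | Pos e, [::] => None
  end.

Fixpoint run w (st : state) : option state :=
  if w is g :: w' then obind (run w') (step g st) else Some st.

Definition run_word (u : gis_word G) (st : state) : option state :=
  if u is Some w then run w st else None.

Lemma run_cat w w' st : run (w ++ w') st = obind (run w') (run w st).
Proof. by elim: w st => //= g w IH st; case: step => //= st'; rewrite IH. Qed.

Lemma run_word_mul (u v : gis_word G) st :
  run_word (gis_mul u v) st = obind (run_word v) (run_word u st).
Proof.
case: u v => [u|] [v|] //=; first exact: run_cat.
by case: run.
Qed.

(** The defining relations hold for the action, so a word that acts somewhere is nonzero. *)
Lemma gis_eq_run_word (u v : gis_word G) st : gis_eq u v -> run_word u st = run_word v st.
Proof.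
move=> uv; elim: uv st => {u v} [u v|//|u v _ IH st|u v w _ IH1 _ IH2 st|u u' v v' _ IH1 _ IH2 st].
- case=> [V [U s]|U W UW [V s]|e [V s]|e [V s]|e [V s]|e [V s]|f [V s]|f g fg [V s]] /=.
  + by case: eqP => //= ->; rewrite eqxx.
  + by case: (V =P U) => //= ->; case: (U =P W).
  + by case: eqP => //= ->; rewrite eqxx.
  + by case: eqP => //= _; rewrite eqxx.
  + by case: s => [|e' s]; case: (V =P tgt e) => //= VE; rewrite ?VE ?eqxx ?andbF.
  + by case: s => [|e' s] //; case: ifP => //= _; rewrite eqxx.
  + by case: eqP => //= ->; rewrite !eqxx.
  + by case: (V =P _) => //= _; case: eqP.
- by rewrite IH.
- by rewrite IH1.
- by rewrite !run_word_mul IH1; case: (run_word u' st).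
Qed.

Lemma run_frame w V s W s' r : run w (V, s) = Some (W, s') -> run w (V, s ++ r) = Some (W, s' ++ r).
Proof.
elim: w V s => [|g w IH] V s /=; first by case=> -> ->.
case: g => [e|U|e] /=; last case: s => [|e' s] //=; case: ifP => //= _; exact: IH.
Qed.

Lemma gis_eq_mul0 w w' : gis_eq (Some w) None -> gis_eq (Some (w ++ w')) None.
Proof. by move=> w0; apply: (gis_eq_mul w0 (gis_eq_refl (Some w'))). Qed.

Lemma gis_eq_cat w u (v : gis_word G) :
  gis_eq (Some u) v -> gis_eq (Some (w ++ u)) (gis_mul (Some w) v).
Proof. by move=> uv; apply: (gis_eq_mul (gis_eq_refl (Some w)) uv). Qed.

(** The last generator already absorbs the idempotent of the vertex where it ends. This carries the
    final vertex of a run over to the semigroup. *)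
Lemma gis_eq_end w st W s : (0 < size w)%N -> run w st = Some (W, s) ->
  gis_eq (Some w) (Some (w ++ [:: One W])).
Proof.
case/lastP: w => // w g _; rewrite -cats1 run_cat; case: run => //= -[V t].
rewrite -catA; case: g => [e|U|e] /=.
- case: ifP => //= _ [<- _]; apply: (@gis_eq_cat _ _ (Some [:: _; _])).
  exact/gis_eq_rel/rel_neg_tgt.
- case: eqP => //= -> [<- _]; apply/gis_eq_sym/(@gis_eq_cat _ _ (Some [:: _])).
  exact/gis_eq_rel/rel_idem.
- case: t => //= e' t; case: ifP => //= _ [<- _]; apply: (@gis_eq_cat _ _ (Some [:: _; _])).
  exact/gis_eq_rel/rel_pos_src.
Qed.

Definition letter_src a : vertex G := match a with inl e => src e | inr e => tgt e end.

Lemma gis_eq_begin a : gis_eq (Some [:: gen_of_letter a])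
  (Some [:: One (letter_src a); gen_of_letter a]).
Proof. by apply: gis_eq_rel; case: a => e; [exact: rel_neg_src|exact: rel_pos_tgt]. Qed.

Lemma gis_eq_start w st W s a : (0 < size w)%N -> run w st = Some (W, s) ->
  W != letter_src a -> gis_eq (Some (w ++ [:: gen_of_letter a])) None.
Proof.
move=> w0 wr Wa.
apply: (gis_eq_trans (gis_eq_mul (gis_eq_end w0 wr) (gis_eq_begin a))) => /=.
rewrite -catA; apply: (@gis_eq_cat _ _ (None)) => /=.
apply: (@gis_eq_mul0 [:: One W; One (letter_src a)] [:: gen_of_letter a]).
by apply/gis_eq_rel/rel_orth/eqP.
Qed.

(** Normal form of a nonzero element: closing letters, then opening letters. *)
Definition normal_word V (ps ns : seq (edge G)) : seq (gis_gen G) :=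
  One V :: map (@Pos G) ps ++ map (@Neg G) ns.

(** Induction on the last letter: an opening letter is appended; a closing letter cancels the last
    opening letter, clashes with it, or is appended to [ps] if none is left. Keeping a run of the
    normal form from the stack [ps] records which vertex comes next. *)
Lemma gis_normal_form V (w : seq (letter G)) :
  gis_eq (Some (One V :: map (@gen_of_letter G) w)) None \/
  exists ps ns W,
    gis_eq (Some (One V :: map (@gen_of_letter G) w)) (Some (normal_word V ps ns)) /\
    run (normal_word V ps ns) (V, ps) = Some (W, rev ns).
Proof.
elim/last_ind: w => [|w a [w0|[ps [ns [W [wu ur]]]]]].
- right; exists [::], [::], V; split; first exact: gis_eq_refl.
  by rewrite /= eqxx.
- by left; rewrite map_rcons -cats1 -cat_cons; exact: gis_eq_mul0.
set u := normal_word V ps ns in wu ur.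
have wau : gis_eq (Some (One V :: map (@gen_of_letter G) (rcons w a)))
    (Some (u ++ [:: gen_of_letter a])).
  by rewrite map_rcons -cats1 -cat_cons; exact: (gis_eq_mul wu (gis_eq_refl (Some [:: gen_of_letter a]))).
have [Wa|Wa] := eqVneq W (letter_src a); last first.
  by left; apply: (gis_eq_trans wau); exact: (gis_eq_start _ ur).
case: a Wa wau => e We wau; rewrite /letter_src in We.
  have uE : normal_word V ps (rcons ns e) = u ++ [:: Neg e].
    by rewrite /normal_word map_rcons -cats1 catA.
  right; exists ps, (rcons ns e), (tgt e); split; first by rewrite uE.
  by rewrite uE run_cat ur /= We eqxx rev_rcons.
case/lastP: ns => [|ns f] in u wu ur wau *.
  have uE : normal_word V (rcons ps e) [::] = u ++ [:: Pos e].
    by rewrite /u /normal_word !cats0 map_rcons -cats1.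
  right; exists (rcons ps e), [::], (src e); split; first by rewrite uE.
  by rewrite uE run_cat -cats1 (run_frame [:: e] ur) /= We !eqxx.
set u' := normal_word V ps ns.
have uE : u = u' ++ [:: Neg f] by rewrite /u /normal_word map_rcons -cats1 catA.
rewrite {}uE in ur wau.
have Er : run u' (V, ps) = Some (src f, rev ns).
  move: ur; rewrite run_cat; case: run => [[U s]|] //=.
  by case: eqP => //= -> [_]; rewrite rev_rcons => -[->].
have [fe|fe] := eqVneq f e; last first.
  left; apply: (gis_eq_trans wau); rewrite -catA.
  apply: (@gis_eq_cat _ _ (None)).
  by apply/gis_eq_rel/rel_clash/eqP.
right; exists ps, ns, (src e); rewrite Er fe; split=> //.
apply: (gis_eq_trans wau); rewrite -catA.
apply: (@gis_eq_trans _ _ (Some (u' ++ [:: One (src e)]))).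
  by apply: (@gis_eq_cat _ _ (Some [:: _])); rewrite fe; apply/gis_eq_rel/rel_cancel.
by apply: gis_eq_sym; rewrite -fe; exact: (gis_eq_end _ Er).
Qed.

(** Replaces the congruence by a computation: the normal form of a nonzero word acts on the stack of
    the edges that it closes. *)
Theorem nonzero_wordP (w : seq (letter G)) : w != [::] ->
  nonzero_word w <-> exists st, run (map (@gen_of_letter G) w) st != None.
Proof.
move=> w0; split=> [nz|[st wst] /(gis_eq_run_word st) /= h]; last first.
  by rewrite h in wst.
case: w w0 nz => // a w _ nz; pose V := letter_src a.
have Va : gis_eq (Some (map (@gen_of_letter G) (a :: w)))
    (Some (One V :: map (@gen_of_letter G) (a :: w))).
  exact: (gis_eq_mul (gis_eq_begin a) (gis_eq_refl (Some _))).
case: (gis_normal_form V (a :: w)) => [h|[ps [ns [W [wu ur]]]]].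
  by case: nz; exact: gis_eq_trans h.
exists (V, ps); have := gis_eq_run_word (V, ps) (gis_eq_trans Va wu).
by rewrite /run_word ur => ->.
Qed.

End PushdownAction.

(** * Time reversal *)

Section Reversal.
Variable G : digraph.

Definition flip_gen (g : gis_gen G) : gis_gen G :=
  match g with Neg e => Pos e | One U => One U | Pos e => Neg e end.

(** The inversion of the inverse semigroup; it permutes the defining relations. *)
Definition reverse_word (u : gis_word G) : gis_word G :=
  if u is Some w then Some (rev (map flip_gen w)) else None.

Lemma reverse_word_mul u v :
  reverse_word (gis_mul u v) = gis_mul (reverse_word v) (reverse_word u).
Proof. by case: u v => [u|] [v|] //=; rewrite map_cat rev_cat. Qed.

Lemma gis_eq_reverse u v : gis_eq u v -> gis_eq (reverse_word u) (reverse_word v).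
Proof.
elim=> {u v} [u v|u|u v _ IH|u v w _ IH1 _ IH2|u u' v v' _ IH1 _ IH2].
- case=> [V|U W UW|e|e|e|e|f|f g fg]; apply: gis_eq_rel; rewrite /reverse_word /rev /=.
  + exact: rel_idem.
  + by apply: rel_orth => /esym.
  + exact: rel_pos_src.
  + exact: rel_pos_tgt.
  + exact: rel_neg_tgt.
  + exact: rel_neg_src.
  + exact: rel_cancel.
  + by apply: rel_clash => /esym.
- exact: gis_eq_refl.
- exact: gis_eq_sym.
- exact: gis_eq_trans IH2.
- by rewrite !reverse_word_mul; exact: gis_eq_mul.
Qed.

Definition flip (a : letter G) : letter G :=
  match a with inl e => inr e | inr e => inl e end.

Lemma flipK : involutive flip. Proof. by case. Qed.

Lemma nonzero_word_reverse (w : seq (letter G)) :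
  nonzero_word w -> nonzero_word (rev (map flip w)).
Proof.
move=> nz /gis_eq_reverse /= h; apply: nz; move: h.
by rewrite map_rev map_rev revK -!map_comp; congr (gis_eq (Some _) None);
  apply: eq_map; case.
Qed.

Definition reversal (x : borel_full_shift G) : borel_full_shift G :=
  fun i => flip (x (- i)).

Lemma reversalK : involutive reversal.
Proof. by move=> x; apply/funext => i; rewrite /reversal flipK opprK. Qed.

(** The positions [[i, i + n)] are read backwards from [[1 - i - n, 1 - i)]. *)
Lemma factor_reversal x i n :
  factor (reversal x) i n = rev (map flip (factor x (1 - i - n%:Z) n)) :> seq _.
Proof.
apply: (@eq_from_nth _ (x 0)) => [|k]; first by rewrite size_rev size_map !size_tuple.
rewrite size_tuple => kn.
have nthF y j m : (m < n)%N -> nth (x 0) (factor y j n) m = y (j + m%:Z).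
  by move=> mn; rewrite -[m]/(val (Ordinal mn)) -tnth_nth tnth_mktuple.
rewrite nthF // nth_rev size_map size_tuple // (nth_map (x 0)) ?size_tuple; last lia.
rewrite nthF; last lia.
by rewrite /reversal; congr (flip (x _)); lia.
Qed.

Lemma markov_dyck_reversal x : markov_dyck G x -> markov_dyck G (reversal x).
Proof.
by move=> mx i n n0; rewrite factor_reversal; apply: nonzero_word_reverse; exact: mx.
Qed.

End Reversal.

Lemma sum_option (R : nmodType) (I : finType) (F : option I -> R) :
  \sum_o F o = F None + \sum_i F (Some i).
Proof.
rewrite (bigD1 None) //=; congr (_ + _).
rewrite (reindex_omap Some id) //=; last by case.
by apply: eq_bigl => i; rewrite eqxx.
Qed.

(** * Codes of blocks of two letters *)

Section PairCodes.
Variables (N M : nat).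

(* In the code of a block, the first component is [Some n] for f(n)^- and [None]
   for a letter e(n, m)^+; the second is [Some m] for e(n, m)^- and [None] for a
   letter f(n)^+. *)
Definition pair_code : Type := (option 'I_N * option 'I_M)%type.
HB.instance Definition _ := Finite.on pair_code.
HB.instance Definition _ := Pointed.on pair_code.

Definition pair_edge : Type := ('I_N * 'I_M)%type.

Implicit Types (b : pair_code) (bs : seq pair_code) (r s : seq pair_edge).

(** The only blocks whose letters depend on the stack: after f(n)^-, a closing second letter can
    only be f(n)^+. *)
Definition needs_top b : bool := ~~ isSome b.1.

Variable p0 : pair_edge.

(* An entry (n, m) of the stack stands for an open f(n) below an open e(n, m).
   The default [p0] is what a closing letter reads from an empty stack. *)
Definition stack b s : seq pair_edge :=
  match b with
  | (Some n, Some m) => (n, m) :: s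
  | (Some n, None) => s
  | (None, Some m) => ((head p0 s).1, m) :: behead s
  | (None, None) => behead s
  end.

Fixpoint stacks s bs : seq pair_edge :=
  if bs is b :: bs' then stacks (stack b s) bs' else s.

Fixpoint safe s bs : bool :=
  if bs is b :: bs' then ~~ (needs_top b && nilp s) && safe (stack b s) bs' else true.

(** Size of the known part of the stack. A block that reads below it and then opens an edge e leaves
    one entry, known from then on; hence [maxn h 1]. *)
Definition height b (h : nat) : nat :=
  match b with
  | (Some _, Some _) => h.+1
  | (Some _, None) => h
  | (None, Some _) => maxn h 1
  | (None, None) => h.-1
  end.

Fixpoint underflows (h : nat) bs : nat :=
  if bs is b :: bs' then ((needs_top b && (h == 0)) + underflows (height b h) bs')%N else 0%N.

Lemma stacks_cat s bs bs' : stacks s (bs ++ bs') = stacks (stacks s bs) bs'.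
Proof. by elim: bs s => //= b bs IH s. Qed.

Lemma safe_cat s bs bs' : safe s (bs ++ bs') = safe s bs && safe (stacks s bs) bs'.
Proof. by elim: bs s => //= b bs IH s; rewrite IH andbA. Qed.

Lemma stack_frame b s r : ~~ (needs_top b && nilp s) -> stack b (s ++ r) = stack b s ++ r.
Proof. by case: b => [[n|] [m|]]; case: s. Qed.

Lemma stacks_frame bs s r : safe s bs -> stacks s bs ++ r = stacks (s ++ r) bs.
Proof.
by elim: bs s => //= b bs IH s /andP[bs0 /IH ->]; rewrite stack_frame.
Qed.

Lemma size_stack b s : ~~ (needs_top b && nilp s) -> size (stack b s) = height b (size s).
Proof.
case: b => [[n|] [m|]] //=; case: s => //= p s _.
Qed.

Section Letters.
Context {hN : (0 < N)%N}.
Local Notation G := (Ghat M hN).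
Local Notation block := (letter G * letter G)%type.

Definition f_neg (n : 'I_N) : letter G := inl (inl n).
Definition f_pos (n : 'I_N) : letter G := inr (inl n).
Definition e_neg (p : pair_edge) : letter G := inl (inr p).
Definition e_pos (p : pair_edge) : letter G := inr (inr p).

Definition decode (p : pair_edge) b : block :=
  match b with
  | (Some n, Some m) => (f_neg n, e_neg (n, m))
  | (Some n, None) => (f_neg n, f_pos n)
  | (None, Some m) => (e_pos p, e_neg (p.1, m))
  | (None, None) => (e_pos p, f_pos p.1)
  end.

Definition encode (ab : block) : pair_code :=
  (if ab.1 is inl (inl n) then Some n else None,
   if ab.2 is inl (inr p) then Some p.2 else None).

Lemma decodeK p b : encode (decode p b) = b.
Proof. by case: b => [[n|] [m|]]. Qed.

Lemma decode_known p p' b : ~~ needs_top b -> decode p b = decode p' b.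
Proof. by case: b => [[n|] [m|]]. Qed.

Fixpoint decodes s bs : seq block :=
  if bs is b :: bs' then decode (head p0 s) b :: decodes (stack b s) bs' else [::].

Lemma decodes_cat s bs bs' :
  decodes s (bs ++ bs') = decodes s bs ++ decodes (stacks s bs) bs'.
Proof. by elim: bs s => //= b bs IH s; rewrite IH. Qed.

Lemma size_decodes s bs : size (decodes s bs) = size bs.
Proof. by elim: bs s => //= b bs IH s; rewrite IH. Qed.

Fixpoint flat (ws : seq block) : seq (letter G) :=
  if ws is w :: ws' then [:: w.1, w.2 & flat ws'] else [::].

Lemma flat_cat ws ws' : flat (ws ++ ws') = flat ws ++ flat ws'.
Proof. by elim: ws => //= w ws ->. Qed.

Definition gens (w : seq (letter G)) : seq (gis_gen G) := map (@gen_of_letter G) w.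

(** Open edges f(n) are dropped: which one is closed is forced by the vertex between the two letters
    of the block. *)
Definition pair_edges (st : seq (edge G)) : seq pair_edge :=
  pmap (fun e => if e is inr p then Some p else None) st.

Lemma run_block (w : block) st st' : run (gens [:: w.1; w.2]) (None, st) = Some st' ->
  [/\ st'.1 = None, w = decode (head p0 (pair_edges st)) (encode w) &
      pair_edges st'.2 = stack (encode w) (pair_edges st)].
Proof.
case: w => -[[n|[n m]]|[n|[n m]]] a' //=.
- case: a' => -[n'|[n' m']] //=.
  + by case: eqP => //= -[->] [<-].
  + by case: eqP => //= -[->]; rewrite eqxx => -[<-].
- by case: st => //= e st; rewrite andbF.
- case: st => //= e st; case: eqP => //= -> /=.
  case: a' => -[n'|[n' m']] //=.
  + by case: eqP => //= -[->] [<-].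
  + case: st => //= e' st; case: eqP => //= ->; case: eqP => //= -[->] [<-].
    by [].
  + by case: st => //= e' st; rewrite andbF.
Qed.

Lemma run_blocks ws st : run (gens (flat ws)) (None, st) != None ->
  ws = decodes (pair_edges st) (map encode ws).
Proof.
elim: ws st => // w ws IH st.
rewrite [gens _](_ : _ = gens [:: w.1; w.2] ++ gens (flat ws)) // run_cat.
case E : run => [[V st']|] //= h; have [/= V0 wE sE] := run_block E.
by rewrite -wE -sE -IH // -V0.
Qed.

Fixpoint stack_edges s : seq (edge G) :=
  if s is p :: s' then [:: inr p, inl p.1 & stack_edges s'] else [::].

(** Converse of [run_blocks]: decoding without underflow yields a word that acts, hence a nonzero
    one. *)
Lemma run_decodes s bs : safe s bs ->
  run (gens (flat (decodes s bs))) (None, stack_edges s) =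
  Some (None, stack_edges (stacks s bs)).
Proof.
elim: bs s => //= b bs IH s /andP[bs0 /IH sbs].
rewrite -sbs {sbs IH}.
case: b bs0 => [[n|] [m|]] /=; rewrite ?eqxx //.
  by case: s => //= -[n m'] s _; rewrite eqxx /= eqxx.
by case: s => //= -[n m'] s _; rewrite eqxx /= !eqxx.
Qed.

(* Only the top part [r] of the stack is known: reading below it branches over
   all possible entries. *)
Fixpoint words_of r bs : seq (seq block) :=
  if bs is b :: bs' then
    if needs_top b && nilp r then
      [seq decode p b :: w | p <- enum {: pair_edge}, w <- words_of (stack b [:: p]) bs']
    else [seq decode (head p0 r) b :: w | w <- words_of (stack b r) bs']
  else [:: [::]].

Lemma mem_words_of bs r s : decodes (r ++ s) bs \in words_of r bs.
Proof.
elim: bs r s => //= b bs IH r s; case: ifP => [/andP[tb /nilP ->]|rb].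
  apply/allpairsPdep; exists (head p0 s), (decodes (stack b s) bs).
  split; rewrite ?mem_enum // /=.
  rewrite (_ : stack b s = stack b [:: head p0 s] ++ behead s); first exact: IH.
  by case: b tb => [[n|] [m|]].
apply/mapP; exists (decodes (stack b (r ++ s)) bs).
  by rewrite stack_frame ?rb //; exact: IH.
by congr (_ :: _); case: b rb => [[n|] [m|]] //; case: r.
Qed.

(** Each underflow branches over the [N * M] possible entries; all other blocks are determined. *)
Lemma size_words_of bs r : size (words_of r bs) = ((N * M) ^ underflows (size r) bs)%N.
Proof.
elim: bs r => //= b bs IH r; case: ifP => [/andP[tb /nilP ->]|rb].
  have h1 p : size (stack b [:: p]) = height b 0 by case: b tb => [[n|] [m|]].
  rewrite /= expnS size_allpairs_dep (eq_map (g := fun=> ((N * M) ^ underflows (height b 0) bs)%N)).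
    rewrite -[X in _ = (X * _)%N](_ : #|{: pair_edge}| = _); last first.
      by rewrite card_prod !card_ord.
    rewrite cardE; elim: (enum _) => //= p s ->.
    by rewrite mulSn.
  by move=> p; rewrite IH h1.
by rewrite size_map IH size_stack ?rb.
Qed.

End Letters.

Fixpoint all_codes (l : nat) : seq (seq pair_code) :=
  if l is l'.+1 then [seq b :: bs | b <- enum {: pair_code}, bs <- all_codes l'] else [:: [::]].

Lemma mem_all_codes bs : bs \in all_codes (size bs).
Proof.
elim: bs => //= b bs IH; apply/allpairsP; exists (b, bs); split=> //=.
by rewrite mem_enum.
Qed.

(** * Number of words, summed over all code sequences *)

Section Count.
Context (R : realType).
Hypotheses (hN : (0 < N)%N) (hM : (0 < M)%N).
Local Notation q := ((N * M)%:R : R).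
Local Notation B := (((N + 1) * (M + 1))%:R : R).

Lemma sum_pair_code (F : pair_code -> R) : \sum_b F b = F (None, None) +
  \sum_m F (None, Some m) + \sum_n F (Some n, None) + \sum_n \sum_m F (Some n, Some m).
Proof.
rewrite (eq_bigr (fun b => F (b.1, b.2))); last by case.
rewrite -(pair_bigA _ (fun o o' => F (o, o'))) /= sum_option sum_option.
rewrite [X in _ + X = _](eq_bigr (fun n => F (Some n, None) + \sum_m F (Some n, Some m))).
  by rewrite big_split /= !addrA.
by move=> n _; rewrite sum_option.
Qed.

(* [1] and [q ^ - h] span the functions that are harmonic, away from height 0,
   for the height of the stack under uniformly distributed codes. *)
Lemma sum_underflows l h :
  \sum_(bs <- all_codes l) q ^+ underflows h bs <=
  B ^+ l * (1 + (q * (M%:R + 2) + N%:R) * l%:R * q^-1 ^+ h).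
Proof.
have q1 : 1 <= q by rewrite ler1n muln_gt0 hN hM.
have q0 : 0 < q by exact: lt_le_trans q1.
(* The total weight of all codes at height 0, where a code that underflows counts [q] times. The
   term in [l] pays for the failure of harmonicity there. *)
set c := q * (M%:R + 2) + N%:R.
have BE : B = q + N%:R + M%:R + 1 by rewrite natrM !natrD natrM; ring.
elim: l h => [|l IH] h; first by rewrite big_seq1 /= !expr0 mulr0 mul0r addr0 mulr1.
rewrite /= big_allpairs_dep big_enum /= exprS.
set Z := fun h => B ^+ l * (1 + c * l%:R * q^-1 ^+ h) in IH.
have term b : \sum_(bs <- all_codes l) q ^+ underflows h (b :: bs) <=
    (if needs_top b && (h == 0%N) then q else 1) * Z (height b h).
  rewrite /=; case: ifP => bh.
    under eq_bigr do rewrite exprS; rewrite -mulr_sumr.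
    by apply: ler_wpM2l; [exact: ltW|exact: IH].
  by rewrite mul1r; apply: IH.
apply: (le_trans (ler_sum _ (fun b _ => term b))); rewrite sum_pair_code /needs_top /=.
have Bl : 0 <= B ^+ l by rewrite exprn_ge0.
have c0 : 0 <= c by rewrite addr_ge0 // mulr_ge0 ?addr_ge0.
rewrite [X in _ + X <= _](eq_bigr (fun=> (1 * Z h.+1) *+ M)); last first.
  by move=> n _; rewrite sumr_const card_ord.
rewrite !sumr_const !card_ord -[(_ * Z (maxn h 1)) *+ M]mulr_natl.
rewrite -[(1 * Z h) *+ N]mulr_natl -[(1 * Z h.+1) *+ M]mulr_natl.
rewrite -[(M%:R * _) *+ N]mulr_natl !mul1r [X in _ + X <= _]mulrA -natrM.
rewrite [B * _]mulrC -[leRHS]mulrA.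
have N0 : 0 <= N%:R :> R by [].
have M0 : 0 <= M%:R :> R by [].
have lE : l.+1%:R = l%:R + 1 :> R by rewrite natr1.
rewrite /Z lE {lE}.
move: N0 M0 q0 c0 BE Bl; rewrite /c.
move: (N%:R : R) (M%:R : R) q B => n m Q b n0 m0 Q0 c0 -> {q1 IH term Z c}.
set t := _ ^+ l => t0.
have l0 : 0 <= l%:R :> R by [].
move: (l%:R : R) l0 => L L0.
case: h => [|h] /=.
  rewrite (_ : maxn 0 1 = 1%N) // expr0 expr1.
  have -> : Q * (t * (1 + (Q * (m + 2) + n) * L * 1)) +
     m * (Q * (t * (1 + (Q * (m + 2) + n) * L * Q^-1))) +
     n * (t * (1 + (Q * (m + 2) + n) * L * 1)) +
     Q * (t * (1 + (Q * (m + 2) + n) * L * Q^-1)) =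
     t * (Q * (m + 2) + n + (Q + n + m + 1) * ((Q * (m + 2) + n) * L)).
    by field; rewrite gt_eqF.
  apply: ler_wpM2l => //.
  move: (Q * (m + 2) + n) c0 => c c0.
  rewrite -subr_ge0.
  have -> : (Q + n + m + 1) * (1 + c * (L + 1) * 1) - (c + (Q + n + m + 1) * (c * L)) =
    (Q + n + m + 1) + (Q + n + m) * c by ring.
  by rewrite !addr_ge0 ?mulr_ge0 ?addr_ge0 // ltW.
rewrite (_ : maxn h.+1 1 = h.+1); last by rewrite /maxn; case: h.
rewrite ?mul1r.
have y0 : 0 <= Q^-1 ^+ h.+1 by rewrite exprn_ge0 // invr_ge0 ltW.
have -> : Q^-1 ^+ h = Q * Q^-1 ^+ h.+1 by rewrite exprS mulrA mulfV ?mul1r // gt_eqF.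
have -> : Q^-1 ^+ h.+2 = Q^-1 ^+ h.+1 / Q by rewrite exprSr.
move: (Q^-1 ^+ h.+1) y0 => y y0.
move: (Q * (m + 2) + n) c0 => c c0.
have -> : t * (1 + c * L * (Q * y)) + m * (t * (1 + c * L * y)) +
   n * (t * (1 + c * L * y)) + Q * (t * (1 + c * L * (y / Q))) =
   t * ((Q + n + m + 1) * (1 + c * L * y)).
  by field; rewrite gt_eqF.
apply: ler_wpM2l => //; apply: ler_wpM2l; first by rewrite !addr_ge0 // ltW.
by rewrite lerD2l ler_wpM2r // ler_wpM2l // lerDl.
Qed.

End Count.

End PairCodes.

Definition slice (A : Type) (y : int -> A) (i : int) (l : nat) : seq A :=
  [seq y (i + k%:Z) | k <- iota 0 l].

Section Slices.
Context (A : Type).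
Implicit Types (y : int -> A) (i : int).

Lemma size_slice y i l : size (slice y i l) = l.
Proof. by rewrite size_map size_iota. Qed.

Lemma slice_add y i l l' : slice y i (l + l') = slice y i l ++ slice y (i + l%:Z) l'.
Proof.
rewrite /slice iotaD map_cat add0n -[in iota l l'](addn0 l) iotaDl -map_comp.
by congr (_ ++ _); apply: eq_map => k /=; congr (y _); lia.
Qed.

Lemma slice1 y i : slice y i 1 = [:: y i].
Proof. by rewrite /slice /= addr0. Qed.

Lemma sliceS y i l : slice y i l.+1 = rcons (slice y i l) (y (i + l%:Z)).
Proof. by rewrite -addn1 slice_add slice1 cats1. Qed.

Lemma take_slice y i k l : (k <= l)%N -> take k (slice y i l) = slice y i k.
Proof. by move=> kl; rewrite -(subnKC kl) slice_add take_size_cat ?size_slice. Qed.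

Lemma nth_slice a y i k l : (k < l)%N -> nth a (slice y i l) k = y (i + k%:Z).
Proof. by move=> kl; rewrite (nth_map 0%N) ?size_iota // nth_iota. Qed.

Lemma slice_factor y i l : factor y i l = slice y i l :> seq A.
Proof. by rewrite /factor /slice /= -val_enum_ord -map_comp. Qed.

Lemma slice_map (B : Type) (f : A -> B) y i l : map f (slice y i l) = slice (f \o y) i l.
Proof. by rewrite /slice -map_comp. Qed.

End Slices.

(** * Coding and decoding of two-sided sequences *)

Section Coding.
Variables (N M : nat) (hN : (0 < N)%N) (hM : (0 < M)%N).
Local Notation G := (Ghat M hN).
Local Notation pair_code := (pair_code N M).
Local Notation pair_edge := (pair_edge N M).
Let p0 : pair_edge := (Ordinal hN, Ordinal hM).
Implicit Types (x : borel_full_shift G) (be : seq_space pair_code).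

Definition block_at x (j : int) : letter G * letter G := (x (j * 2), x (j * 2 + 1)).

Definition codes x : seq_space pair_code := fun j => encode (block_at x j).

Definition at_root x (i : int) : bool := letter_src (x i) == None.

Lemma flat_slice x j l : flat (slice (block_at x) j l) = slice x (j * 2) l.*2.
Proof.
elim: l => // l IH; rewrite sliceS -cats1 flat_cat IH doubleS !sliceS -!cats1 -catA /=.
have -> : (j + l%:Z) * 2 = j * 2 + l.*2%:Z by lia.
by have -> : j * 2 + l.*2%:Z + 1 = j * 2 + l.*2.+1%:Z by lia.
Qed.

Lemma run_src (a : letter G) w V st :
  run (gen_of_letter a :: w) (V, st) != None -> V = letter_src a.
Proof.
case: a => e /=; first by case: (V =P _).
by case: st => //= e' st; case: (e' == e) => //=; case: (V =P _).
Qed.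

Lemma run_slice x : markov_dyck G x -> forall i n, (0 < n)%N ->
  exists st, run (gens (slice x i n)) (letter_src (x i), st) != None.
Proof.
move=> mx i n n0; have w0 : (factor x i n : seq _) != [::].
  by rewrite -size_eq0 size_tuple -lt0n.
have /(nonzero_wordP w0)[[V st]] := mx i n n0.
rewrite slice_factor -/(gens _) => h; exists st; move: h.
case: n n0 {w0} => // n _; rewrite /slice (_ : iota 0 n.+1 = 0%N :: iota 1 n) // map_cons addr0.
by move=> h; rewrite -(run_src h).
Qed.

Definition letter_tgt (a : letter G) : vertex G :=
  match a with inl e => tgt e | inr e => src e end.

Lemma run_src_tgt (a a' : letter G) V st :
  run (gens [:: a; a']) (V, st) != None -> letter_src a' = letter_tgt a.
Proof.
rewrite (_ : gens _ = [:: gen_of_letter a] ++ [:: gen_of_letter a']) // run_cat.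
case E : run => [[W st']|] // /(run_src (w := [::])) <-; move: E.
case: a => e /=; first by case: (V =P _) => //= _ [].
by case: st => //= e' st; case: ifP => //= _ [].
Qed.

(** Every edge has exactly one end at V(0). *)
Lemma at_root_succ x i : markov_dyck G x -> at_root x (i + 1) = ~~ at_root x i.
Proof.
move=> mx; have [st] := run_slice mx i (isT : 0 < 2)%N.
rewrite /slice /= addr0 -/(gens [:: _; _]) /at_root => /run_src_tgt ->.
by case: (x i) => [[n|[n m]]|[n|[n m]]].
Qed.

Lemma at_root_even x j : markov_dyck G x -> at_root x (j * 2) = at_root x 0.
Proof.
move=> mx; have h i : at_root x (i + 2) = at_root x i.
  by rewrite (_ : i + 2 = i + 1 + 1) ?at_root_succ ?negbK //; lia.
elim/int_ind: j => [|n IH|n IH]; first by rewrite mul0r.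
  by rewrite -IH -[RHS]h; congr (at_root x _); lia.
by rewrite -IH -h; congr (at_root x _); lia.
Qed.

Lemma blocks_decode x : markov_dyck G x -> at_root x 0 -> forall j l,
  exists s, slice (block_at x) j l = decodes p0 s (slice (codes x) j l).
Proof.
move=> mx r0 j [|l]; first by exists [::].
have [st] := run_slice mx (j * 2) (isT : 0 < l.+1.*2)%N.
have /eqP -> : at_root x (j * 2) by rewrite at_root_even.
rewrite -flat_slice => /(run_blocks p0) h; exists (pair_edges st).
by rewrite {1}h slice_map.
Qed.

(** The entry on top of the stack before block [j], known from finitely many earlier blocks read
    from an empty stack without underflow. No initial stack at minus infinity has to be chosen. *)
Definition top be (j : int) (p : pair_edge) : Prop := exists l s,
  safe p0 [::] (slice be (j - l%:Z) l) /\ stacks p0 [::] (slice be (j - l%:Z) l) = p :: s.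

Definition good be : Prop := forall j, exists p, top be j p.

Lemma block_decode x : markov_dyck G x -> at_root x 0 -> forall j,
  exists p, block_at x j = decode p (codes x j).
Proof.
move=> mx r0 j; have [s] := blocks_decode mx r0 j 1; rewrite !slice1.
by move=> /(congr1 (head (block_at x j))) h; exists (head p0 s).
Qed.

(* A stack known over a window stays known, with further entries at the bottom,
   over every longer window ending at the same time. *)
Lemma stacks_extend be j l l' (s : seq pair_edge) : (l <= l')%N ->
  safe p0 [::] (slice be (j - l%:Z) l) ->
  stacks p0 s (slice be (j - l'%:Z) l') =
  stacks p0 [::] (slice be (j - l%:Z) l) ++
    stacks p0 s (slice be (j - l'%:Z) (l' - l)).
Proof.
move=> ll' sl; rewrite stacks_frame // -[X in slice _ _ X](subnK ll') slice_add stacks_cat.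
congr (stacks _ _ (slice be _ _)); lia.
Qed.

Lemma top_unique be j p p' : top be j p -> top be j p' -> p = p'.
Proof.
move=> [l [s [sl es]]] [l' [s' [sl' es']]].
have [ll'|/ltnW l'l] := leqP l l'.
  by have := stacks_extend [::] ll' sl; rewrite es' es => -[].
by have := stacks_extend [::] l'l sl'; rewrite es' es => -[].
Qed.

Definition root_letter : letter G := point.

(** By [top_unique], [xget] returns the only possible top entry. Code sequences that are not [good]
    go to a constant sequence. *)
Definition decode_seq be : borel_full_shift G := fun i =>
  if `[< good be >] then
    let ab := decode (xget p0 (top be (i %/ 2)%Z)) (be (i %/ 2)%Z) in
    if (i %% 2)%Z == 0 then ab.1 else ab.2
  else root_letter.

Lemma block_decode_seq be j : good be ->
  block_at (decode_seq be) j = decode (xget p0 (top be j)) (be j).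
Proof.
move=> gb; rewrite /block_at /decode_seq asboolT //=.
have -> : (j * 2 %/ 2)%Z = j by lia.
have -> : (j * 2 %% 2)%Z = 0 by lia.
have -> : ((j * 2 + 1) %/ 2)%Z = j by lia.
have -> : ((j * 2 + 1) %% 2)%Z = 1 by lia.
by rewrite -surjective_pairing.
Qed.

Lemma codes_decode_seq be : good be -> codes (decode_seq be) = be.
Proof. by move=> gb; apply/funext => j; rewrite /codes block_decode_seq // decodeK. Qed.

(** Any range of blocks extends to the left until nothing is read below the known stack; each
    failure at the right end is cured by starting earlier. *)
Lemma slice_safe be : good be -> forall j l, exists l',
  safe p0 [::] (slice be (j - l'%:Z) (l' + l)).
Proof.
move=> gb j; elim=> [|l [l' sl']].
  by have [p [l' [s [sl' _]]]] := gb j; exists l'; rewrite addn0.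
have [step_ok|] := boolP (safe p0 [::] (slice be (j - l'%:Z) (l' + l.+1))).
  by exists l'.
rewrite addnS sliceS -cats1 safe_cat sl' /= andbT negbK => /andP[_ /nilP e0].
(* The stack has become empty although a top entry exists here, so the window showing that entry
   must start further left. *)
have [p [l2 [s [sl2 es]]]] := gb (j + l%:Z).
have ll2 : (l' + l < l2)%N.
  rewrite ltnNge; apply/negP => l2l.
  have := stacks_extend [::] l2l sl2; rewrite es.
  have -> : j + l%:Z - (l' + l)%N%:Z = j - l'%:Z by lia.
  by rewrite e0.
exists (l2 - l)%N; have -> : (l2 - l + l.+1 = l2.+1)%N by lia.
have -> : j - (l2 - l)%N%:Z = j + l%:Z - l2%:Z by lia.
by rewrite sliceS -cats1 safe_cat sl2 /= es andbF.
Qed.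

Lemma slice_decode_seq be a l : good be -> safe p0 [::] (slice be a l) ->
  slice (block_at (decode_seq be)) a l = decodes p0 [::] (slice be a l).
Proof.
move=> gb; elim: l => // l IH; rewrite !sliceS -!cats1 safe_cat => /andP[sl].
rewrite decodes_cat -IH //= andbT => e; congr (_ ++ [:: _]).
rewrite block_decode_seq //; have [tb|tb] := boolP (needs_top (be (a + l%:Z))); last first.
  exact: decode_known.
move: e; rewrite tb /=; case e : (stacks _ _ _) => [|p s] //= _; congr decode.
have tp : top be (a + l%:Z) p by exists l, s; rewrite addrK.
by apply: (top_unique _ tp); apply: xgetPex; exists p.
Qed.

(** Every factor lies in a range of blocks without underflow, whose decoding acts on the empty
    stack; so the factor acts on the stack reached before it. *)
Lemma markov_dyck_decode_seq be : good be -> markov_dyck G (decode_seq be).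
Proof.
move=> gb i n n0; set x := decode_seq be.
have w0 : (factor x i n : seq _) != [::] by rewrite -size_eq0 size_tuple -lt0n.
apply/(nonzero_wordP w0); rewrite slice_factor.
have [l' sl'] := slice_safe gb (i %/ 2)%Z n.+1.
have := run_decodes (hN := hN) sl'; rewrite -slice_decode_seq // flat_slice -/x.
set a := ((i %/ 2)%Z - l'%:Z) * 2.
pose c := absz (i - a).
have ca : a + c%:Z = i by rewrite /c /a; lia.
have cn : (c + n <= (l' + n.+1).*2)%N by rewrite /c /a; lia.
rewrite -(subnK cn) addnC slice_add slice_add ca /gens !map_cat !run_cat.
case: run => //= st1; case E : run => [st2|] //= _.
by exists st1; rewrite E.
Qed.

Lemma decode_seq_codes x : markov_dyck G x -> at_root x 0 -> good (codes x) ->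
  decode_seq (codes x) = x.
Proof.
move=> mx r0 gx.
have eb j : block_at (decode_seq (codes x)) j = block_at x j.
  rewrite block_decode_seq //; have [p tp] := gx j.
  have -> : xget p0 (top (codes x) j) = p.
    by apply: (top_unique _ tp); apply: xgetPex; exists p.
  case: tp => l [s [sl es]].
  have [s0] := blocks_decode mx r0 (j - l%:Z) l.+1.
  rewrite !sliceS -!cats1 decodes_cat => /eqP; rewrite eqseq_cat ?size_decodes ?size_slice //.
  have -> : j - l%:Z + l%:Z = j by lia.
  case/andP=> _; rewrite /= eqseq_cons andbT => /eqP ->.
  by rewrite -[s0]cat0s -stacks_frame // es.
apply/funext => i; pose j := (i %/ 2)%Z.
have /orP[/eqP ij|/eqP ij] : (i == j * 2) || (i == j * 2 + 1) by rewrite /j; lia.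
  by rewrite ij; have := congr1 fst (eb j).
by rewrite ij; have := congr1 snd (eb j).
Qed.

Lemma top_shift be j p : top (seq_shift be) j p <-> top be (j + 1) p.
Proof.
have e l : slice (seq_shift be) (j - l%:Z) l = slice be (j + 1 - l%:Z) l.
  by apply: eq_map => k; rewrite /seq_shift; congr (be _); lia.
by split=> -[l [s h]]; exists l, s; move: h; rewrite e.
Qed.

Lemma good_shift be : good (seq_shift be) <-> good be.
Proof.
split=> gb j; last by have [p tp] := gb (j + 1); exists p; apply/top_shift.
by have [p /top_shift tp] := gb (j - 1); exists p; rewrite subrK in tp.
Qed.

Lemma decode_seq_shift be :
  decode_seq (seq_shift be) = shift (shift (decode_seq be)).
Proof.
apply/funext => i; rewrite /shift /decode_seq.
have [gb|gb] := pselect (good be); last first.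
  by rewrite !asboolF // => /good_shift.
rewrite !asboolT //; last exact/good_shift.
have -> : ((i + 1 + 1) %/ 2)%Z = (i %/ 2)%Z + 1 by lia.
have -> : ((i + 1 + 1) %% 2)%Z = (i %% 2)%Z by lia.
have -> : top (seq_shift be) (i %/ 2)%Z = top be ((i %/ 2)%Z + 1).
  by apply/funext => p; apply/propext; exact: top_shift.
by [].
Qed.

Definition letter_step (a : letter G) : int := if a is inl _ then 1 else -1.

Definition heights (h : nat) (bs : seq pair_code) : nat :=
  foldl (fun h b => height b h) h bs.

Lemma underflows_sum h bs : underflows h bs = (\sum_(j < size bs)
  (needs_top (nth point bs j) && (heights h (take j bs) == 0)))%N.
Proof.
by elim: bs h => [|b bs IH] h /=; rewrite ?big_ord0 // big_ord_recl IH.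
Qed.

(** [heights] is the height walk reflected at 0, so it dominates the sum of steps from every earlier
    starting time, including those inside a block. Each stack entry stands for two open edges, hence
    the doubling. *)
Lemma sum_step_height x : markov_dyck G x -> at_root x 0 -> forall (j a : nat),
  (a <= j.*2)%N ->
  \sum_(a <= k < j.*2) letter_step (x k%:Z) <= (heights 0 (slice (codes x) 0 j)).*2%:Z.
Proof.
move=> mx r0; elim=> [|j IH] a aj.
  by move: aj; rewrite leqn0 => /eqP ->; rewrite big_geq.
rewrite sliceS /heights foldl_rcons -/(heights _ _) add0r.
have [p] := block_decode mx r0 j%:Z; rewrite /block_at.
have -> : j%:Z * 2 = j.*2%:Z by lia.
have -> : j.*2%:Z + 1 = j.*2.+1%:Z by lia.
move: (codes x j%:Z) => b E; have /= xj := congr1 fst E; have /= xj1 := congr1 snd E.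
have sE : letter_step (x j.*2%:Z) = letter_step (decode p b).1 by rewrite -xj.
have sE1 : letter_step (x j.*2.+1%:Z) = letter_step (decode p b).2 by rewrite -xj1.
move: aj; rewrite doubleS leq_eqVlt => /predU1P[->|]; first by rewrite big_geq.
rewrite ltnS leq_eqVlt => /predU1P[->|].
  by rewrite big_nat1 sE1; case: b {E xj xj1 sE sE1} => [[n|] [m|]] //=; lia.
rewrite ltnS => aj; rewrite big_nat_recr ?big_nat_recr /= ?sE ?sE1; try lia.
have := IH a aj; set h := heights 0 _; set t := \sum_(a <= k < _) _.
by case: b {E xj xj1 sE sE1} => [[n|] [m|]] /=; lia.
Qed.

(** The letter at [i] closes an edge that was not opened in the [t] preceding letters: no sum of
    steps ending at [i] gets back to 0. *)
Definition unmatched_within (t : nat) (i : int) : set (borel_full_shift G) :=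
  [set x | forall r, (r <= t)%N -> \sum_(k < r.+1) letter_step (x (i - k%:Z)) < 0].

(** An underflow at height 0 closes an edge opened before time 0. *)
Lemma underflow_unmatched x j : markov_dyck G x -> at_root x 0 ->
  needs_top (codes x j%:Z) && (heights 0 (slice (codes x) 0 j) == 0%N) ->
  unmatched_within j.*2 j.*2%:Z x.
Proof.
move=> mx r0 /andP[tb /eqP h0] r rj.
have sE : letter_step (x j.*2%:Z) = -1.
  have [p] := block_decode mx r0 j%:Z; rewrite /block_at.
  rewrite (_ : j%:Z * 2 = j.*2%:Z); last by lia.
  move: (codes x j%:Z) tb => b tb E; have /= -> := congr1 fst E.
  by case: b tb {E} => [[n|] [m|]].
have := sum_step_height mx r0 (leq_subr r j.*2); rewrite h0 => le0.
suff -> : \sum_(k < r.+1) letter_step (x (j.*2%:Z - k%:Z)) =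
    letter_step (x j.*2%:Z) + \sum_(j.*2 - r <= k < j.*2) letter_step (x k%:Z).
  by rewrite sE; lia.
rewrite big_ord_recl subr0; congr (_ + _).
have e : \sum_(j.*2 - r <= k < j.*2) letter_step (x k%:Z) =
    \sum_(i < r) letter_step (x (j.*2%:Z - i.+1%:Z)).
  rewrite -[in X in \sum_(X <= _ < _) _](add0n (j.*2 - r)%N) big_addn subKn //.
  rewrite big_nat_rev big_mkord; apply: eq_bigr => -[k kr] _ /=.
  by congr (letter_step (x _)); lia.
by rewrite e.
Qed.

End Coding.

(** * Uniform code sequences decode almost surely *)

Section GoodSequences.
Variables (N M : nat) (hN : (0 < N)%N) (hM : (0 < M)%N).
Local Notation G := (Ghat M hN).
Local Notation pair_code := (pair_code N M).
Local Notation pair_edge := (pair_edge N M).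
Let p0 : pair_edge := (Ordinal hN, Ordinal hM).
Implicit Types (b : pair_code) (be : seq_space pair_code).

Definition gain b : int :=
  match b with (Some _, Some _) => 1 | (None, None) => -1 | _ => 0 end.

(** In the shortest window of positive gain, all nonempty prefixes have positive gain by minimality.
    Starting from the empty stack there is thus no underflow, and the size of the stack equals the
    gain. *)
Lemma top_of_gain be j l : 1 <= \sum_(k < l) gain (be (j - l%:Z + k%:Z)) ->
  exists p, top hN hM be j p.
Proof.
move=> gl; pose S (l : nat) := \sum_(k < l) gain (be (j - l%:Z + k%:Z)).
have [{gl}l gl lmin] := @ex_minnP (fun l => 1 <= S l) (ex_intro _ l gl).
pose Q (k : nat) := \sum_(i < k) gain (be (j - l%:Z + i%:Z)).
have QS k : (k <= l)%N -> S l = Q k + S (l - k)%N.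
  move=> kl; rewrite /S /Q -(big_mkord xpredT (fun i => gain (be (j - l%:Z + i%:Z)))).
  rewrite (big_cat_nat _ kl) //= big_mkord; congr (_ + _).
  rewrite -[in X in \sum_(X <= _ < _) _](add0n k) big_addn big_mkord.
  by apply: eq_bigr => i _; congr (gain (be _)); lia.
have Q1 k : (0 < k <= l)%N -> 1 <= Q k.
  case/andP=> k0 kl; have := QS k kl; have : S (l - k)%N < 1.
    by rewrite ltNge; apply/negP => /lmin; lia.
  by move: gl; lia.
have main k : (k <= l)%N -> safe p0 [::] (slice be (j - l%:Z) k) /\
    (size (stacks p0 [::] (slice be (j - l%:Z) k)))%:Z = Q k.
  elim: k => [_|k IH kl]; first by rewrite /Q big_ord0.
  have [sk ek] := IH (ltnW kl).
  rewrite sliceS -cats1 safe_cat stacks_cat sk /=; set s := stacks _ _ _ in ek *.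
  have := Q1 k.+1 kl; rewrite {1 2}/Q big_ord_recr /= -/(Q k) -ek.
  set c := be _; move: (c) => {}c; rewrite andbT.
  have k0 : nilp s -> Q k = 0 by rewrite -ek => /nilP ->.
  case: (posnP k) => [k00|kpos].
    have -> : s = [::] by rewrite /s k00 /slice.
    by case: c => [[n|] [m|]] /=; rewrite ?big_ord0; lia.
  have := Q1 k; rewrite kpos (ltnW kl) -ek => /(_ isT).
  by case: s {ek k0} => // p s _; case: c => [[n|] [m|]] /=; split=> //; lia.
have [sl el] := main l (leqnn l).
have : 1 <= Q l by have := QS l (leqnn l); rewrite subnn {2}/S big_ord0; move: gl; lia.
case E : (stacks p0 [::] (slice be (j - l%:Z) l)) el => [|p s] /= <- // _.
by exists p, l, s.
Qed.

Lemma measurable_top j p : measurable [set be | top hN hM be j p].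
Proof.
pose P l (w : l.-tuple pair_code) :=
  safe p0 [::] w && (ohead (stacks p0 [::] w) == Some p).
rewrite (_ : mkset _ = \bigcup_l
    [set be | P l (window (@seq_coord pair_code) (j - l%:Z) l be)]).
  by apply: bigcup_measurable => l _; exact: (discrete_pred (P l) (@discrete_seq_window _ _ _)).
have wE l be : tval (window (@seq_coord pair_code) (j - l%:Z) l be) =
    slice be (j - l%:Z) l by exact: slice_factor.
apply/seteqP; split=> be /=.
  by case=> l [s [sl es]]; exists l => //=; rewrite /P wE sl es eqxx.
case=> l _ /=; rewrite /P wE => /andP[sl].
by case E : (stacks _ _ _) => [|p' s] //= /eqP[<-]; exists l, s.
Qed.

Lemma measurable_good : measurable [set be | good hN hM be].
Proof.
rewrite (_ : mkset _ = \bigcap_j \bigcup_p [set be | top hN hM be j p]).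
  apply: measurable_bigcap_count => j; apply: measurable_bigcup_count => p.
  exact: measurable_top.
apply/seteqP; split=> be /= h j; first by move=> _; have [p] := h j; exists p.
by have [p _] := h j I; exists p.
Qed.

Lemma discrete_decode_seq i : discrete (@coord G i \o decode_seq hN hM).
Proof.
move=> a; pose j := (i %/ 2)%Z.
pose out (p : pair_edge) b := let ab := decode (hN := hN) p b in
  if (i %% 2)%Z == 0 then ab.1 else ab.2.
rewrite (_ : _ @^-1` _ =
  ([set be | good hN hM be] `&` \bigcup_p ([set be | top hN hM be j p] `&`
     [set be | (fun b => out p b == a) (seq_coord j be)])) `|`
  (~` [set be | good hN hM be] `&` [set be | @root_letter N M hN == a])).
  have mg := measurable_good; have mgC := measurableC mg.
  apply: measurableU; apply: measurableI => //.
    apply: measurable_bigcup_count => p; apply: measurableI; first exact: measurable_top.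
    by apply: (discrete_pred (fun b => out p b == a)); exact: discrete_seq_coord.
  exact: (discrete_pred (fun _ => @root_letter N M hN == a) (@discrete_seq_coord _ 0)).
apply/seteqP; split=> be /=.
  rewrite /coord /decode_seq; case: asboolP => gb.
    move=> oa; left; split=> //; have [p tp] := gb j; exists p => //; split=> //=.
    rewrite -oa /out; have -> // : xget p0 (top hN hM be (i %/ 2)%Z) = p.
    by apply: (top_unique _ tp); apply: xgetPex; exists p.
  by move=> /eqP; right.
rewrite /coord /decode_seq; case=> [[gb [p _ [tp /eqP oa]]]|[gb /eqP ra]]; last first.
  by rewrite asboolF.
rewrite asboolT // -oa /out; have -> // : xget p0 (top hN hM be (i %/ 2)%Z) = p.
by apply: (top_unique _ tp); apply: xgetPex; exists p.
Qed.

Context (R : realType) (nu : probability (seq_space pair_code) R).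
Hypothesis hNM : (1 < N * M)%N.
Hypothesis uniform_windows : forall i n w,
  pmf nu (window (@seq_coord pair_code) i n) w = #|{: pair_code}|%:R^-1 ^+ n.

Lemma card_pair_code : #|{: pair_code}| = ((N + 1) * (M + 1))%N.
Proof. by rewrite card_prod !card_option !card_ord !addn1. Qed.

(** Chernoff bound: without a top entry every window before [j] has gain at most 0, while the mean
    [rho] of [u ^ gain] is less than 1. *)
Lemma pr_no_top j : pr nu (~` \bigcup_p [set be | top hN hM be j p]) = 0.
Proof.
(* [q * u + u^-1] equals [q + 1] at [u = 1] and at [u = 1 / q], and is smaller in between; [u] is
   the harmonic mean of these two values. *)
pose q : R := (N * M)%:R; pose u : R := 2 / (q + 1).
have q2 : 2 <= q by rewrite ler_nat.
have u0 : 0 < u by rewrite divr_gt0 //; lra.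
have uq : u * (q + 1) = 2 by rewrite /u divfK // gt_eqF //; lra.
have u1 : u < 1 by rewrite ltr_pdivrMr ?mul1r; lra.
pose wt b : R := u ^ gain b.
pose B : R := #|{: pair_code}|%:R.
have BE : B = q + N%:R + M%:R + 1.
  by rewrite /B card_pair_code /q !natrM !natrD; ring.
have B0 : 0 < B by rewrite BE; have : 0 <= N%:R :> R; have : 0 <= M%:R :> R => //; lra.
pose rho := (\sum_b wt b) / B.
have wtE : \sum_b wt b = q * u + N%:R + M%:R + u^-1.
  rewrite (sum_pair_code wt) /wt /= !expr0z !expr1z.
  rewrite [X in _ + X = _](eq_bigr (fun=> u *+ M)); last first.
    by move=> n _; rewrite sumr_const card_ord.
  rewrite !sumr_const !card_ord -mulrnA -[u *+ _]mulr_natl /q mulnC.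
  by rewrite -exprz_inv; ring.
have rho1 : 0 <= rho < 1.
  have wt0 b : 0 <= wt b by exact/ltW/exprz_gt0.
  rewrite /rho divr_ge0 ?sumr_ge0 ?(ltW B0) //= ltr_pdivrMr // mul1r wtE BE.
  suff : q * u + u^-1 < q + 1 by lra.
  rewrite -(ltr_pM2r u0) mulrDl mulVf ?gt_eqF //.
  have -> : (q + 1) * u = 2 by rewrite mulrC.
  have -> : q * u * u + 1 = u * (u * (q + 1)) - u * u + 1 by ring.
  rewrite uq; have : 0 < (1 - u) * (1 - u) by rewrite mulr_gt0 // subr_gt0.
  lra.
have bound l : pr nu (~` \bigcup_p [set be | top hN hM be j p]) <= rho ^+ l.
  pose W := window (@seq_coord pair_code) (j - l%:Z) l.
  have mW : discrete W by exact: discrete_seq_window.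
  pose S (w : l.-tuple pair_code) := \sum_(k < l) gain (tnth w k).
  apply: (@le_trans _ _ (pr nu [set be | S (W be) <= 0])).
    apply: le_pr.
    - by apply: measurableC; apply: measurable_bigcup_count => p; exact: measurable_top.
    - exact: (discrete_pred (fun w => S w <= 0) mW).
    move=> be /= nt; rewrite leNgt; apply/negP => S0; apply: nt.
    suff /top_of_gain[p tp] : 1 <= \sum_(k < l) gain (be (j - l%:Z + k%:Z)) by exists p.
    rewrite -gtz0_ge1 (_ : \sum_(k < l) _ = S (W be)) //.
    by apply: eq_bigr => k _; rewrite tnth_mktuple.
  rewrite (pr_pred nu (fun w => S w <= 0) mW).
  apply: (@le_trans _ _ (\sum_w (\prod_(k < l) wt (tnth w k)) / B ^+ l)).
    rewrite big_mkcond /=; apply: ler_sum => w _.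
    have P0 : 0 < \prod_(k < l) wt (tnth w k).
      by apply: prodr_gt0 => k _; exact: exprz_gt0.
    rewrite uniform_windows exprVn; case: ifP => Sw; last first.
      by rewrite ltW // divr_gt0 // exprn_gt0.
    rewrite ler_peMl ?invr_ge0 ?exprn_ge0 ?(ltW B0) //.
    have -> : \prod_(k < l) wt (tnth w k) = u ^ S w.
      rewrite /S; elim/big_rec2 : _ => [|k z x _ ->]; first by rewrite expr0z.
      by rewrite expfzDr // gt_eqF.
    have [n ->] : exists n : nat, S w = - n%:Z by exists (absz (S w)); move: Sw; lia.
    by rewrite -invr_expz invf_ge1 ?exprn_gt0 //; apply: exprn_ile1 => //; exact: ltW.
  rewrite -mulr_suml (sum_tuple_prod (fun _ : 'I_l => wt)) prodr_const card_ord.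
  by rewrite /rho expr_div_n.
apply/eqP; rewrite eq_le pr_ge0 andbT.
have : (fun l => rho ^+ l) @ \oo --> (0 : R).
  by apply: cvg_expr; case/andP: rho1 => r0 r1; rewrite ger0_norm.
move=> h; apply: ler_cvg_to (cvg_cst _) h _.
by near=> l; exact: bound.
Unshelve. all: by end_near.
Qed.

Lemma pr_good : pr nu [set be | good hN hM be] = 1.
Proof.
rewrite (_ : mkset _ = \bigcap_j \bigcup_p [set be | top hN hM be j p]); last first.
  apply/seteqP; split=> be /= h j; first by move=> _; have [p] := h j; exists p.
  by have [p _] := h j I; exists p.
have mt j : measurable (\bigcup_p [set be | top hN hM be j p]).
  by apply: measurable_bigcup_count => p; exact: measurable_top.
apply: pr_bigcap1 => // j; have := pr_no_top j; rewrite prC //; lra.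
Qed.

End GoodSequences.

Section BorelShiftFacts.
Variable G : digraph.
Local Notation T := (borel_full_shift G).

Lemma iter_shift n (x : T) i : iter n (@shift G) x i = x (i + n%:Z).
Proof.
elim: n i => [|n IH] i; first by rewrite addr0.
by rewrite iterS {1}/shift IH; congr (x _); lia.
Qed.

Lemma measurable_shift_preimage (E : set T) : measurable E -> measurable (@shift G @^-1` E).
Proof. by apply: (measurable_shift (@discrete_coord G) (@borel_generate G)). Qed.

Lemma word_shift n (x : T) : word (@shift G) (coord 0) n x = window (@coord G) 0 n x.
Proof.
by apply: eq_from_tnth => i; rewrite !tnth_mktuple /coord iter_shift.
Qed.

Lemma discrete_coord_window i n : discrete (window (@coord G) i n).
Proof. exact: (discrete_window (@discrete_coord G)). Qed.

Lemma measurable_markov_dyck : measurable (markov_dyck G : set T).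
Proof.
rewrite (_ : markov_dyck G = \bigcap_(i : int) \bigcap_(n : nat)
    [set x | (fun w : n.-tuple (letter G) => `[< (0 < n)%N -> nonzero_word w >])
      (window (@coord G) i n x)]).
  apply: measurable_bigcap_count => i; apply: measurable_bigcap_count => n.
  exact: (discrete_pred (fun w : n.-tuple (letter G) => `[< (0 < n)%N -> nonzero_word w >])
    (@discrete_coord_window i n)).
apply/seteqP; split=> x /= mx i => [_ n _ /=|n n0].
  by apply/asboolP; exact: mx.
by have /asboolP := mx i I n I; exact.
Qed.

Lemma markov_dyck_shift (x : T) : markov_dyck G x -> markov_dyck G (shift x).
Proof.
move=> mx i n n0; have := mx (i + 1) n n0; rewrite !slice_factor.
have -> // : slice (shift x) i n = slice x (i + 1) n.
by apply: eq_map => k; rewrite /shift; congr (x _); lia.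
Qed.

End BorelShiftFacts.

(** * The measure decoded from uniform codes *)

Section RootMeasure.
Variables (N M : nat) (hN : (0 < N)%N) (hM : (0 < M)%N).
Local Notation G := (Ghat M hN).
Local Notation pair_code := (pair_code N M).
Local Notation T := (borel_full_shift G).
Local Notation D := (decode_seq hN hM).
Context (R : realType) (nu : probability (seq_space pair_code) R).
Hypothesis hNM : (1 < N * M)%N.
Hypothesis uniform_windows : forall i n w,
  pmf nu (window (@seq_coord pair_code) i n) w = #|{: pair_code}|%:R^-1 ^+ n.

Lemma measurable_decode_seq E : measurable E -> measurable (D @^-1` E).
Proof.
apply: (measurable_coord_preimage (@discrete_coord G) (@borel_generate G)).
exact: discrete_decode_seq.
Qed.

Lemma exists_root_measure : exists mu : probability T R, forall E, measurable E ->
  pr mu E = (pr nu (D @^-1` E) + pr nu (D @^-1` (@shift G @^-1` E))) / 2.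
Proof.
have mD : measurable_fun setT D.
  by move=> _ E mE; rewrite setTI; exact: measurable_decode_seq.
have mSD : measurable_fun setT (@shift G \o D).
  move=> _ E mE; rewrite setTI comp_preimage; apply: measurable_decode_seq.
  exact: measurable_shift_preimage.
have [m0 m0E] := exists_pushforward nu mD.
have [m1 m1E] := exists_pushforward nu mSD.
have [mu muE] := exists_midpoint m0 m1; exists mu => E mE.
by rewrite muE // /pr m0E m1E.
Qed.

Context (mu : probability T R).
Hypothesis muE : forall E, measurable E ->
  pr mu E = (pr nu (D @^-1` E) + pr nu (D @^-1` (@shift G @^-1` E))) / 2.

Let mgood := measurable_good hN hM.
Let pgood : pr nu [set be | good hN hM be] = 1.
Proof. exact: pr_good. Qed.

Lemma root_measure_markov_dyck : pr mu (markov_dyck G) = 1.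
Proof.
have mMD := @measurable_markov_dyck G.
have full E : measurable E -> (forall be, good hN hM be -> E be) -> pr nu E = 1.
  move=> mE gE; rewrite -(prT nu); apply: (eq_pr_ae mE _ mgood pgood) => // be gb.
  by split=> // _; exact: gE.
rewrite muE // (full (D @^-1` _)).
- rewrite full; first by lra.
    by apply: measurable_decode_seq; exact: measurable_shift_preimage.
  by move=> be gb; apply: markov_dyck_shift; exact: markov_dyck_decode_seq.
- exact: measurable_decode_seq.
- by move=> be gb; exact: markov_dyck_decode_seq.
Qed.

Lemma root_measure_invariant : invariant_measure (@shift G) mu.
Proof.
move=> E mE; have mSE := measurable_shift_preimage mE.
rewrite !prE //; congr EFin; rewrite !muE // addrC; congr ((_ + _) / 2).
rewrite /pr -(uniform_invariant uniform_windows (measurable_decode_seq mE)).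
by congr (fine (nu _)); apply/seteqP; split=> be /=; rewrite decode_seq_shift.
Qed.

(** An invariant set pulls back under [D] to a set invariant under the shift of the codes, and both
    halves of [mu] give it the same mass. *)
Lemma root_measure_ergodic : ergodic (@shift G) mu.
Proof.
move=> E mE SE; have mDE := measurable_decode_seq mE.
have : pr mu E = pr nu (D @^-1` E) by rewrite muE // SE; lra.
rewrite !prE // => ->; rewrite -prE //.
apply: (uniform_ergodic uniform_windows mDE).
by rewrite -[in RHS]SE -[in RHS]SE; apply/seteqP; split=> be /=; rewrite decode_seq_shift.
Qed.

(** A word of [2 * l + 2] letters contains [l] complete blocks in either phase, hence determines [l]
    codes: its probability is at most the inverse of the number of codes to the power [l]. *)
Lemma root_measure_entropy_rate :
  ln #|{: pair_code}|%:R / 2 <= entropy_rate mu (@shift G) (@coord G 0).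
Proof.
have B0 : 0 < #|{: pair_code}|%:R :> R.
  by rewrite ltr0n card_pair_code // muln_gt0 !addn1.
have mW n := @discrete_word _ _ _ (@measurable_shift_preimage G) n _ _ (@discrete_coord G 0).
have bound l w : pmf mu (word (@shift G) (@coord G 0) l.+1.*2) w <= #|{: pair_code}|%:R^-1 ^+ l.
  (* [s] is the phase. Block 0 may be cut at the start of the window, so blocks 1 to [l] are
     read. *)
  pose v (s : nat) : l.-tuple pair_code := [tuple encode
    (nth point w (k.+1.*2 - s), nth point w (k.+1.*2.+1 - s)) | k < l].
  have half (s : nat) (E : set (seq_space pair_code)) : measurable E -> (s <= 1)%N ->
      (forall be, good hN hM be -> E be ->
        window (@coord G) s%:Z l.+1.*2 (D be) = w) ->
      pr nu E <= #|{: pair_code}|%:R^-1 ^+ l.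
    move=> mE s1 Ew; rewrite -(uniform_windows 1 (v s)).
    rewrite -(pr_setI1 mE mgood pgood); apply: le_pr.
    - exact: measurableI.
    - exact: discrete_seq_window.
    move=> be [Eb gb] /=; have {}Ew := Ew be gb Eb.
    apply: eq_from_tnth => k; rewrite !tnth_mktuple /seq_coord.
    rewrite -[in LHS](codes_decode_seq gb) /codes /block_at.
    have nthw (i : nat) : (i < l.+1.*2)%N -> nth point w i = D be (s%:Z + i%:Z).
      by move=> il; rewrite -Ew -[i]/(val (Ordinal il)) -tnth_nth tnth_mktuple.
    have kl := ltn_ord k.
    rewrite !nthw; try lia.
    by congr (encode (D be _, D be _)); lia.
  rewrite /pmf muE; last exact: (mW _ w).
  have -> : #|{: pair_code}|%:R^-1 ^+ l = (#|{: pair_code}|%:R^-1 ^+ l + #|{: pair_code}|%:R^-1 ^+ l) / 2 :> R.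
    by lra.
  rewrite ler_pM2r ?invr_gt0 //; apply: lerD.
    apply: (half 0%N) => //; first by apply: measurable_decode_seq; exact: (mW _ w).
    by move=> be _ /=; rewrite word_shift.
  apply: (half 1%N) => //.
    by apply: measurable_decode_seq; apply: measurable_shift_preimage; exact: (mW _ w).
  move=> be _ /= <-; rewrite word_shift; apply: eq_from_tnth => k; rewrite !tnth_mktuple.
  by rewrite /coord /shift; congr (D be _); lia.
have lower l : l%:R * ln #|{: pair_code}|%:R <=
    entropy mu (word (@shift G) (@coord G 0) l.+1.*2).
  apply: le_trans (entropy_ge (mW _) (bound l)).
  by rewrite exprVn lnV ?posrE ?exprn_gt0 // opprK lnXn // mulr_natl.
have c1 := entropy_rate_cvg (@measurable_shift_preimage G) root_measure_invariant
  (@discrete_coord G 0).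
have c2 : (fun l => entropy mu (word (@shift G) (@coord G 0) l.+1.*2) / l.+1.*2%:R) @ \oo
    --> entropy_rate mu (@shift G) (@coord G 0).
  apply: (cvg_comp (fun l => l.+1.*2) _ _ c1).
  move=> A [n _ nA]; exists n => // k /= nk; apply: nA => /=; lia.
have c3 : (fun l => ln #|{: pair_code}|%:R / 2 - (ln #|{: pair_code}|%:R / 2) / l.+1%:R) @ \oo
    --> ln #|{: pair_code}|%:R / 2 - (0 : R).
  apply: cvgB; first exact: cvg_cst.
  by have := cvg_div_natr (ln #|{: pair_code}|%:R / 2 : R); rewrite -cvg_shiftS.
rewrite -[leLHS]subr0; apply: (ler_cvg_to c3 c2); near=> l.
rewrite ler_pdivlMr ?ltr0n //; apply: le_trans (lower l).
have s0 : l.+1%:R != 0 :> R by rewrite pnatr_eq0.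
have -> : l%:R = l.+1%:R - 1 :> R by rewrite -natr1 addrK.
rewrite -muln2 natrM le_eqVlt; apply/orP; left; apply/eqP.
by field.
Unshelve. all: by end_near.
Qed.

Definition closing (a : letter G) : bool := if a is inr _ then true else false.

Lemma pr_code_pred (P : pred pair_code) :
  pr nu [set be | P (@seq_coord pair_code 0 be)] = \sum_(b | P b) #|{: pair_code}|%:R^-1.
Proof.
rewrite (pr_pred nu P (@discrete_seq_coord _ 0)); apply: eq_bigr => b _.
rewrite -[RHS]expr1 -(uniform_windows 0 [tuple b]); congr pr.
apply/seteqP; split=> be /=.
  by move=> <-; apply: eq_from_tnth => k; rewrite tnth_mktuple ord1 (tnth_nth point) /= addr0.
move=> /(congr1 (fun w => tnth w ord0)); rewrite tnth_mktuple addr0 => ->.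
by rewrite (tnth_nth point).
Qed.

Lemma root_measure_closing : pr mu [set x | closing (coord 0 x)] =
  ((N.+1)%:R^-1 + (M.+1)%:R^-1) / 2.
Proof.
have mC : measurable [set x : T | closing (coord 0 x)].
  exact: (discrete_pred closing (@discrete_coord G 0)).
have BE : #|{: pair_code}|%:R = (N.+1)%:R * (M.+1)%:R :> R.
  by rewrite card_pair_code -natrM !addn1.
have N0 : (N.+1)%:R != 0 :> R by rewrite pnatr_eq0.
have M0 : (M.+1)%:R != 0 :> R by rewrite pnatr_eq0.
rewrite muE //; congr ((_ + _) / 2).
  rewrite (@eq_pr_ae _ _ _ nu _ [set be | (fun b : pair_code => ~~ isSome b.1) (@seq_coord pair_code 0 be)]
    [set be | good hN hM be]) //.
  - rewrite (pr_code_pred (fun b : pair_code => ~~ isSome b.1)) big_mkcond.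
  rewrite (sum_pair_code (fun b => if ~~ isSome b.1 then _ else 0)) /=.
    rewrite sumr_const card_ord [X in _ + X + _]big1 // [X in _ + X]big1; last first.
      by move=> n _; rewrite big1.
    rewrite !addr0.
    by rewrite -mulrS -[LHS]mulr_natr BE invfM -mulrA mulVf // mulr1.
  - exact: measurable_decode_seq.
  - exact: (discrete_pred (fun b : pair_code => ~~ isSome b.1) (@discrete_seq_coord _ 0)).
  move=> be gb /=; rewrite /coord /seq_coord.
  have := block_decode_seq 0 gb; rewrite /block_at mul0r => /(congr1 fst) /= ->.
  by case: (be 0) => [[n|] [m|]].
rewrite (@eq_pr_ae _ _ _ nu _ [set be | (fun b : pair_code => ~~ isSome b.2) (@seq_coord pair_code 0 be)]
  [set be | good hN hM be]) //.
- rewrite (pr_code_pred (fun b : pair_code => ~~ isSome b.2)) big_mkcond.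
  rewrite (sum_pair_code (fun b => if ~~ isSome b.2 then _ else 0)) /=.
  rewrite [X in _ + X + _ + _]big1 // [X in _ + X]big1; last first.
    by move=> n _; rewrite big1.
  rewrite !addr0 sumr_const card_ord.
  by rewrite -mulrS -[LHS]mulr_natr BE invfM mulrAC mulVf // mul1r.
- by apply: measurable_decode_seq; exact: measurable_shift_preimage.
- exact: (discrete_pred (fun b : pair_code => ~~ isSome b.2) (@discrete_seq_coord _ 0)).
move=> be gb /=; rewrite /coord /seq_coord /shift.
have := block_decode_seq 0 gb; rewrite /block_at mul0r => /(congr1 snd) /= ->.
by case: (be 0) => [[n|] [m|]].
Qed.

End RootMeasure.

(** * Measures of maximal entropy *)

Section MatchedClosings.
Variables (N M : nat) (hN : (0 < N)%N) (hM : (0 < M)%N).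
Local Notation G := (Ghat M hN).
Local Notation pair_code := (pair_code N M).
Local Notation pair_edge := (pair_edge N M).
Local Notation T := (borel_full_shift G).
Local Notation D := (decode_seq hN hM).
Local Notation S := (@shift G).
Let p0 : pair_edge := (Ordinal hN, Ordinal hM).
Implicit Types x : T.

Lemma measurable_unmatched_within t i :
  measurable (unmatched_within (hN := hN) (M := M) t i : set T).
Proof.
pose V r x := [tuple coord (i - k%:Z) x | k < r.+1].
have mV r : discrete (V r) by apply: discrete_tuple => k; exact: discrete_coord.
pose P r (w : r.+1.-tuple (letter G)) :=
  (r <= t)%N ==> (\sum_(k < r.+1) letter_step (tnth w k) < 0).
rewrite (_ : unmatched_within t i = \bigcap_r [set x | P r (V r x)]).
  by apply: measurable_bigcap_count => r; exact: (discrete_pred (P r) (mV r)).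
have e x r : \sum_(k < r.+1) letter_step (tnth (V r x) k) =
    \sum_(k < r.+1) letter_step (x (i - k%:Z)).
  by apply: eq_bigr => k _; rewrite tnth_mktuple.
apply/seteqP; split=> x /= h r.
  by move=> _ /=; rewrite /P e; apply/implyP; exact: h.
by move=> rt; have := h r I; rewrite /= /P e rt.
Qed.

Lemma unmatched_within_shift t i n x :
  unmatched_within t i (iter n S x) <-> unmatched_within t (i + n%:Z) x.
Proof.
have e r : \sum_(k < r.+1) letter_step (iter n S x (i - k%:Z)) =
    \sum_(k < r.+1) letter_step (x (i + n%:Z - k%:Z)).
  by apply: eq_bigr => k _; rewrite iter_shift; congr (letter_step (x _)); lia.
by split=> h r rt; have := h r rt; rewrite e.
Qed.

Lemma unmatched_within_le t t' i : (t <= t')%N ->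
  unmatched_within t' i `<=` (unmatched_within t i : set T).
Proof. by move=> tt' x h r rt; apply: h; exact: leq_trans tt'. Qed.

(** Chooses the phase in which blocks start at V(0). *)
Definition to_root x : T := if at_root x 0 then x else S x.

Definition root_codes x : seq_space pair_code := codes (to_root x).

Definition root_code x : pair_code := root_codes x 0.

Local Notation S2 := (S \o S).

Lemma markov_dyck_to_root x : markov_dyck G x -> markov_dyck G (to_root x).
Proof. by move=> mx; rewrite /to_root; case: ifP => // _; exact: markov_dyck_shift. Qed.

Lemma at_root_to_root x : markov_dyck G x -> at_root (to_root x) 0.
Proof.
move=> mx; rewrite /to_root; case: ifPn => // r0.
by have := at_root_succ 0 mx; rewrite r0 add0r.
Qed.

Lemma root_codes_shift x : markov_dyck G x -> root_codes (S2 x) = seq_shift (root_codes x).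
Proof.
move=> mx; have e : at_root (S2 x) 0 = at_root x 0.
  rewrite -[RHS]negbK -(at_root_succ 0 mx) -(at_root_succ _ mx).
  by congr (letter_src (x _) == _); lia.
rewrite /root_codes /to_root e; case: ifP => _; apply/funext => j.
  by rewrite /seq_shift /codes /block_at /shift /=; congr (encode (x _, x _)); lia.
by rewrite /seq_shift /codes /block_at /shift /=; congr (encode (x _, x _)); lia.
Qed.

Lemma iter_root_codes n x : markov_dyck G x ->
  root_codes (iter n S2 x) = iter n (@seq_shift pair_code) (root_codes x).
Proof.
elim: n x => // n IH x mx; rewrite iterSr IH ?root_codes_shift -?iterSr //.
by do 2 apply: markov_dyck_shift.
Qed.

Lemma iter_seq_shift n (be : seq_space pair_code) i :
  iter n (@seq_shift pair_code) be i = be (i + n%:Z).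
Proof.
elim: n i => [|n IH] i; first by rewrite addr0.
by rewrite iterS {1}/seq_shift IH; congr (be _); lia.
Qed.

Lemma word_root_code n x : markov_dyck G x ->
  word S2 root_code n x = window (@seq_coord pair_code) 0 n (root_codes x).
Proof.
move=> mx; apply: eq_from_tnth => k; rewrite !tnth_mktuple /root_code iter_root_codes //.
by rewrite iter_seq_shift.
Qed.

Lemma discrete_coord3 i j k (C : finType)
    (f : letter G * (letter G * (letter G * letter G)) -> C) :
  discrete (fun x : T => f (x 0, (x i, (x j, x k)))).
Proof.
have dc := @discrete_coord G.
exact: (discrete_comp f (discrete_pair (dc 0)
  (discrete_pair (dc i) (discrete_pair (dc j) (dc k))))).
Qed.

Lemma discrete_root_codes j : discrete (@seq_coord pair_code j \o root_codes).
Proof.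
pose f (c : letter G * (letter G * (letter G * letter G))) :=
  if letter_src c.1 == None then encode (c.2.1, c.2.2.1) else encode c.2.2.
have := discrete_coord3 (j * 2) (j * 2 + 1) (j * 2 + 1 + 1) f.
congr discrete; apply/funext => x.
by rewrite /f /= /seq_coord /root_codes /to_root /at_root; case: ifP.
Qed.

Lemma measurable_to_root E : measurable E -> measurable (to_root @^-1` E).
Proof.
apply: (measurable_coord_preimage (@discrete_coord G) (@borel_generate G)) => i.
pose f (c : letter G * (letter G * (letter G * letter G))) :=
  if letter_src c.1 == None then c.2.1 else c.2.2.1.
have := discrete_coord3 i (i + 1) 0 f.
congr discrete; apply/funext => x.
by rewrite /f /= /coord /to_root /at_root; case: ifP.
Qed.

Lemma measurable_root_codes E : measurable E -> measurable (root_codes @^-1` E).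
Proof.
apply: (measurable_coord_preimage (@discrete_seq_coord pair_code)
  (@seq_space_generate pair_code)).
exact: discrete_root_codes.
Qed.

Context (R : realType) (mu : probability T R).
Hypotheses (muMD : pr mu (markov_dyck G) = 1) (invS : invariant_measure S mu)
  (matched : pr mu (\bigcap_t unmatched_within t 0) = 0)
  (rate_ge : ln #|{: pair_code}|%:R / 2 <= entropy_rate mu S (@coord G 0)).

Let mMD := @measurable_markov_dyck G.
Let mS := @measurable_shift_preimage G.
Let mS2 E : measurable E -> measurable (S2 @^-1` E).
Proof. by move=> mE; exact: mS (mS mE). Qed.
Let invS2 : invariant_measure S2 mu.
Proof. by move=> E mE; rewrite comp_preimage invS ?invS //; exact: mS. Qed.
Let mroot_code : discrete root_code.
Proof. exact: (discrete_root_codes 0). Qed.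

Let u t : R := pr mu (unmatched_within t 0).

(** The codes of [l] blocks leave open a possible first letter outside the blocks and one factor
    [N * M] per underflow. The expected number of underflows is bounded by probabilities of
    unmatched closing letters. *)
Lemma entropy_le_root_code l :
  entropy mu (word S (@coord G 0) l.*2) <= entropy mu (word S2 root_code l)
    + ln (1 + #|{: letter G}|)%:R + ln (N * M)%:R * \sum_(j < l) (2 * u j.*2).
Proof.
(* [o] is the letter before the first block when the word does not start at V(0). *)
pose mk (o : option (letter G)) (ws : seq (letter G * letter G)) : l.*2.-tuple (letter G) :=
  let s := if o is Some a then a :: flat ws else flat ws in [tuple nth point s i | i < l.*2].
pose F (bs : l.-tuple pair_code) :=
  [seq mk o ws | o <- enum {: option (letter G)}, ws <- words_of (hN := hN) p0 [::] bs].
have mX := @discrete_word _ _ _ mS l.*2 _ _ (@discrete_coord G 0).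
have mW := @discrete_word _ _ _ mS2 l _ _ mroot_code.
have mZ := discrete_pair mX mW.
have WE x : markov_dyck G x -> word S2 root_code l x = slice (root_codes x) 0 l :> seq _.
  by move=> mx; rewrite word_root_code //; exact: slice_factor.
have sizeF bs : size (F bs) = ((1 + #|{: letter G}|) * (N * M) ^ underflows 0 bs)%N.
  by rewrite size_allpairs size_words_of -cardE card_option add1n.
have E0 : (0 < #|{: letter G}|)%N by apply/card_gt0P; exists point.
have lnF bs : ln (size (F bs))%:R =
    ln (1 + #|{: letter G}|)%:R + ln (N * M)%:R * (underflows 0 bs)%:R :> R.
  rewrite sizeF natrM natrX lnM ?posrE ?ltr0n ?exprn_gt0 ?ltr0n ?muln_gt0 ?hN //.
  by rewrite lnXn ?ltr0n ?muln_gt0 ?hN // -[RHS]/(_ + _) mulr_natr.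
have := @entropy_fibre _ _ _ mu _ _ mZ _ _ fst snd F.
have mem_F c : 0 < pmf mu (fun x => (word S (@coord G 0) l.*2 x, word S2 root_code l x)) c ->
    c.1 \in F c.2.
  move=> c0; have [x [mx xc]] : exists x, markov_dyck G x /\
      (word S (@coord G 0) l.*2 x, word S2 root_code l x) = c.
    apply: contrapT => nx; move: c0; rewrite ltNge => /negP; apply.
    rewrite /pmf -(pr_setI1 (mZ c) mMD muMD) (_ : _ `&` _ = set0) ?pr0 //.
    by apply/seteqP; split=> // x [/= xc mx]; apply: nx; exists x.
  rewrite -xc /= /F.
  have [s] := blocks_decode hM (markov_dyck_to_root mx) (at_root_to_root mx) 0 l.
  rewrite -/(root_codes x) -(WE x mx) => bE.
  apply/allpairsP; exists (if at_root x 0 then None else Some (x 0),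
    decodes p0 s (word S2 root_code l x)).
  split; first by rewrite mem_enum.
    exact: (mem_words_of _ _ [::]).
  rewrite -bE [X in _ = X]/mk /= (flat_slice hM) (_ : (0%Z * 2)%R = 0%Z) //; apply: eq_from_tnth => k.
  rewrite word_shift !tnth_mktuple /coord /to_root.
  have nths (y : T) i : (i < l.*2)%N -> nth point (slice y 0 l.*2) i = y i%:Z.
    move=> il; rewrite -slice_factor -[i in LHS]/(val (Ordinal il)) -tnth_nth tnth_mktuple.
    by rewrite add0r.
  case: ifP => _; first by rewrite nths // add0r.
  case: k => -[|k] kl //=; rewrite nths; last lia.
  by rewrite /shift; congr (x _); lia.
move=> /(_ mem_F) /le_trans; apply; rewrite -addrA lerD2l.
rewrite (sum_pmf_comp mu mZ snd (fun bs => ln (size (F bs))%:R)).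
have mW' : discrete (snd \o (fun x => (word S (@coord G 0) l.*2 x, word S2 root_code l x))).
  exact: mW.
under eq_bigr do rewrite lnF mulrDr.
rewrite big_split /= -mulr_suml (sum_pmf mu mW') mul1r lerD2l.
under eq_bigr do rewrite mulrCA.
rewrite -mulr_sumr; apply: ler_wpM2l.
  by rewrite ln_ge0 // ler1n muln_gt0 hN.
pose cond (j : 'I_l) (bs : l.-tuple pair_code) :=
  needs_top (nth point bs j) && (heights 0 (take j bs) == 0%N).
rewrite (eq_bigr (fun bs => \sum_(j < l)
  pmf mu (word S2 root_code l) bs * (cond j bs)%:R)); last first.
  by move=> bs _; rewrite underflows_sum // size_tuple natr_sum mulr_sumr.
rewrite exchange_big /=; apply: ler_sum => j _.
have -> : \sum_bs pmf mu (word S2 root_code l) bs * (cond j bs)%:R =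
    pr mu [set x | cond j (word S2 root_code l x)].
  rewrite (pr_pred mu (cond j) mW) [RHS]big_mkcond; apply: eq_bigr => bs _.
  by case: cond; rewrite ?mulr1 ?mulr0.
have mc : measurable [set x | cond j (word S2 root_code l x)].
  exact: (discrete_pred (cond j) mW).
have mU t i : measurable (unmatched_within t i : set T) by exact: measurable_unmatched_within.
pose U : set T := unmatched_within j.*2 j.*2%:Z.
have uE : pr mu U = u j.*2.
  rewrite /u -[RHS](pr_iter mS invS j.*2 (mU _ _)); congr pr; apply/seteqP; split=> x.
    by move=> h; apply: (proj2 (unmatched_within_shift _ _ _ _)); rewrite add0r.
  by move=> h; have := proj1 (unmatched_within_shift _ _ _ _) h; rewrite add0r.
(* The factor 2 comes from the phase: the unmatched letter occurs in [x] or in [S x]. *)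
rewrite -(pr_setI1 mc mMD muMD); apply: (@le_trans _ _ (pr mu (U `|` S @^-1` U))); last first.
  apply: (le_trans (le_prU mu (mU _ _) (mS (mU _ _)))).
  have SU : pr mu (S @^-1` U) = u j.*2 by rewrite -uE /pr invS //; exact: mU.
  by rewrite [X in X + _]uE SU mulr_natl mulr2n.
apply: le_pr.
- exact: measurableI.
- by apply: measurableU; [exact: mU|exact: mS (mU _ _)].
move=> x [/= cx mx]; suff : unmatched_within j.*2 j.*2%:Z (to_root x).
  by rewrite /to_root; case: ifP => _; [left|right].
apply: (underflow_unmatched hM (markov_dyck_to_root mx) (at_root_to_root mx)).
move: cx; rewrite /cond (WE x mx) -/(root_codes x).
by rewrite take_slice ?nth_slice ?add0r // ltnW.
Qed.

Lemma cvg_unmatched : u @ \oo --> (0 : R).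
Proof.
rewrite -matched; apply: pr_cvgI => [t|t t' tt']; first exact: measurable_unmatched_within.
exact: unmatched_within_le.
Qed.

(** Divided by [l], the cost of the underflows is a Cesaro mean of a sequence tending to 0. *)
Lemma root_code_rate : ln #|{: pair_code}|%:R <= entropy_rate mu S2 root_code.
Proof.
have q1 : 0 <= ln (N * M)%:R :> R by rewrite ln_ge0 // ler1n muln_gt0 hN.
pose C : R := ln (1 + #|{: letter G}|)%:R.
pose v j := 2 * u j.*2.
have cv : v @ \oo --> (0 : R).
  rewrite -(mulr0 (2 : R)); apply: cvgM; first exact: cvg_cst.
  apply: (cvg_comp (fun j => j.*2) _ _ cvg_unmatched).
  by move=> A [n _ nA]; exists n => // k /= nk; apply: nA => /=; lia.
pose f l := entropy mu (word S2 root_code l.+1) / l.+1%:R + C / l.+1%:R +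
  ln (N * M)%:R * arithmetic_mean v l.
have cf : f @ \oo --> entropy_rate mu S2 root_code + 0 + ln (N * M)%:R * (0 : R).
  apply: cvgD.
    apply: cvgD.
      by have := entropy_rate_cvg mS2 invS2 mroot_code; rewrite -cvg_shiftS.
    by have := cvg_div_natr C; rewrite -cvg_shiftS.
  by apply: cvgM; [exact: cvg_cst|exact: cesaro].
rewrite -[leRHS]addr0 -[leRHS]addr0 -[X in _ + X](mulr0 (ln (N * M)%:R : R)).
apply: (ler_cvg_to (cvg_cst _) cf); near=> l.
have l0 : 0 < l.+1%:R :> R by [].
have h1 := entropy_rate_le mS invS (@discrete_coord G 0) (isT : 0 < l.+1.*2)%N.
have h2 := entropy_le_root_code l.+1.
have h3 : entropy_rate mu S (@coord G 0) * l.+1.*2%:R <= entropy mu (word S (@coord G 0) l.+1.*2).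
  by rewrite -ler_pdivlMr.
have h4 : ln #|{: pair_code}|%:R * l.+1%:R <= entropy_rate mu S (@coord G 0) * l.+1.*2%:R.
  by have := ler_wpM2r (ltW l0) rate_ge; rewrite -muln2 natrM; lra.
have -> : f l = (entropy mu (word S2 root_code l.+1) + C +
    ln (N * M)%:R * \sum_(j < l.+1) v j) / l.+1%:R.
  rewrite /f /arithmetic_mean /= /series /= big_mkord.
  by rewrite !mulrDl -!mulrA [l.+1%:R^-1 * _]mulrC.
by rewrite ler_pdivlMr //; apply: (le_trans h4); apply: (le_trans h3).
Unshelve. all: by end_near.
Qed.

(** The rate is the infimum of the entropies per code, so words of every length attain the maximal
    entropy. *)
Lemma root_code_uniform n w :
  pmf mu (word S2 root_code n) w = #|{: pair_code}|%:R^-1 ^+ n.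
Proof.
have mW := @discrete_word _ _ _ mS2 n _ _ mroot_code.
have B0 : 0 < #|{: pair_code}|%:R :> R by rewrite ltr0n card_pair_code // muln_gt0 !addn1.
have [n0|n0] := posnP n.
  rewrite (entropy_uniform mW) ?card_tuple ?natrX ?exprVn // n0 expr0 ln1.
  exact: entropy_ge0 (@discrete_word _ _ _ mS2 0 _ _ mroot_code).
rewrite (entropy_uniform mW) ?card_tuple ?natrX ?exprVn // lnXn // -[leLHS]mulr_natr.
rewrite -ler_pdivlMr ?ltr0n //; apply: (le_trans root_code_rate).
exact: entropy_rate_le.
Qed.

Context (nu : probability (seq_space pair_code) R).
Hypothesis hNM : (1 < N * M)%N.
Hypothesis uniform_windows : forall i n w,
  pmf nu (window (@seq_coord pair_code) i n) w = #|{: pair_code}|%:R^-1 ^+ n.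

Lemma root_codes_law E : measurable E -> pr mu (root_codes @^-1` E) = pr nu E.
Proof.
have mrc : measurable_fun setT root_codes.
  by move=> _ F mF; rewrite setTI; exact: measurable_root_codes.
have [nu' nuE] := exists_pushforward mu mrc.
move=> mE; rewrite /pr -nuE -!/(pr _ _).
apply: (pr_unique (@discrete_seq_coord pair_code) (@seq_space_generate pair_code)) mE.
move=> t C cC; rewrite (cylinderE cC); move: (@base _ _ _ _ t C) => P.
have mw i n := @discrete_seq_window pair_code i n.
rewrite (pr_pred nu' P (mw _ _)) (pr_pred nu P (mw _ _)); apply: eq_bigr => w _.
rewrite uniform_windows -(root_code_uniform w) /pmf /pr nuE -!/(pr _ _).
have mX : measurable (root_codes @^-1` (window (@seq_coord pair_code) (- t%:Z) (t + t) @^-1` [set w])).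
  by apply: measurable_root_codes; exact: mw.
(* Invariance under the double shift moves the window at [-t] to time 0, where it is a word of root
   codes. *)
rewrite -(pr_iter mS2 invS2 t mX); apply: (eq_pr_ae _ _ mMD muMD).
- exact: measurable_iter mS2 _ _ mX.
- exact: (@discrete_word _ _ _ mS2 (t + t) _ _ mroot_code w).
move=> x mx /=; rewrite iter_root_codes // seq_window_iter word_root_code //.
by rewrite addNr.
Qed.

(** Almost everywhere [to_root x] is the decoding of its codes, whose law is [nu]. It remains to
    undo [to_root]. *)
Theorem matched_closings_law E : measurable E ->
  pr mu E = (pr nu (D @^-1` E) + pr nu (D @^-1` (S @^-1` E))) / 2.
Proof.
pose root (a : letter G) := letter_src a == None.
pose Z : set T := [set x | root (@coord G 0 x)].
have mZ : measurable Z.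
  exact: (discrete_pred root (@discrete_coord G 0)).
have mgood := measurable_good hN hM.
have pgood : pr mu (root_codes @^-1` [set be | good hN hM be]) = 1.
  by rewrite root_codes_law //; exact: pr_good.
pose K : set T := markov_dyck G `&` root_codes @^-1` [set be | good hN hM be].
have MDg : measurable K.
  by apply: measurableI => //; exact: measurable_root_codes.
have pMDg : pr mu K = 1.
  by rewrite /K setIC pr_setI1 //; exact: measurable_root_codes.
have SZ x : markov_dyck G x -> Z (S x) <-> ~ Z x.
  move=> mx; rewrite /Z /root /= /coord /shift add0r.
  have := at_root_succ 0 mx; rewrite /at_root add0r => ->.
  by split => /negP.
(* The shift exchanges the points at V(0) with the others, so both phases contribute equally. *)
have half F : measurable F -> pr mu (to_root @^-1` F) = 2 * pr mu (Z `&` F).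
  move=> mF; have mSF := mS mF; have mZC := measurableC mZ.
  have -> : pr mu (to_root @^-1` F) = pr mu ((Z `&` F) `|` (~` Z `&` S @^-1` F)).
    congr pr; apply/seteqP; split=> x /=; rewrite /to_root /at_root /Z /root /= /coord.
      by case: ifP => [r Fx|/negP r Fx]; [left|right].
    by case=> -[r Fx]; [rewrite r|move/negP/negbTE: r => ->].
  rewrite prU; [|exact: measurableI..|]; last first.
    by rewrite setIACA setICr set0I.
  have -> : pr mu (~` Z `&` S @^-1` F) = pr mu (Z `&` F); last by lra.
  have mZF : measurable (Z `&` F) by exact: measurableI.
  transitivity (pr mu (S @^-1` (Z `&` F))); last by rewrite /pr invS.
  apply: (eq_pr_ae _ _ mMD muMD); [exact: measurableI|exact: mS mZF|].
  by move=> x mx /=; split=> -[/(SZ x mx) r Fx].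
have rootE F : measurable F -> pr mu (to_root @^-1` F) = pr nu (D @^-1` F).
  move=> mF; have mDF := measurable_decode_seq hM mF.
  rewrite -root_codes_law //; apply: (eq_pr_ae _ _ MDg pMDg).
  - exact: measurable_to_root.
  - exact: measurable_root_codes.
  move=> x [mx gx] /=; rewrite decode_seq_codes //; first exact: markov_dyck_to_root.
  exact: at_root_to_root.
move=> mE; have mSE := mS mE.
rewrite -!rootE // !half //.
have -> : pr mu (Z `&` S @^-1` E) = pr mu (~` Z `&` E).
  have mZE : measurable (~` Z `&` E) by apply: measurableI => //; exact: measurableC.
  transitivity (pr mu (S @^-1` (~` Z `&` E))); last by rewrite /pr invS.
  apply: (eq_pr_ae _ _ mMD muMD); [exact: measurableI|exact: mS mZE|].
  move=> x mx /=; split=> -[r Ex]; split=> //.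
    by move/(SZ x mx).
  by apply: contrapT => nZ; apply: r; apply/(SZ x mx).
have mZE : measurable (Z `&` E) by exact: measurableI.
have mZE' : measurable (~` Z `&` E) by apply: measurableI => //; exact: measurableC.
have := prU mu mZE mZE'; rewrite setIACA setICr set0I => /(_ erefl).
rewrite -setIUl setUv setTI; lra.
Qed.

End MatchedClosings.

(** * Equivariant events under an ergodic measure *)

Section ErgodicDichotomy.
Context d (T : measurableType d) (R : realType) (mu : probability T R) (S : T -> T).
Hypothesis invS : invariant_measure S mu.

Lemma pr_equivariant (L : int -> set T) : (forall i, measurable (L i)) ->
  (forall i x, L i (S x) <-> L (i + 1) x) -> forall i, pr mu (L i) = pr mu (L 0).
Proof.
move=> mL LS.
have step i (n : nat) : pr mu (L (i + n%:Z)) = pr mu (L i).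
  elim: n => [|n <-]; first by rewrite addr0.
  rewrite -[RHS](_ : pr mu (S @^-1` L (i + n%:Z)) = _); last by rewrite /pr invS.
  congr pr; apply/seteqP; split=> x /=.
    by rewrite intS addrCA addrC => /LS.
  by rewrite intS addrCA [1 + _]addrC => /LS.
move=> i; case: (leP 0 i) => i0; first by rewrite -(step 0 `|i|%N); congr (pr mu (L _)); lia.
by rewrite -(step i `|i|%N); congr (pr mu (L _)); lia.
Qed.

(** All [L i] have the same probability [c], and disjointness gives [n * c <= 1] for every [n]. *)
Lemma pr_disjoint_equivariant (L : int -> set T) : (forall i, measurable (L i)) ->
  (forall i x, L i (S x) <-> L (i + 1) x) ->
  (forall i j x, L i x -> L j x -> i = j) -> pr mu (\bigcup_i L i) = 0.
Proof.
move=> mL LS Ldisj; have Lc := pr_equivariant mL LS.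
pose c := pr mu (L 0); have c0 : 0 <= c by exact: pr_ge0.
pose U (n : nat) : set T := \bigcup_(i < n) L i%:Z.
have mU n : measurable (U n) by exact: bigcup_measurable.
have UE n : pr mu (U n) = n%:R * c.
  elim: n => [|n IH].
    by rewrite mul0r (_ : U 0%N = set0) ?pr0 // -subset0 => x [].
  have -> : U n.+1 = U n `|` L n%:Z.
    apply/seteqP; split=> x.
      move=> [i /=]; rewrite ltnS leq_eqVlt => /predU1P[->|ilt] Lx; [by right|left].
      by exists i.
    by case=> [[i /= ilt Lx]|Lx]; [exists i => //=; exact: ltnW|exists n => //=].
  rewrite prU // ?IH ?Lc -/c; first by rewrite -natr1 mulrDl mul1r.
  by rewrite -subset0 => x [[i /= ilt Li] Ln]; have [] := Ldisj _ _ _ Li Ln; lia.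
have cz : c = 0.
  apply/eqP; rewrite eq_le c0 andbT leNgt; apply/negP => cpos.
  have := pr_le1 mu (mU (Num.truncn c^-1).+1); rewrite UE leNgt => /negP; apply.
  by rewrite -ltr_pdivrMr // mul1r truncnS_gt.
by apply: pr_bigcup0 => // i; rewrite Lc.
Qed.

Hypothesis erg : ergodic S mu.

Lemma ergodic_bigcup (W : int -> set T) : (forall i, measurable (W i)) ->
  (forall i x, W i (S x) <-> W (i + 1) x) -> pr mu (W 0) != 0 ->
  pr mu (\bigcup_i W i) = 1.
Proof.
move=> mW WS W0; have mU : measurable (\bigcup_i W i) by exact: measurable_bigcup_count.
have := erg mU; case.
- apply/seteqP; split=> x [i _ Wi].
    by exists (i + 1) => //; apply/WS.
  by exists (i - 1) => //; apply/WS; rewrite subrK.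
- move=> z; case/eqP: W0; apply/eqP; rewrite eq_le pr_ge0 andbT.
  apply: (@le_trans _ _ (pr mu (\bigcup_i W i))); last by rewrite /pr z.
  by apply: le_pr => // x W0x; exists 0.
by move=> z; rewrite /pr z.
Qed.

(* Otherwise almost every point has indices in [U], all of them smaller than
   some index in [V]; the position of the last one is then stationary, which is
   impossible. *)
Theorem ergodic_dichotomy (U V : int -> set T) :
  (forall i, measurable (U i)) -> (forall i, measurable (V i)) ->
  (forall i x, U i (S x) <-> U (i + 1) x) -> (forall i x, V i (S x) <-> V (i + 1) x) ->
  (forall i j x, U i x -> V j x -> i < j) -> pr mu (U 0) = 0 \/ pr mu (V 0) = 0.
Proof.
move=> mU mV US VS UV; apply: contrapT => /not_orP[/eqP U0 /eqP V0].
have U1 := ergodic_bigcup mU US U0; have V1 := ergodic_bigcup mV VS V0.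
pose L i : set T := U i `&` \bigcap_(k : nat) ~` U (i + k.+1%:Z).
have mL i : measurable (L i).
  apply: measurableI => //; apply: measurable_bigcap_count => k; exact: measurableC.
have LS i x : L i (S x) <-> L (i + 1) x.
  split=> -[/US Ui h]; split=> // k _ /=.
    by move=> Ux; apply: (h k I); apply/US; rewrite addrAC.
  by move/US => Ux; apply: (h k I); rewrite addrAC.
have Llt i j x : L i x -> L j x -> i < j -> False.
  move=> [_ h] [Uj _] ij; apply: (h (`|j - i|.-1)%N I) => /=.
  by move: Uj; congr (U _ x); lia.
have Ldisj i j x : L i x -> L j x -> i = j.
  by move=> Li Lj; case: (ltgtP i j) => // ij; [case: (Llt i j x)|case: (Llt j i x)].
have := pr_disjoint_equivariant mL LS Ldisj => L0.
have : pr mu (\bigcup_i U i `&` \bigcup_j V j) = 1.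
  by rewrite pr_setI1 //; exact: measurable_bigcup_count.
apply/eqP; rewrite lt_eqF // (@le_lt_trans _ _ 0) // -L0.
have mUU : measurable (\bigcup_i U i) by exact: measurable_bigcup_count.
have mVV : measurable (\bigcup_i V i) by exact: measurable_bigcup_count.
apply: le_pr; [exact: measurableI|exact: measurable_bigcup_count|].
move=> x [[i _ Ui] [j _ Vj]].
pose P k := `[< U (i + k%:Z) x >].
have P0 : exists k, P k by exists 0%N; apply/asboolP; rewrite addr0.
have Pb k : P k -> (k <= `|j - i|)%N.
  by move=> /asboolP /UV /(_ Vj); have := UV _ _ _ Ui Vj; lia.
case: (ex_maxnP P0 Pb) => m /asboolP Um mmax; exists (i + m%:Z) => //; split=> //.
move=> k _ /= Uk; have /mmax : P (m + k.+1)%N by apply/asboolP; rewrite PoszD addrA.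
lia.
Qed.

End ErgodicDichotomy.

(** * Reversed measures *)

Section ReversedMeasure.
Variable G : digraph.
Local Notation T := (borel_full_shift G).
Local Notation S := (@shift G).

(** Reversal conjugates the shift to its inverse. *)
Lemma reversal_shift (x : T) : reversal (S (reversal (S x))) = x.
Proof. by apply/funext => i; rewrite /reversal /shift flipK; congr (x _); lia. Qed.

Lemma measurable_reversal (E : set T) : measurable E -> measurable (@reversal G @^-1` E).
Proof.
apply: (measurable_coord_preimage (@discrete_coord G) (@borel_generate G)) => i.
exact: (discrete_comp (@flip G) (@discrete_coord G (- i))).
Qed.

Lemma shift_reversal_preimage (E : set T) :
  S @^-1` (@reversal G @^-1` (S @^-1` E)) = @reversal G @^-1` E.
Proof.
by apply/seteqP; split=> x /=; rewrite -{1}[shift (reversal (shift x))]reversalK reversal_shift.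
Qed.

Context (R : realType) (mu : probability T R).

Lemma exists_reversed_measure :
  exists mr : probability T R, forall E, mr E = mu (@reversal G @^-1` E).
Proof.
apply: exists_pushforward => _ E mE.
by rewrite setTI; exact: measurable_reversal.
Qed.

Hypothesis invS : invariant_measure S mu.
Context (mr : probability T R).
Hypothesis mrE : forall E, mr E = mu (@reversal G @^-1` E).

Lemma pr_reversed E : pr mr E = pr mu (@reversal G @^-1` E).
Proof. by rewrite /pr mrE. Qed.

Lemma reversed_markov_dyck : mu (markov_dyck G) = 1%E -> mr (markov_dyck G) = 1%E.
Proof.
rewrite mrE => <-; congr (mu _); apply/seteqP; split=> x /= /markov_dyck_reversal //.
by rewrite reversalK.
Qed.

Lemma reversed_invariant : invariant_measure S mr.
Proof.
move=> E mE; have mSE := measurable_reversal (measurable_shift_preimage mE).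
by rewrite !mrE -(invS mSE) shift_reversal_preimage.
Qed.

Lemma reversed_ergodic : ergodic S mu -> ergodic S mr.
Proof.
move=> erg E mE SE; rewrite !mrE; apply: erg; first exact: measurable_reversal.
by rewrite -[in LHS]SE shift_reversal_preimage.
Qed.

(** A word of the reversed process is a word at nonpositive times, read backwards and flipped; [F]
    recovers the latter. *)
Lemma reversed_entropy_rate :
  entropy_rate mu S (@coord G 0) <= entropy_rate mr S (@coord G 0).
Proof.
have mS := @measurable_shift_preimage G.
have mW n := @discrete_word _ _ _ mS n _ _ (@discrete_coord G 0).
have c1 := entropy_rate_cvg mS invS (@discrete_coord G 0).
have c2 := entropy_rate_cvg mS reversed_invariant (@discrete_coord G 0).
rewrite -cvg_shiftS in c1; rewrite -cvg_shiftS in c2.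
apply: (ler_cvg_to c1 c2); near=> n.
rewrite ler_pM2r ?invr_gt0 //.
pose F (w : n.+1.-tuple (letter G)) : n.+1.-tuple (letter G) :=
  [tuple of rev (map (@flip G) w)].
pose Z := word S (@coord G 0) n.+1 \o @reversal G.
have mZ : discrete Z by move=> w; rewrite comp_preimage; apply: measurable_reversal; exact: mW.
have -> : entropy mr (word S (@coord G 0) n.+1) = entropy mu Z.
  rewrite /entropy (_ : pmf mr _ = pmf mu Z) //; apply/funext => w.
  by rewrite /pmf pr_reversed.
have FZ : F \o Z = window (@coord G) (- n%:Z) n.+1.
  apply/funext => x; apply: val_inj.
  have Zx : Z x = factor (reversal x) 0 n.+1 by exact: word_shift.
  rewrite -[LHS]/(rev (map (@flip G) (Z x))) -[RHS]/(tval (factor x (- n%:Z) n.+1)) Zx.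
  rewrite factor_reversal map_rev revK -map_comp.
  rewrite (eq_map (g := id)); first rewrite map_id.
    by rewrite (_ : 1 - 0 - _ = - n%:Z) //; lia.
  by move=> a; rewrite /= flipK.
have -> : word S (@coord G 0) n.+1 = window (@coord G) (- n%:Z) n.+1 \o iter n S.
  apply/funext => x; rewrite word_shift; apply: eq_from_tnth => k; rewrite !tnth_mktuple.
  by rewrite /coord iter_shift; congr (x _); lia.
rewrite (entropy_iter mS invS n (@discrete_coord_window _ (- n%:Z) n.+1)) -FZ.
exact: entropy_comp.
Unshelve. all: by end_near.
Qed.

End ReversedMeasure.

(** * Growth of the language *)

Section LanguageGrowth.
Variables (N M : nat) (hN : (0 < N)%N) (hM : (0 < M)%N).
Local Notation G := (Ghat M hN).
Local Notation pair_code := (pair_code N M).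
Local Notation pair_edge := (pair_edge N M).
Local Notation T := (borel_full_shift G).
Local Notation S := (@shift G).
Let p0 : pair_edge := (Ordinal hN, Ordinal hM).

Lemma language_words n (w : n.-tuple (letter G)) : w \in language (markov_dyck G) n ->
  exists r bs ws, [/\ bs \in all_codes N M (n./2).+1,
    ws \in words_of (hN := hN) p0 [::] bs &
    w = [tuple nth point (flat ws) (nat_of_bool r + k) | k < n]].
Proof.
rewrite inE => /asboolP[x mx [i xw]].
(* If the word starts off V(0), the blocks start one letter earlier; [n./2 + 1] blocks cover at
   least [n + 1] letters. *)
pose r := ~~ at_root x i.
pose y : T := fun k => x (i - (nat_of_bool r)%:Z + k).
have my : markov_dyck G y.
  move=> j m m0; have := mx (i - (nat_of_bool r)%:Z + j) m m0.
  have -> // : factor x (i - (nat_of_bool r)%:Z + j) m = factor y j m.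
  by apply: eq_from_tnth => k; rewrite !tnth_mktuple /y; congr (x _); lia.
have ry : at_root y 0.
  rewrite /at_root /y addr0 -/(at_root x _) /r.
  case ri : (at_root x i) => /=; first by rewrite subr0.
  by have := at_root_succ (i - 1) mx; rewrite subrK ri => /esym/negbFE.
have [s bE] := blocks_decode hM my ry 0 (n./2).+1.
exists r, (slice (codes y) 0 (n./2).+1), (slice (block_at y) 0 (n./2).+1); split.
- by have := mem_all_codes (slice (codes y) 0 (n./2).+1); rewrite size_slice.
- by rewrite bE; exact: (mem_words_of _ _ [::]).
apply: eq_from_tnth => k; rewrite -xw !tnth_mktuple (flat_slice hM) nth_slice.
  by rewrite /y; congr (x _); lia.
by have := odd_double_half n; case: k => k /= kn; case: r {y my ry bE} => /=; lia.
Qed.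

Context (R : realType).
Local Notation B := (((N + 1) * (M + 1))%:R : R).
Local Notation K := ((N * M)%:R * (M%:R + 2) + N%:R : R).

Lemma card_language n :
  #|language (markov_dyck G) n|%:R <= 2 * (B ^+ (n./2).+1 * (1 + K * (n./2).+1%:R)).
Proof.
pose mk (r : bool) ws : n.-tuple (letter G) := [tuple nth point (flat ws) (r + k) | k < n].
pose W bs := words_of (hN := hN) p0 [::] bs.
pose L := [seq mk r ws | r <- [:: true; false],
  ws <- flatten [seq W bs | bs <- all_codes N M (n./2).+1]].
have sL : size L = (2 * \sum_(bs <- all_codes N M (n./2).+1) (N * M) ^ underflows 0 bs)%N.
  rewrite size_allpairs size_flatten /shape -map_comp sumnE big_map.
  by congr (_ * _)%N; apply: eq_bigr => bs _; rewrite /= size_words_of.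
have le_card : (#|language (markov_dyck G) n| <= size L)%N.
  apply: leq_trans (card_size L); apply/subset_leq_card/fintype.subsetP => w.
  move=> /language_words[r [bs [ws [bsl wsb ->]]]].
  apply/allpairsP; exists (r, ws); split=> //=; first by case: r.
  by apply/flattenP; exists (W bs) => //; apply/mapP; exists bs.
apply: (@le_trans _ _ (size L)%:R); first by rewrite ler_nat.
rewrite sL natrM ler_pM2l // natr_sum.
have := sum_underflows R hN hM (n./2).+1 0; rewrite expr0 mulr1 => /(le_trans _); apply.
by apply: ler_sum => bs _; rewrite natrX.
Qed.

(** The linear factor of [card_language] disappears after taking logarithms and dividing by [n]. *)
Lemma cvg_language : (forall n, n%:R * (ln B / 2) <= ln #|language (markov_dyck G) n|%:R) ->
  (fun n => ln #|language (markov_dyck G) n|%:R / n%:R) @ \oo --> ln B / 2.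
Proof.
move=> lower.
have B1 : 1 <= B by rewrite ler1n muln_gt0 !addn1.
have B0 : 0 < B by exact: lt_le_trans B1.
have lB : 0 <= ln B by exact: ln_ge0.
have K0 : 0 <= K by rewrite addr_ge0 // mulr_ge0 // addr_ge0.
apply/cvgrPdist_le => e e0.
(* The slope of the linear bound [ln y <= dl * y - 1 - ln dl], chosen so that [dl * K <= e / 2]; [C]
   collects the constants. *)
pose dl := e / (2 * (1 + K)).
have K1 : 0 < 2 * (1 + K) by lra.
have dl0 : 0 < dl by rewrite divr_gt0.
pose C : R := ln 2 + ln B + dl * (1 + K) - 1 - ln dl.
have /cvgrPdist_le /(_ (e / 2)) hC := cvg_div_natr C.
near=> n.
have n0 : 0 < n%:R :> R by rewrite ltr0n; near: n; exact: nbhs_infty_gt.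
have Cn : C / n%:R <= e / 2.
  have : `|0 - C / n%:R| <= e / 2 by near: n; apply: hC; rewrite divr_gt0.
  by rewrite sub0r normrN; apply: le_trans; exact: ler_norm.
have lo : ln B / 2 <= ln #|language (markov_dyck G) n|%:R / n%:R.
  by rewrite ler_pdivlMr // mulrC lower.
rewrite ler0_norm ?subr_le0 // opprB lerBlDr ler_pdivrMr //.
have l1 : (n./2).+1%:R <= n%:R / 2 + 1 :> R.
  rewrite -natr1 lerD2r ler_pdivlMr // -natrM ler_nat muln2.
  by rewrite -[leqRHS]odd_double_half leq_addl.
set l : R := (n./2).+1%:R in l1 *.
have l0 : 0 < l by [].
have Kl : 0 < 1 + K * l by rewrite ltr_pwDl // mulr_ge0 // ltW.
have ubound : ln #|language (markov_dyck G) n|%:R <= ln 2 + (l * ln B + ln (1 + K * l)).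
  have [->|L0] := posnP #|language (markov_dyck G) n|.
    rewrite ln0 //; apply: addr_ge0; first by rewrite ln_ge0 // ler1n.
    apply: addr_ge0; first by rewrite mulr_ge0 // ltW.
    by rewrite ln_ge0 // lerDl mulr_ge0 // ltW.
  have L1 : 0 < #|language (markov_dyck G) n|%:R :> R by rewrite ltr0n.
  rewrite (mulrC l) mulr_natr -lnXn // -!lnM ?posrE ?mulr_gt0 ?exprn_gt0 //.
  by rewrite ler_ln ?posrE ?mulr_gt0 ?exprn_gt0 //; exact: card_language.
apply: (le_trans ubound).
have lnd : ln (1 + K * l) + ln dl <= dl * (1 + K * l) - 1.
  rewrite -lnM ?posrE // mulrC -[X in ln X](subrK 1) addrC; apply: le_ln1Dx.
  by rewrite ltrBrDr addNr mulr_gt0.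
have h1 : l * ln B <= (n%:R / 2 + 1) * ln B by rewrite ler_wpM2r.
have h2 : dl * (K * l) <= dl * K * (n%:R / 2 + 1) by rewrite mulrA ler_wpM2l // mulr_ge0 // ltW.
have h3 : C <= e / 2 * n%:R by rewrite -ler_pdivrMr.
have h4 : dl * K <= e / 2.
  by rewrite /dl mulrAC ler_pdivrMr // mulrAC [2 * _]mulrC mulrA; nra.
have h5 : dl * K * (n%:R / 2) <= e / 2 * n%:R by nra.
rewrite /C in h3; lra.
Unshelve. all: by end_near.
Qed.

(** Serves twice: it bounds every entropy rate from above, and through the decoded measure it bounds
    the language from below. *)
Lemma entropy_language (mu : probability T R) n : pr mu (markov_dyck G) = 1 ->
  entropy mu (word S (@coord G 0) n) <= ln #|language (markov_dyck G) n|%:R.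
Proof.
move=> mu1; have mMD := @measurable_markov_dyck G.
have mW := @discrete_word _ _ _ (@measurable_shift_preimage G) n _ _ (@discrete_coord G 0).
rewrite cardE; apply: (entropy_count mW) => w.
rewrite mem_enum /pmf -(pr_setI1 (mW w) mMD mu1) => w0.
apply: contraT => wL; move: w0; rewrite (_ : _ `&` _ = set0) ?pr0 ?ltxx //.
apply/seteqP; split=> // x [/= xw mx]; move/negP: wL; apply.
by rewrite inE; apply/asboolP; exists x => //; exists 0; rewrite -xw word_shift.
Qed.

End LanguageGrowth.

(** * Kolmogorov-Sinai entropy as the rate of the letters *)

Section BorelEntropy.
Variable G : digraph.
Context (R : realType) (mu : probability (borel_full_shift G) R).
Hypothesis invS : invariant_measure (@shift G) mu.

Lemma measure_entropyE :
  measure_entropy (@shift G) mu = (entropy_rate mu (@shift G) (@coord G 0))%:E.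
Proof.
have mS := @measurable_shift_preimage G.
have mX := @discrete_coord G 0.
apply/eqP; rewrite eq_le; apply/andP; split.
  apply: ge_ereal_sup => _ [k [xi [mxi ->]]].
  rewrite (partition_entropyE mu mS) // lee_fin.
  exact: (entropy_rate_generator (@discrete_coord G) (@borel_generate G)).
(* Partitions are labelled by ordinals, so the letters are numbered. *)
pose xi := enum_rank \o @coord G 0.
have mxi : discrete xi by exact: (discrete_comp _ mX).
apply: (@le_trans _ _ (entropy_rate mu (@shift G) xi)%:E); last first.
  apply: ereal_sup_ubound; exists _, xi; split=> //.
  by rewrite (partition_entropyE mu mS).
rewrite lee_fin -[leRHS]addr0; apply: (le_entropy_rate mS invS (c := 0)) => // n.
rewrite mulr0 !addr0.
pose f (w : n.-tuple 'I_#|{: letter G}|) : n.-tuple (letter G) :=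
  [tuple enum_val (tnth w k) | k < n].
rewrite (_ : word (@shift G) (@coord G 0) n = f \o word (@shift G) xi n).
  by apply: entropy_comp; exact: (discrete_word mS).
apply/funext => x; apply: eq_from_tnth => k.
by rewrite /f /= !tnth_mktuple /xi /= enum_rankK.
Qed.

End BorelEntropy.

(** * Classification of the ergodic maximal measures *)

Section MaximalMeasures.
Variables (N M : nat) (hN : (0 < N)%N) (hM : (0 < M)%N).
Local Notation G := (Ghat M hN).
Local Notation pair_code := (pair_code N M).
Local Notation T := (borel_full_shift G).
Local Notation S := (@shift G).
Local Notation D := (decode_seq hN hM).

Definition unmatched_closing (i : int) : set T :=
  \bigcap_t unmatched_within (hN := hN) (M := M) t i.

Definition unmatched_opening (i : int) : set T :=
  @reversal G @^-1` unmatched_closing (- i).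

Lemma measurable_unmatched_closing i : measurable (unmatched_closing i).
Proof.
by apply: measurable_bigcap_count => t; exact: measurable_unmatched_within.
Qed.

Lemma unmatched_closing_shift i (x : T) :
  unmatched_closing i (S x) <-> unmatched_closing (i + 1) x.
Proof.
split=> h t _; first exact: (proj1 (@unmatched_within_shift N M hN hM t i 1 x) (h t I)).
exact: (proj2 (@unmatched_within_shift N M hN hM t i 1 x) (h t I)).
Qed.

Lemma unmatched_opening_shift i (x : T) :
  unmatched_opening i (S x) <-> unmatched_opening (i + 1) x.
Proof.
rewrite /unmatched_opening /= -[reversal x]/(reversal x).
have -> : reversal x = S (reversal (S x)) by rewrite -[RHS]reversalK reversal_shift.
rewrite unmatched_closing_shift (_ : - (i + 1) + 1 = - i) //; lia.
Qed.

Lemma letter_step_flip (a : letter G) : letter_step (flip a) = - letter_step a.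
Proof. by case: a. Qed.

(** If [j <= i], the sum of the steps from [j] to [i] would be positive, counted from the opening
    letter, and negative, counted back from the closing one. *)
Lemma unmatched_lt i j (x : T) :
  unmatched_closing i x -> unmatched_opening j x -> i < j.
Proof.
move=> Ui Vj; rewrite ltNge; apply/negP => ji.
pose r := `|i - j|%N.
have := Ui r I r (leqnn r); have := Vj r I r (leqnn r).
rewrite [X in X < 0](_ : _ = - \sum_(k < r.+1) letter_step (x (i - k%:Z))); first lia.
rewrite (reindex_inj rev_ord_inj) -sumrN; apply: eq_bigr => k _ /=.
rewrite /reversal letter_step_flip; congr (- letter_step (x _)).
by case: k => k /= kr; lia.
Qed.

Context (R : realType) (nu : probability (seq_space pair_code) R).
Hypothesis hNM : (1 < N * M)%N.
Hypothesis uniform_windows : forall i n w,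
  pmf nu (window (@seq_coord pair_code) i n) w = #|{: pair_code}|%:R^-1 ^+ n.
Local Notation h0 := (ln #|{: pair_code}|%:R / 2 : R).

Lemma maximal_measure_law (mu mr : probability T R) :
  mu (markov_dyck G) = 1%E -> invariant_measure S mu -> ergodic S mu ->
  h0 <= entropy_rate mu S (@coord G 0) -> (forall E, mr E = mu (@reversal G @^-1` E)) ->
  let law E := (pr nu (D @^-1` E) + pr nu (D @^-1` (S @^-1` E))) / 2 in
  (forall E, measurable E -> pr mu E = law E) \/ (forall E, measurable E -> pr mr E = law E).
Proof.
move=> mu1 invS erg rate mrE law.
have mS := @measurable_shift_preimage G.
have mO i : measurable (unmatched_opening i).
  by apply: measurable_reversal; exact: measurable_unmatched_closing.
have := ergodic_dichotomy invS erg measurable_unmatched_closing mO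
  unmatched_closing_shift unmatched_opening_shift unmatched_lt.
case=> U0; [left|right] => E mE.
  apply: matched_closings_law => //.
  by rewrite /pr mu1.
apply: matched_closings_law => //.
- by rewrite /pr (reversed_markov_dyck mrE).
- exact: reversed_invariant mrE.
- by rewrite (pr_reversed mrE) -[RHS]U0.
- by apply: (le_trans rate); exact: reversed_entropy_rate.
Qed.

(** The lower bound fixes the growth of the language at [h0]. No rate of an invariant measure on the
    shift exceeds this, so maximality is a single inequality. *)
Lemma max_entropy_measureP (mu : probability T R) :
  (forall n, n%:R * h0 <= ln #|language (markov_dyck G) n|%:R) ->
  topological_entropy R (markov_dyck G) = h0 /\
  (max_entropy_measure mu <-> [/\ mu (markov_dyck G) = 1%E, invariant_measure S mu
    & h0 <= entropy_rate mu S (@coord G 0)]).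
Proof.
move=> lower; have mS := @measurable_shift_preimage G.
have mX := @discrete_coord G 0.
have cl : (fun n => ln #|language (markov_dyck G) n|%:R / n%:R) @ \oo --> h0.
  by move: lower; rewrite card_pair_code; exact: cvg_language.
have topE : topological_entropy R (markov_dyck G) = h0 by exact: cvg_lim cl.
split=> //; split=> [[mu1 invS]|[mu1 invS rate]].
  by rewrite topE measure_entropyE // => -[rE]; split=> //; rewrite rE.
split=> //; rewrite topE measure_entropyE //; congr EFin.
apply/eqP; rewrite eq_le rate andbT.
apply: (ler_cvg_to (entropy_rate_cvg mS invS mX) cl); near=> n.
by rewrite ler_pM2r ?invr_gt0 ?ltr0n;
  [apply: entropy_language; rewrite /pr mu1|near: n; exact: nbhs_infty_gt].
Unshelve. all: by end_near.
Qed.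

End MaximalMeasures.


Theorem theorem3p2 (R : realType) (N M : nat) (hN : (0 < N)%N) (hM : (0 < M)%N)
    (hNM : (1 < N * M)%N) :
  (exists mu1 mu2 : probability (borel_full_shift (Ghat M hN)) R,
    [/\ ~ same_measure mu1 mu2,
        ergodic_max_entropy_measure mu1,
        ergodic_max_entropy_measure mu2
      & forall mu : probability (borel_full_shift (Ghat M hN)) R,
          ergodic_max_entropy_measure mu ->
          same_measure mu mu1 \/ same_measure mu mu2])
  /\ topological_entropy R (markov_dyck (Ghat M hN))
     = 2%:R^-1 * (ln (N + 1)%:R + ln (M + 1)%:R).
Proof.
have [nu /window_law nuW] := exists_uniform_bernoulli R (pair_code N M).
have [m1 m1E] := exists_root_measure hN hM nu.
have [m2 m2E] := exists_reversed_measure m1.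
have m1MD := root_measure_markov_dyck hNM nuW m1E.
have m1inv := root_measure_invariant nuW m1E.
have m1rate := root_measure_entropy_rate hNM nuW m1E.
have m1erg := root_measure_ergodic nuW m1E.
have m1MD' : m1 (markov_dyck (Ghat M hN)) = 1%E.
  by rewrite prE ?m1MD //; exact: measurable_markov_dyck.
have lower n : n%:R * (ln #|{: pair_code N M}|%:R / 2) <=
    ln #|language (markov_dyck (Ghat M hN)) n|%:R :> R.
  have [->|n0] := posnP n; first rewrite mul0r.
    have [->|] := posnP #|language (markov_dyck (Ghat M hN)) 0|; first by rewrite ln0.
    by move=> k0; rewrite ln_ge0 // ler1n.
  apply: (le_trans _ (entropy_language n m1MD)); rewrite mulrC -ler_pdivlMr ?ltr0n //.
  apply: (le_trans m1rate); apply: entropy_rate_le => //.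
  - exact: measurable_shift_preimage.
  - exact: discrete_coord.
have max mu := max_entropy_measureP hM mu lower.
split; last first.
  rewrite (max m1).1 card_pair_code natrM lnM ?posrE ?ltr0n ?addn1 // mulrC.
  by [].
have m1max : ergodic_max_entropy_measure m1 by split=> //; apply/(max m1).2.
have m2max : ergodic_max_entropy_measure m2.
  split; last exact: (reversed_ergodic m2E).
  apply/(max m2).2; split; first exact: reversed_markov_dyck.
    exact: reversed_invariant m2E.
  by apply: (le_trans m1rate); exact: reversed_entropy_rate.
exists m1, m2; split=> //.
- move=> m12.
  have mC : measurable [set x : borel_full_shift (Ghat M hN) | closing (coord 0 x)].
    exact: (discrete_pred (@closing N M hN) (@discrete_coord (Ghat M hN) 0)).
  have cE := root_measure_closing hNM nuW m1E.
  (* Reversal keeps position 0 and exchanges opening and closing letters, so equal measures would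
     close with probability 1/2. *)
  have e : pr m1 [set x | closing (coord 0 x)] = 1 - pr m1 [set x | closing (coord 0 x)].
    rewrite -prC // {1}/pr (m12 _ mC) m2E; congr (fine (m1 _)).
    by apply/seteqP; split=> x /=; rewrite /coord /reversal oppr0; case: (x 0).
  have N0 : (N.+1)%:R != 0 :> R by rewrite pnatr_eq0.
  have M0 : (M.+1)%:R != 0 :> R by rewrite pnatr_eq0.
  (* After clearing denominators this is exactly [N * M > 1]. *)
  have NM : (N.+1)%:R^-1 + (M.+1)%:R^-1 < 1 :> R.
    rewrite -[_^-1]mul1r -[X in _ + X]mul1r addf_div // !mul1r -natrD -natrM.
    by rewrite ltr_pdivrMr ?ltr0n // mul1r ltr_nat; nia.
  move: NM e; rewrite cE; move: (N.+1%:R^-1 + M.+1%:R^-1) => s; clear.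
  by move=> s1 s2; lra.
move=> mu [/(max mu).2 [muMD inv rate] erg].
have [mr mrE] := exists_reversed_measure mu.
have [law|law] := maximal_measure_law hM hNM nuW muMD inv erg rate mrE; [left|right] => E mE.
  by rewrite !prE ?law ?m1E.
have mrev := measurable_reversal mE.
(* Here the reversal of [mu] has the law of [m1]; reversing once more gives [m2]. *)
rewrite m2E (_ : mu E = mr (@reversal _ @^-1` E)).
  by rewrite !prE // law // m1E.
by rewrite mrE; congr (mu _); apply/seteqP; split=> x /=; rewrite reversalK.
Qed.
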